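(* Let $\mathbb{D}$ be the open unit disc in $\mathbb{C}$ and let $\varphi:\mathbb{D}\to\mathbb{D}$ be holomorphic. Let $C_\varphi:H^\infty(\mathbb{D})\to H^\infty(\mathbb{D})$, $C_\varphi f=f\circ\varphi$. The following are equivalent: (i) $C_\varphi$ is mean ergodic on $H^\infty(\mathbb{D})$; (i') $C_\varphi$ is uniformly mean ergodic on $H^\infty(\mathbb{D})$; (ii) either $\varphi$ has a Denjoy-Wolff point $z_0$ lying in the open disc $\mathbb{D}$ and $(\varphi^n)_n$ converges to $z_0$ uniformly on $\mathbb{D}$, or $\varphi$ is a periodic elliptic automorphism.
   Context: $H^\infty(\mathbb{D})$ is the Banach space of bounded holomorphic functions on $\mathbb{D}$ with the norm $\|f\|_\infty=\sup_{z\in\mathbb{D}}|f(z)|$. $\varphi^n=\varphi\circ\cdots\circ\varphi$ ($n$ times). A bounded operator $T$ on a Banach space $X$ is mean ergodic if the Cesàro means $T_{[n]}=\frac1n\sum_{m=1}^nT^m$ converge in the strong operator topology to some bounded operator on $X$, and uniformly mean ergodic if they converge in operator norm. An elliptic automorphism is a bijective holomorphic self-map of $\mathbb{D}$ of the form $\phi\circ\varphi_\lambda\circ\phi^{-1}$ with $\phi$ an automorphism of $\mathbb{D}$ and $\varphi_\lambda(z)=\lambda z$, $|\lambda|=1$ (the identity, $\lambda=1$, is included); it is periodic if $\lambda^k=1$ for some integer $k\ge1$, i.e. some iterate of it is the identity. If a holomorphic self-map $\varphi$ of $\mathbb{D}$ is not an elliptic automorphism (in particular not the identity), the Denjoy-Wolff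 theorem gives a unique point $z_0\in\overline{\mathbb{D}}$, the Denjoy-Wolff point of $\varphi$, such that $\varphi^n\to z_0$ uniformly on compact subsets of $\mathbb{D}$. *)

(* Defs.v *)
(* Stdlib real numbers, with Coquelicot's complex numbers and normed modules. *)
From Stdlib Require Import Reals Lra Lia List.
From Stdlib Require Import Classical FunctionalExtensionality ProofIrrelevance.
From Coquelicot Require Import Coquelicot.
Set Implicit Arguments.
Unset Strict Implicit.
Unset Printing Implicit Defensive.
Open Scope R_scope.

Definition cesaro_mean (X : NormedModule C_AbsRing) (T : X -> X) (n : nat)
  (x : X) : X :=
  scal (RtoC (/ INR n) : C_AbsRing)
    (sum_n_m (fun m => Nat.iter m T x) 1 n).

Definition operator_norm (X : NormedModule C_AbsRing) (T : X -> X) : R :=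
  real (Lub_Rbar (fun r => exists x : X, norm x <= 1 /\ r = norm (T x))).

(* [is_linear] is Coquelicot's predicate of bounded linear operators. *)
Definition mean_ergodic (X : NormedModule C_AbsRing) (T : X -> X) : Prop :=
  is_linear T /\
  exists P : X -> X, is_linear P /\
    forall x : X,
      filterlim (fun n => cesaro_mean T n x)
        eventually (locally (P x)).

Definition uniformly_mean_ergodic (X : NormedModule C_AbsRing) (T : X -> X)
  : Prop :=
  is_linear T /\
  exists P : X -> X, is_linear P /\
    is_lim_seq
      (fun n => operator_norm
         (fun x => minus (cesaro_mean T n x) (P x)))
      0.

Definition unit_disc (z : C) : Prop := Cmod z < 1.
Definition closed_unit_disc (z : C) : Prop := Cmod z <= 1.

(* Maps on the disc are total maps on [C] of which only the values on the disc
   matter. As the disc is open, complex differentiability of the total map at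
   a point of the disc only depends on its values there. *)
Definition holomorphic_on_disc (f : C -> C) : Prop :=
  forall z, unit_disc z -> ex_derive (K := C_AbsRing) (V := C_NormedModule) f z.

Definition self_map (phi : C -> C) : Prop :=
  (forall z, unit_disc z -> unit_disc (phi z)) /\ holomorphic_on_disc phi.

Definition disc_automorphism (h : C -> C) : Prop :=
  self_map h /\
  (forall z w, unit_disc z -> unit_disc w -> h z = h w -> z = w) /\
  (forall w, unit_disc w -> exists z, unit_disc z /\ h z = w).

(* [k] is the inverse of [h] on the disc, and its values elsewhere are free. *)
Definition elliptic_with (phi : C -> C) (lambda : C) : Prop :=
  disc_automorphism phi /\
  Cmod lambda = 1 /\
  exists h k : C -> C,
    disc_automorphism h /\
    (forall z, unit_disc z -> unit_disc (k z) /\ h (k z) = z) /\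
    (forall z, unit_disc z -> phi z = h (lambda * k z)%C).

Definition elliptic_automorphism (phi : C -> C) : Prop :=
  exists lambda, elliptic_with phi lambda.

Definition periodic_elliptic_automorphism (phi : C -> C) : Prop :=
  exists lambda, elliptic_with phi lambda /\
    exists n : nat, (1 <= n)%nat /\ (lambda ^ n)%C = RtoC 1.

Definition compact_set (A : C -> Prop) : Prop :=
  forall (I : Type) (U : I -> C -> Prop),
    (forall i, open (U i)) ->
    (forall z, A z -> exists i, U i z) ->
    exists l : list I, forall z, A z -> exists i, In i l /\ U i z.

Definition iterates_converge_uniformly_on
  (A : C -> Prop) (phi : C -> C) (z0 : C) : Prop :=
  forall eps : R, 0 < eps ->
    exists N : nat, forall n : nat, (N <= n)%nat ->
      forall z, A z -> Cmod (Nat.iter n phi z - z0)%C < eps.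

Definition denjoy_wolff_point (phi : C -> C) (z0 : C) : Prop :=
  ~ elliptic_automorphism phi /\
  closed_unit_disc z0 /\
  forall A : C -> Prop, compact_set A -> (forall z, A z -> unit_disc z) ->
    iterates_converge_uniformly_on A phi z0.

(* Each function on the disc is represented by its extension by zero, so that
   Leibniz equality is equality of functions on the disc. *)
Record Hinf : Type := MkHinf {
  Hinf_fun :> C -> C;
  Hinf_holomorphic : holomorphic_on_disc Hinf_fun;
  Hinf_bounded : exists M : R, forall z, unit_disc z -> Cmod (Hinf_fun z) <= M;
  Hinf_outside : forall z, ~ unit_disc z -> Hinf_fun z = RtoC 0
}.

Lemma Hinf_ext (f g : Hinf) : (forall z, unit_disc z -> f z = g z) -> f = g.
Proof.
intros H.
destruct f as [f f1 f2 f3], g as [g g1 g2 g3]; simpl in H.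
assert (E : f = g).
{ apply functional_extensionality; intro z.
  destruct (classic (unit_disc z)) as [Hz|Hz]; [now apply H|].
  now rewrite f3, g3. }
subst g; f_equal; apply proof_irrelevance.
Qed.

(* Coquelicot has two normed modules over the complex field with carrier [C];
   they have the same norm, and give the same derivatives. *)
Lemma is_derive_C_AbsRing (f : C -> C) (z l : C) :
  is_derive (K := C_AbsRing) (V := C_NormedModule) f z l <->
  is_derive (K := C_AbsRing) (V := AbsRing_NormedModule C_AbsRing) f z l.
Proof.
split; intros [[H1 H2 H3] H4]; split; try (split; assumption); exact H4.
Qed.

Lemma locally_unit_disc (z : C) :
  unit_disc z -> locally (T := AbsRing_UniformSpace C_AbsRing) z unit_disc.
Proof.
intros Hz; unfold unit_disc in *.
assert (He : 0 < 1 - Cmod z) by lra.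
exists (mkposreal _ He); intros w Hw.
change (Cmod (minus w z) < 1 - Cmod z) in Hw.
replace w with (plus (minus w z) z).
- eapply Rle_lt_trans; [apply (Cmod_triangle (minus w z) z)|lra].
- unfold minus; rewrite <- plus_assoc, plus_opp_l; apply plus_zero_r.
Qed.

Definition extend_by_zero (f : C -> C) (z : C) : C :=
  if Rlt_dec (Cmod z) 1 then f z else RtoC 0.

Lemma extend_in f z : unit_disc z -> extend_by_zero f z = f z.
Proof.
unfold extend_by_zero, unit_disc; intros Hz.
destruct (Rlt_dec (Cmod z) 1); [easy|contradiction].
Qed.

Lemma extend_out f z : ~ unit_disc z -> extend_by_zero f z = RtoC 0.
Proof.
unfold extend_by_zero, unit_disc; intros Hz.
destruct (Rlt_dec (Cmod z) 1); [contradiction|easy].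
Qed.

Lemma extend_holomorphic f :
  holomorphic_on_disc f -> holomorphic_on_disc (extend_by_zero f).
Proof.
intros Hf z Hz; destruct (Hf z Hz) as [l Hl]; exists l.
apply (is_derive_ext_loc (K := C_AbsRing) (V := C_NormedModule) f); [|exact Hl].
apply (filter_imp unit_disc); [|now apply locally_unit_disc].
now intros w Hw; rewrite extend_in.
Qed.

Lemma extend_bounded f :
  (exists M : R, forall z, unit_disc z -> Cmod (f z) <= M) ->
  exists M : R, forall z, unit_disc z -> Cmod (extend_by_zero f z) <= M.
Proof.
intros [M HM]; exists M; intros z Hz; rewrite extend_in; auto.
Qed.

Definition Hinf_make (f : C -> C) (Hf : holomorphic_on_disc f)
  (Bf : exists M : R, forall z, unit_disc z -> Cmod (f z) <= M) : Hinf :=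
  MkHinf (extend_holomorphic Hf) (extend_bounded Bf) (extend_out f).

Lemma Hinf_makeE f Hf Bf z : unit_disc z -> @Hinf_make f Hf Bf z = f z.
Proof. apply extend_in. Qed.

Lemma Hinf_plus_holo (f g : Hinf) :
  holomorphic_on_disc (fun z => f z + g z)%C.
Proof.
intros z Hz.
destruct (Hinf_holomorphic f Hz) as [l Hl], (Hinf_holomorphic g Hz) as [m Hm].
eexists; exact (is_derive_plus (K := C_AbsRing) (V := C_NormedModule)
  _ _ _ _ _ Hl Hm).
Qed.

Lemma Hinf_plus_bounded (f g : Hinf) :
  exists M : R, forall z, unit_disc z -> Cmod (f z + g z)%C <= M.
Proof.
destruct (Hinf_bounded f) as [M HM], (Hinf_bounded g) as [N HN].
exists (M + N); intros z Hz; specialize (HM z Hz); specialize (HN z Hz).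
eapply Rle_trans; [apply Cmod_triangle|lra].
Qed.

Lemma Hinf_scal_holo (c : C) (f : Hinf) :
  holomorphic_on_disc (fun z => c * f z)%C.
Proof.
intros z Hz; destruct (Hinf_holomorphic f Hz) as [l Hl].
eexists; apply is_derive_C_AbsRing; apply is_derive_C_AbsRing in Hl.
exact (is_derive_mult (K := C_AbsRing) (fun _ => c) f z zero l
  (is_derive_const (K := C_AbsRing) (V := AbsRing_NormedModule C_AbsRing) c z)
  Hl Cmult_comm).
Qed.

Lemma Hinf_scal_bounded (c : C) (f : Hinf) :
  exists M : R, forall z, unit_disc z -> Cmod (c * f z)%C <= M.
Proof.
destruct (Hinf_bounded f) as [M HM].
exists (Cmod c * M); intros z Hz; rewrite Cmod_mult.
apply Rmult_le_compat_l; [apply Cmod_ge_0|auto].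
Qed.

Lemma zero_holo : holomorphic_on_disc (fun _ => RtoC 0).
Proof.
intros z _; eexists.
exact (is_derive_const (K := C_AbsRing) (V := C_NormedModule) (RtoC 0) z).
Qed.

Lemma zero_bounded :
  exists M : R, forall z : C, unit_disc z -> Cmod (RtoC 0) <= M.
Proof. exists (Cmod (RtoC 0)); intros; apply Rle_refl. Qed.

Definition Hinf_zero : Hinf := Hinf_make zero_holo zero_bounded.
Definition Hinf_plus (f g : Hinf) : Hinf :=
  Hinf_make (@Hinf_plus_holo f g) (Hinf_plus_bounded f g).
Definition Hinf_scal (c : C) (f : Hinf) : Hinf :=
  Hinf_make (@Hinf_scal_holo c f) (Hinf_scal_bounded c f).
Definition Hinf_opp (f : Hinf) : Hinf := Hinf_scal (RtoC (-1)) f.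

Definition Hinf_norm (f : Hinf) : R :=
  real (Lub_Rbar (fun r => exists z, unit_disc z /\ r = Cmod (f z))).

Lemma unit_disc_0 : unit_disc (RtoC 0).
Proof. unfold unit_disc; rewrite Cmod_0; lra. Qed.

Lemma Hinf_norm_lub (f : Hinf) :
  is_lub_Rbar (fun r => exists z, unit_disc z /\ r = Cmod (f z)) (Hinf_norm f).
Proof.
unfold Hinf_norm; set (E := fun r => _).
assert (H := Lub_Rbar_correct E).
destruct (Hinf_bounded f) as [M HM].
destruct (Lub_Rbar E) as [r| |] eqn:Er; [exact H| |]; exfalso.
- apply (proj2 H (Finite M)); intros x [z [Hz ->]]; simpl; auto.
- apply (proj1 H (Cmod (f (RtoC 0)))); exists (RtoC 0); split; [|easy].
  exact unit_disc_0.
Qed.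

Lemma Hinf_norm_ge (f : Hinf) z : unit_disc z -> Cmod (f z) <= Hinf_norm f.
Proof.
intros Hz; apply (proj1 (Hinf_norm_lub f) (Cmod (f z))); now exists z.
Qed.

Lemma Hinf_norm_le (f : Hinf) (M : R) :
  (forall z, unit_disc z -> Cmod (f z) <= M) -> Hinf_norm f <= M.
Proof.
intros H; apply (proj2 (Hinf_norm_lub f) (Finite M)).
intros x [z [Hz ->]]; simpl; auto.
Qed.

Lemma Hinf_plusC f g : Hinf_plus f g = Hinf_plus g f.
Proof.
apply Hinf_ext; intros z Hz; unfold Hinf_plus.
rewrite !Hinf_makeE by easy; apply Cplus_comm.
Qed.

Lemma Hinf_plusA f g h :
  Hinf_plus f (Hinf_plus g h) = Hinf_plus (Hinf_plus f g) h.
Proof.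
apply Hinf_ext; intros z Hz; unfold Hinf_plus.
rewrite !Hinf_makeE by easy; apply Cplus_assoc.
Qed.

Lemma Hinf_plus0 f : Hinf_plus f Hinf_zero = f.
Proof.
apply Hinf_ext; intros z Hz; unfold Hinf_plus, Hinf_zero.
rewrite !Hinf_makeE by easy; apply Cplus_0_r.
Qed.

Lemma Hinf_plus_opp f : Hinf_plus f (Hinf_opp f) = Hinf_zero.
Proof.
apply Hinf_ext; intros z Hz; unfold Hinf_plus, Hinf_opp, Hinf_scal, Hinf_zero.
rewrite !Hinf_makeE by easy.
replace (RtoC (-1)) with (- RtoC 1)%C by (now rewrite <- RtoC_opp); ring.
Qed.

Definition Hinf_AbelianMonoid_mixin :=
  AbelianMonoid.Mixin Hinf Hinf_plus Hinf_zero Hinf_plusC Hinf_plusA Hinf_plus0.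

Canonical Hinf_AbelianMonoid :=
  AbelianMonoid.Pack Hinf Hinf_AbelianMonoid_mixin Hinf.

Definition Hinf_AbelianGroup_mixin :=
  AbelianGroup.Mixin Hinf_AbelianMonoid Hinf_opp Hinf_plus_opp.

Canonical Hinf_AbelianGroup :=
  AbelianGroup.Pack Hinf
    (AbelianGroup.Class _ Hinf_AbelianMonoid_mixin Hinf_AbelianGroup_mixin)
    Hinf.

Lemma Hinf_scalA (a b : C_Ring) (f : Hinf) :
  Hinf_scal a (Hinf_scal b f) = Hinf_scal (mult a b) f.
Proof.
apply Hinf_ext; intros z Hz; unfold Hinf_scal.
rewrite !Hinf_makeE by easy; apply Cmult_assoc.
Qed.

Lemma Hinf_scal1 (f : Hinf) : Hinf_scal (one (K := C_Ring)) f = f.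
Proof.
apply Hinf_ext; intros z Hz; unfold Hinf_scal.
rewrite !Hinf_makeE by easy; apply Cmult_1_l.
Qed.

Lemma Hinf_scalDr (a : C_Ring) (f g : Hinf) :
  Hinf_scal a (Hinf_plus f g) = Hinf_plus (Hinf_scal a f) (Hinf_scal a g).
Proof.
apply Hinf_ext; intros z Hz; unfold Hinf_scal, Hinf_plus.
rewrite !Hinf_makeE by easy; apply Cmult_plus_distr_l.
Qed.

Lemma Hinf_scalDl (a b : C_Ring) (f : Hinf) :
  Hinf_scal (plus a b) f = Hinf_plus (Hinf_scal a f) (Hinf_scal b f).
Proof.
apply Hinf_ext; intros z Hz; unfold Hinf_scal, Hinf_plus.
rewrite !Hinf_makeE by easy; apply Cmult_plus_distr_r.
Qed.

Definition Hinf_ModuleSpace_mixin :=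
  ModuleSpace.Mixin C_Ring Hinf_AbelianGroup Hinf_scal
    Hinf_scalA Hinf_scal1 Hinf_scalDr Hinf_scalDl.

Canonical Hinf_ModuleSpace :=
  ModuleSpace.Pack C_Ring Hinf
    (ModuleSpace.Class _ _ (AbelianGroup.class Hinf_AbelianGroup)
       Hinf_ModuleSpace_mixin)
    Hinf.

Lemma zero_HinfE z : unit_disc z -> (zero : Hinf) z = RtoC 0.
Proof. apply (Hinf_makeE zero_holo zero_bounded). Qed.

Lemma plus_HinfE (f g : Hinf) z : unit_disc z -> (plus f g) z = (f z + g z)%C.
Proof. apply (Hinf_makeE (@Hinf_plus_holo f g) (Hinf_plus_bounded f g)). Qed.

Lemma scal_HinfE (c : C_Ring) (f : Hinf) z :
  unit_disc z -> (scal c f : Hinf) z = (c * f z)%C.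
Proof. apply (Hinf_makeE (@Hinf_scal_holo c f) (Hinf_scal_bounded c f)). Qed.

Definition Hinf_ball (f : Hinf) (eps : R) (g : Hinf) : Prop :=
  Hinf_norm (minus g f) < eps.

Lemma Hinf_norm_triangle (f g : Hinf) :
  Hinf_norm (plus f g) <= Hinf_norm f + Hinf_norm g.
Proof.
apply Hinf_norm_le; intros z Hz.
rewrite plus_HinfE by easy; eapply Rle_trans; [apply Cmod_triangle|].
apply Rplus_le_compat; now apply Hinf_norm_ge.
Qed.

Lemma Hinf_norm_scal (c : C_AbsRing) (f : Hinf) :
  Hinf_norm (Hinf_scal c f) <= abs c * Hinf_norm f.
Proof.
apply Hinf_norm_le; intros z Hz; unfold Hinf_scal.
rewrite Hinf_makeE by easy; rewrite Cmod_mult.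
apply Rmult_le_compat_l; [apply Cmod_ge_0|now apply Hinf_norm_ge].
Qed.

Lemma Hinf_norm_zero_eq (f : Hinf) : Hinf_norm f = 0 -> f = zero.
Proof.
intros H; apply Hinf_ext; intros z Hz.
rewrite zero_HinfE by easy.
apply Cmod_eq_0; apply Rle_antisym; [|apply Cmod_ge_0].
rewrite <- H; now apply Hinf_norm_ge.
Qed.

Lemma Hinf_ball_center (f : Hinf) (e : posreal) : Hinf_ball f e f.
Proof.
unfold Hinf_ball; rewrite minus_eq_zero.
eapply Rle_lt_trans; [|apply (cond_pos e)].
apply Hinf_norm_le; intros z Hz.
rewrite zero_HinfE, Cmod_0 by easy; apply Rle_refl.
Qed.

Lemma Hinf_ball_sym (f g : Hinf) (e : R) : Hinf_ball f e g -> Hinf_ball g e f.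
Proof.
unfold Hinf_ball; intros H; eapply Rle_lt_trans; [|exact H].
rewrite <- (opp_minus g f).
eapply Rle_trans; [apply (Hinf_norm_scal (RtoC (-1)))|].
change (abs (RtoC (-1))) with (Cmod (RtoC (-1))).
rewrite Cmod_R, Rabs_m1; lra.
Qed.

Lemma Hinf_ball_triangle (f g h : Hinf) (e1 e2 : R) :
  Hinf_ball f e1 g -> Hinf_ball g e2 h -> Hinf_ball f (e1 + e2) h.
Proof.
unfold Hinf_ball; intros H1 H2.
rewrite (minus_trans g h f).
eapply Rle_lt_trans; [apply Hinf_norm_triangle|lra].
Qed.

Definition Hinf_UniformSpace_mixin :=
  UniformSpace.Mixin Hinf Hinf_zero Hinf_ball
    Hinf_ball_center Hinf_ball_sym Hinf_ball_triangle.

Canonical Hinf_UniformSpace :=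
  UniformSpace.Pack Hinf Hinf_UniformSpace_mixin Hinf.

Canonical Hinf_NormedModuleAux :=
  NormedModuleAux.Pack C_AbsRing Hinf
    (NormedModuleAux.Class C_AbsRing _ (ModuleSpace.class C_Ring Hinf_ModuleSpace)
       Hinf_UniformSpace_mixin)
    Hinf.

Lemma Hinf_norm_ball1 (f g : Hinf) (eps : R) :
  Hinf_norm (minus g f) < eps -> Hinf_ball f eps g.
Proof. easy. Qed.

Lemma Hinf_norm_ball2 (f g : Hinf) (eps : posreal) :
  Hinf_ball f eps g -> Hinf_norm (minus g f) < 1 * eps.
Proof. now rewrite Rmult_1_l. Qed.

Definition Hinf_NormedModule_mixin :=
  NormedModule.Mixin C_AbsRing Hinf_NormedModuleAux Hinf_norm 1
    Hinf_norm_triangle Hinf_norm_scal Hinf_norm_ball1 Hinf_norm_ball2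
    Hinf_norm_zero_eq.

Canonical Hinf_NormedModule :=
  NormedModule.Pack C_AbsRing Hinf
    (NormedModule.Class C_AbsRing _
       (NormedModuleAux.class C_AbsRing Hinf_NormedModuleAux)
       Hinf_NormedModule_mixin)
    Hinf.

Lemma comp_holo (phi : C -> C) (f : Hinf) :
  self_map phi -> holomorphic_on_disc (fun z => f (phi z)).
Proof.
intros [Hd Hp] z Hz.
destruct (Hp z Hz) as [m Hm]; apply is_derive_C_AbsRing in Hm.
destruct (Hinf_holomorphic f (Hd z Hz)) as [l Hl].
eexists.
exact (is_derive_comp (K := C_AbsRing) (V := C_NormedModule) f phi z l m Hl Hm).
Qed.

Lemma comp_bounded (phi : C -> C) (f : Hinf) :
  self_map phi -> exists M : R, forall z, unit_disc z -> Cmod (f (phi z)) <= M.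
Proof.
intros [Hd _]; destruct (Hinf_bounded f) as [M HM]; exists M; auto.
Qed.

Definition composition_operator (phi : C -> C) (Hphi : self_map phi)
  (f : Hinf) : Hinf :=
  Hinf_make (comp_holo f Hphi) (comp_bounded f Hphi).

Lemma composition_operatorE phi (Hphi : self_map phi) f z :
  unit_disc z -> composition_operator Hphi f z = f (phi z).
Proof. apply (extend_in (fun z => f (phi z))). Qed.

Lemma composition_operator_is_linear phi (Hphi : self_map phi) :
  is_linear (composition_operator Hphi).
Proof.
assert (Hd := proj1 Hphi).
split.
- intros f g; apply Hinf_ext; intros z Hz.
  rewrite composition_operatorE, !plus_HinfE, !composition_operatorE; auto.
- intros c f; apply Hinf_ext; intros z Hz.
  rewrite composition_operatorE, !scal_HinfE, !composition_operatorE; auto.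
- exists 1; split; [lra|]; intros f; rewrite Rmult_1_l.
  apply Hinf_norm_le; intros z Hz; rewrite composition_operatorE by easy.
  exact (Hinf_norm_ge f (Hd z Hz)).
Qed.

(* Main.v *)
(* Test functions in H^oo turn mean ergodicity into information on orbits.
   - If phi has a fixed point in the disc, move it to 0. When |phi'(0)| = 1, phi
     is a rotation by some lambda; if lambda is not a root of unity, then the
     Cesaro limits are constant, whereas f = h / (1 + h), with h a series of
     Poisson kernels with masses at the powers of lambda, tends to 1 at each
     lambda^m while |f(0)| <= 1/2. When |phi'(0)| < 1, the maximum principle gives
     |phi(z)|^k <= |z|^(k+1) near the circle, so that 1 - |phi^j(z)| grows
     geometrically along an orbit which stays near the circle. If phi^n did not
     tend to 0 uniformly, there would be arbitrarily long orbit segments near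
     the circle, on which one such f, with f(0) close to 0, is close to 1.
   - If phi has no fixed point in the disc, then Wolff's lemma provides zeta on
     the circle with Re W(phi(z)) >= Re W(z), W = (zeta + z) / (zeta - z), and
     W(phi^n(0)) tends to infinity. A bounded function oscillating slowly
     between 0 and 1 as W tends to infinity has Cesaro means at 0 which diverge. *)
Require Import Defs.
From Stdlib Require Import Reals Lra Lia Classical ClassicalEpsilon.
From Coquelicot Require Import Coquelicot.
Open Scope R_scope.

(** * Goursat's theorem for rectangles *)

(** Mean ergodicity gives convergence in the sup norm, so the means may be evaluated at starting
    points that depend on [n]. Both contradictions at a fixed point rest on this: the Cesaro limit
    is constant and equal to f(0), while from a suitable point near the circle the first n iterates
    all lie where f is near 1. The obstacle is that the kernels must be large along whole orbit
    segments and yet have small total mass, since at 0 they add up to the sum of their masses. A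
    kernel of mass proportional to 1 - |w|^2 is large at w, so a segment that leaves the circle
    geometrically fast costs only a multiple of its last mass; this is the role of the inequality
    |phi|^k <= |z|^(k+1).

    The function theory rests on the mean value property, obtained from Goursat's theorem in
    logarithmic polar coordinates. It is proved for functions that are merely continuous at the
    centre, so quotients such as f(z)/z are treated without power series. Schwarz-Pick takes the
    place of Cauchy estimates, also in the converse direction, where it makes the unit ball of H^oo
    equi-Lipschitz near the fixed point. *)

Lemma nested_intervals (a b : nat -> R) :
  (forall n, a n <= a (S n)) -> (forall n, b (S n) <= b n) ->
  (forall n, a n <= b n) -> exists x, forall n, a n <= x <= b n.
Proof.
intros Ha Hb Hab.
assert (Ha' : forall n m, (n <= m)%nat -> a n <= a m)
  by (induction 1; [lra|specialize (Ha m); lra]).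
assert (Hb' : forall n m, (n <= m)%nat -> b m <= b n)
  by (induction 1; [lra|specialize (Hb m); lra]).
assert (Hx : forall n m, a n <= b m).
{ intros n m; destruct (Nat.le_ge_cases n m) as [H|H].
  - specialize (Ha' _ _ H); specialize (Hab m); lra.
  - specialize (Hb' _ _ H); specialize (Hab n); lra. }
destruct (completeness (fun r => exists n, r = a n)) as [x [H1 H2]].
- exists (b O); intros r [n ->]; apply Hx.
- exists (a O); now exists O.
- exists x; intros n; split; [apply H1; now exists n|].
  apply H2; intros r [m ->]; apply Hx.
Qed.

(** The invariant [P] travels in a sigma type, because the choice at each step needs the proof that
    it holds; [Q] records how successive choices are related. *)
Lemma dependent_choice (A : Type) (P : nat -> A -> Prop)
  (Q : nat -> A -> A -> Prop) (x0 : A) :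
  P O x0 -> (forall n x, P n x -> exists y, P (S n) y /\ Q n x y) ->
  exists f : nat -> A, f O = x0 /\ forall n, P n (f n) /\ Q n (f n) (f (S n)).
Proof.
intros H0 HS.
pose (step := fun n (x : {x | P n x}) =>
  let s := constructive_indefinite_description _ (HS n (proj1_sig x) (proj2_sig x)) in
  exist (P (S n)) (proj1_sig s) (proj1 (proj2_sig s))).
pose (f := nat_rect (fun n => {x | P n x}) (exist _ x0 H0) step).
exists (fun n => proj1_sig (f n)); split; [easy|]; intros n; split.
- apply proj2_sig.
- simpl; unfold step.
  destruct (constructive_indefinite_description _ _) as [y [Hy1 Hy2]]; exact Hy2.
Qed.

(** Here a + i b is the complex derivative of u + i v. Nothing is asked about its continuity, hence
    Goursat's bisection rather than Green's formula. *)
Definition CR_differentiable (u v : R -> R -> R) (x y : R) : Prop :=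
  exists a b, differentiable_pt_lim u x y a (- b) /\
    differentiable_pt_lim v x y b a.

Lemma differentiable_pt_lim_continuous (f : R -> R -> R) x y a b :
  differentiable_pt_lim f x y a b ->
  continuous (fun t => f t y) x /\ continuous (fun t => f x t) y.
Proof.
intros H; split.
- assert (D := derivable_pt_lim_comp_2d f (fun t => t) (fun _ => y) x a b 1 0 H
    (derivable_pt_lim_id x) (derivable_pt_lim_const y x)).
  apply is_derive_Reals in D.
  apply (ex_derive_continuous (fun t => f t y)); eexists; exact D.
- assert (D := derivable_pt_lim_comp_2d f (fun _ => x) (fun t => t) y a b 0 1 H
    (derivable_pt_lim_const x y) (derivable_pt_lim_id y)).
  apply is_derive_Reals in D.
  apply (ex_derive_continuous (fun t => f x t)); eexists; exact D.
Qed.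

(* The imaginary part of the integral of [u + i v] over the boundary of the
   rectangle [x1, x2] x [y1, y2]. *)
Definition bdry (u v : R -> R -> R) (x1 x2 y1 y2 : R) : R :=
  RInt (fun y => u x2 y - u x1 y) y1 y2 - RInt (fun x => v x y2 - v x y1) x1 x2.

Definition CR_on (u v : R -> R -> R) (x1 x2 y1 y2 : R) : Prop :=
  forall x y, x1 <= x <= x2 -> y1 <= y <= y2 -> CR_differentiable u v x y.

Lemma CR_on_continuous u v x1 x2 y1 y2 : CR_on u v x1 x2 y1 y2 ->
  forall x y, x1 <= x <= x2 -> y1 <= y <= y2 ->
  continuous (fun t => u x t) y /\ continuous (fun t => v t y) x.
Proof.
intros H x y Hx Hy; destruct (H x y Hx Hy) as [a [b [H1 H2]]].
apply differentiable_pt_lim_continuous in H1, H2; tauto.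
Qed.

Lemma CR_on_ex_RInt_u u v x1 x2 y1 y2 x x' y y' : CR_on u v x1 x2 y1 y2 ->
  x1 <= x <= x2 -> x1 <= x' <= x2 -> y1 <= y -> y <= y' -> y' <= y2 ->
  ex_RInt (fun t => u x t - u x' t) y y'.
Proof.
intros H Hx Hx' Hy Hyy Hy'; apply (ex_RInt_continuous (V := R_CompleteNormedModule)).
intros z Hz; rewrite Rmin_left, Rmax_right in Hz by lra.
apply (continuous_minus (V := R_NormedModule)).
- apply (proj1 (CR_on_continuous _ _ _ _ _ _ H x z Hx ltac:(lra))).
- apply (proj1 (CR_on_continuous _ _ _ _ _ _ H x' z Hx' ltac:(lra))).
Qed.

Lemma CR_on_ex_RInt_v u v x1 x2 y1 y2 x x' y y' : CR_on u v x1 x2 y1 y2 ->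
  y1 <= y <= y2 -> y1 <= y' <= y2 -> x1 <= x -> x <= x' -> x' <= x2 ->
  ex_RInt (fun t => v t y - v t y') x x'.
Proof.
intros H Hx Hx' Hy Hyy Hy'; apply (ex_RInt_continuous (V := R_CompleteNormedModule)).
intros z Hz; rewrite Rmin_left, Rmax_right in Hz by lra.
apply (continuous_minus (V := R_NormedModule)).
- apply (proj2 (CR_on_continuous _ _ _ _ _ _ H z y ltac:(lra) Hx)).
- apply (proj2 (CR_on_continuous _ _ _ _ _ _ H z y' ltac:(lra) Hx')).
Qed.

Lemma bdry_split_x u v x1 x x2 y1 y2 : CR_on u v x1 x2 y1 y2 ->
  x1 <= x <= x2 -> y1 <= y2 ->
  bdry u v x1 x2 y1 y2 = bdry u v x1 x y1 y2 + bdry u v x x2 y1 y2.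
Proof.
intros H Hx Hy; unfold bdry.
rewrite <- (RInt_Chasles (V := R_CompleteNormedModule) (fun x => v x y2 - v x y1) x1 x x2);
  try (apply (CR_on_ex_RInt_v _ _ _ _ _ _ _ _ _ _ H); lra).
rewrite (RInt_ext (fun y => u x2 y - u x1 y)
  (fun y => plus (u x y - u x1 y) (u x2 y - u x y)))
  by (intros; unfold plus; simpl; ring).
rewrite (RInt_plus (V := R_CompleteNormedModule) (fun y => u x y - u x1 y)
  (fun y => u x2 y - u x y)); try (apply (CR_on_ex_RInt_u _ _ _ _ _ _ _ _ _ _ H); lra).
unfold plus; simpl; ring.
Qed.

Lemma bdry_split_y u v x1 x2 y1 y y2 : CR_on u v x1 x2 y1 y2 ->
  x1 <= x2 -> y1 <= y <= y2 ->
  bdry u v x1 x2 y1 y2 = bdry u v x1 x2 y1 y + bdry u v x1 x2 y y2.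
Proof.
intros H Hx Hy; unfold bdry.
rewrite <- (RInt_Chasles (V := R_CompleteNormedModule) (fun y => u x2 y - u x1 y) y1 y y2);
  try (apply (CR_on_ex_RInt_u _ _ _ _ _ _ _ _ _ _ H); lra).
rewrite (RInt_ext (fun x => v x y2 - v x y1)
  (fun x => plus (v x y - v x y1) (v x y2 - v x y)))
  by (intros; unfold plus; simpl; ring).
rewrite (RInt_plus (V := R_CompleteNormedModule) (fun x => v x y - v x y1)
  (fun x => v x y2 - v x y)); try (apply (CR_on_ex_RInt_v _ _ _ _ _ _ _ _ _ _ H); lra).
unfold plus; simpl; ring.
Qed.

Lemma RInt_near_const (g : R -> R) a b c e : a <= b -> ex_RInt g a b ->
  (forall t, a <= t <= b -> Rabs (g t - c) <= e) ->
  Rabs (RInt g a b - c * (b - a)) <= e * (b - a).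
Proof.
intros Hab Hg H.
assert (Hc : ex_RInt (fun _ => c) a b) by apply ex_RInt_const.
assert (E : RInt g a b - c * (b - a) = RInt (fun t => minus (g t) c) a b).
{ rewrite (RInt_minus (V := R_CompleteNormedModule) g (fun _ => c)) by easy.
  rewrite RInt_const; unfold minus, plus, opp, scal; simpl; unfold mult; simpl; ring. }
rewrite E, (Rmult_comm e); apply abs_RInt_le_const; [easy| |exact H].
apply (ex_RInt_minus (V := R_CompleteNormedModule) g (fun _ => c)); easy.
Qed.

(** The affine part of u + i v contributes the same a (x2 - x1) (y2 - y1) to both integrals of
    [bdry], so it cancels. Only the remainders are left, at most 2 e s in each integrand. *)
Lemma bdry_local_bound u v x1 x2 y1 y2 x0 y0 a b e s :
  CR_on u v x1 x2 y1 y2 ->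
  x1 <= x0 <= x2 -> y1 <= y0 <= y2 -> x2 - x1 <= s -> y2 - y1 <= s -> 0 <= e ->
  (forall x y, x1 <= x <= x2 -> y1 <= y <= y2 ->
    Rabs (u x y - u x0 y0 - (a * (x - x0) + - b * (y - y0))) <= e * s /\
    Rabs (v x y - v x0 y0 - (b * (x - x0) + a * (y - y0))) <= e * s) ->
  Rabs (bdry u v x1 x2 y1 y2) <= 4 * e * s * s.
Proof.
intros H Hx Hy Hsx Hsy He Hl; unfold bdry.
assert (I1 : Rabs (RInt (fun y => u x2 y - u x1 y) y1 y2
  - a * (x2 - x1) * (y2 - y1)) <= 2 * (e * s) * (y2 - y1)).
{ apply RInt_near_const; [lra|apply (CR_on_ex_RInt_u _ _ _ _ _ _ _ _ _ _ H); lra|].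
  intros t Ht.
  destruct (Hl x2 t ltac:(lra) Ht) as [A _], (Hl x1 t ltac:(lra) Ht) as [B _].
  apply Rabs_le_between in A, B; apply Rabs_le_between; lra. }
assert (I2 : Rabs (RInt (fun x => v x y2 - v x y1) x1 x2
  - a * (y2 - y1) * (x2 - x1)) <= 2 * (e * s) * (x2 - x1)).
{ apply RInt_near_const; [lra|apply (CR_on_ex_RInt_v _ _ _ _ _ _ _ _ _ _ H); lra|].
  intros t Ht.
  destruct (Hl t y2 Ht ltac:(lra)) as [_ A], (Hl t y1 Ht ltac:(lra)) as [_ B].
  apply Rabs_le_between in A, B; apply Rabs_le_between; lra. }
assert (0 <= e * s) by nra.
apply Rabs_le_between in I1, I2; apply Rabs_le_between.
assert (2 * (e * s) * (y2 - y1) <= 2 * (e * s) * s) by nra.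
assert (2 * (e * s) * (x2 - x1) <= 2 * (e * s) * s) by nra.
nra.
Qed.

Lemma bdry_quarter u v x y d d' : CR_on u v x (x + 2 * d) y (y + 2 * d') ->
  0 <= d -> 0 <= d' -> exists x' y', (x' = x \/ x' = x + d) /\ (y' = y \/ y' = y + d') /\
  Rabs (bdry u v x (x + 2 * d) y (y + 2 * d')) <=
    4 * Rabs (bdry u v x' (x' + d) y' (y' + d')).
Proof.
intros H Hd Hd'.
assert (E : bdry u v x (x + 2 * d) y (y + 2 * d') =
  bdry u v x (x + d) y (y + d') + bdry u v x (x + d) (y + d') (y + d' + d') +
  (bdry u v (x + d) (x + d + d) y (y + d') +
   bdry u v (x + d) (x + d + d) (y + d') (y + d' + d'))).
{ replace (y + d' + d') with (y + 2 * d') by ring.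
  replace (x + d + d) with (x + 2 * d) by ring.
  rewrite (bdry_split_x u v x (x + d)); [|easy|lra|lra].
  rewrite (bdry_split_y u v x (x + d) y (y + d')); [|intros s t Hs Ht; apply H; lra|lra|lra].
  rewrite (bdry_split_y u v (x + d) (x + 2 * d) y (y + d')); [|intros s t Hs Ht; apply H; lra|lra|lra].
  ring. }
set (B := bdry u v x (x + 2 * d) y (y + 2 * d')) in *.
destruct (Rle_dec (Rabs B) (4 * Rabs (bdry u v x (x + d) y (y + d')))) as [L|N1];
  [exists x, y; tauto|].
destruct (Rle_dec (Rabs B) (4 * Rabs (bdry u v x (x + d) (y + d') (y + d' + d')))) as [L|N2];
  [exists x, (y + d'); tauto|].
destruct (Rle_dec (Rabs B) (4 * Rabs (bdry u v (x + d) (x + d + d) y (y + d')))) as [L|N3];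
  [exists (x + d), y; tauto|].
exists (x + d), (y + d'); split; [tauto|split; [tauto|]].
set (B1 := bdry u v x (x + d) y _) in *; set (B2 := bdry u v x (x + d) (y + d') _) in *.
set (B3 := bdry u v (x + d) _ y _) in *; set (B4 := bdry u v (x + d) _ (y + d') _) in *.
rewrite E in N1, N2, N3 |- *.
assert (T1 := Rabs_triang (B1 + B2) (B3 + B4)).
assert (T2 := Rabs_triang B1 B2); assert (T3 := Rabs_triang B3 B4); lra.
Qed.

Lemma pow_half_lt (e : R) : 0 < e -> exists n : nat, / 2 ^ n < e.
Proof.
intros He; destruct (pow_lt_1_zero (/ 2)) with (y := e) as [n Hn].
- rewrite Rabs_pos_eq; lra.
- easy.
- exists n; specialize (Hn n (Nat.le_refl n)); rewrite <- pow_inv.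
  now apply Rle_lt_trans with (1 := Rle_abs _).
Qed.

(** Bisection costs a factor 4 at each step, while differentiability at the common point of the
    rectangles makes the boundary integral o(4^-n). *)
Theorem goursat_rectangle u v x1 x2 y1 y2 : x1 <= x2 -> y1 <= y2 ->
  CR_on u v x1 x2 y1 y2 -> bdry u v x1 x2 y1 y2 = 0.
Proof.
intros Hx Hy H.
set (D := fun n => (x2 - x1) / 2 ^ n); set (D' := fun n => (y2 - y1) / 2 ^ n).
assert (P2 : forall n, 0 < 2 ^ n) by (intros; apply pow_lt; lra).
assert (HD : forall n, 0 <= D n) by (intros; apply Rdiv_le_0_compat; [lra|easy]).
assert (HD' : forall n, 0 <= D' n) by (intros; apply Rdiv_le_0_compat; [lra|easy]).
assert (DS : forall n, D n = 2 * D (S n)) by (intros; unfold D; simpl; field; specialize (P2 n); lra).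
assert (DS' : forall n, D' n = 2 * D' (S n)) by (intros; unfold D'; simpl; field; specialize (P2 n); lra).
set (B := bdry u v x1 x2 y1 y2).
destruct (dependent_choice (R * R) (fun n p =>
   x1 <= fst p /\ fst p + D n <= x2 /\ y1 <= snd p /\ snd p + D' n <= y2 /\
   Rabs B <= 4 ^ n * Rabs (bdry u v (fst p) (fst p + D n) (snd p) (snd p + D' n)))
  (fun n p q => fst p <= fst q /\ fst q + D (S n) <= fst p + D n /\
    snd p <= snd q /\ snd q + D' (S n) <= snd p + D' n) (x1, y1)) as [f [_ Hf]].
- unfold D, D'; simpl; rewrite !Rdiv_1_r.
  replace (x1 + (x2 - x1)) with x2 by ring; replace (y1 + (y2 - y1)) with y2 by ring.
  repeat split; try lra. rewrite Rmult_1_l; apply Rle_refl.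
- intros n [x y]; simpl; intros [A1 [A2 [A3 [A4 A5]]]].
  destruct (bdry_quarter u v x y (D (S n)) (D' (S n))) as [x' [y' [Ex [Ey L]]]]; try easy.
  { rewrite <- DS, <- DS'; intros s t Hs Ht; apply H; lra. }
  rewrite <- DS, <- DS' in L.
  exists (x', y'); simpl.
  specialize (DS n); specialize (DS' n); specialize (HD (S n)); specialize (HD' (S n)).
  assert (0 < 4 ^ n) by (apply pow_lt; lra).
  repeat split; try (destruct Ex, Ey; lra).
  apply Rle_trans with (1 := A5); rewrite (Rmult_comm 4), Rmult_assoc.
  apply Rmult_le_compat_l; lra.
- destruct (nested_intervals (fun n => fst (f n)) (fun n => fst (f n) + D n)) as [X HX];
    try (intros n; destruct (Hf n) as [_ K]; specialize (HD n); lra).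
  destruct (nested_intervals (fun n => snd (f n)) (fun n => snd (f n) + D' n)) as [Y HY];
    try (intros n; destruct (Hf n) as [_ K]; specialize (HD' n); lra).
  destruct (H X Y) as [a [b [Hu Hv]]].
  { specialize (HX O); destruct (Hf O) as [K _]; lra. }
  { specialize (HY O); destruct (Hf O) as [K _]; lra. }
  apply NNPP; intros HB.
  (* The summand 1 keeps [s] positive for degenerate rectangles. *)
  set (s := 1 + (x2 - x1) + (y2 - y1)).
  assert (Hs : 0 < s) by (unfold s; lra).
  (* With this e, 4^n times the local bound 4 e (s / 2^n)^2 is exactly |B| / 2, which contradicts
     the lower bound |B|. *)
  assert (He : 0 < Rabs B / (8 * s * s)).
  { apply Rdiv_lt_0_compat; [now apply Rabs_pos_lt|nra]. }
  set (e := mkposreal _ He).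
  destruct (Hu e) as [d1 H1], (Hv e) as [d2 H2].
  set (d := Rmin d1 d2).
  assert (Hd : 0 < d / s).
  { apply Rdiv_lt_0_compat; [|easy]. apply Rmin_pos; apply cond_pos. }
  destruct (pow_half_lt _ Hd) as [n Hn].
  assert (Hsn : s / 2 ^ n < d).
  { apply (Rmult_lt_compat_l s) in Hn; [|easy].
    replace (s * (d / s)) with d in Hn by (field; lra); exact Hn. }
  assert (L1 : D n <= s / 2 ^ n).
  { apply Rmult_le_compat_r; [left; apply Rinv_0_lt_compat, P2|unfold s; lra]. }
  assert (L2 : D' n <= s / 2 ^ n).
  { apply Rmult_le_compat_r; [left; apply Rinv_0_lt_compat, P2|unfold s; lra]. }
  destruct (Hf n) as [[A1 [A2 [A3 [A4 A5]]]] _].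
  specialize (HX n); specialize (HY n); simpl in HX, HY.
  assert (Hb : Rabs (bdry u v (fst (f n)) (fst (f n) + D n) (snd (f n)) (snd (f n) + D' n))
     <= 4 * e * (s / 2 ^ n) * (s / 2 ^ n)).
  { apply bdry_local_bound with (x0 := X) (y0 := Y) (a := a) (b := b); try lra.
    - intros x y Ix Iy; apply H; lra.
    - apply Rlt_le, cond_pos.
    - intros x y Ix Iy.
      assert (Jx : Rabs (x - X) <= s / 2 ^ n) by (apply Rabs_le_between; lra).
      assert (Jy : Rabs (y - Y) <= s / 2 ^ n) by (apply Rabs_le_between; lra).
      assert (Jm : Rmax (Rabs (x - X)) (Rabs (y - Y)) <= s / 2 ^ n) by now apply Rmax_lub.
      assert (d <= d1) by apply Rmin_l; assert (d <= d2) by apply Rmin_r.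
      split; (eapply Rle_trans; [first [apply H1|apply H2]; lra|]);
        apply Rmult_le_compat_l; try easy; apply Rlt_le, cond_pos. }
  assert (P4 : 4 ^ n = 2 ^ n * 2 ^ n) by (rewrite <- Rpow_mult_distr; f_equal; ring).
  apply (Rmult_le_compat_l (4 ^ n)) in Hb; [|apply pow_le; lra].
  assert (C : 4 ^ n * (4 * e * (s / 2 ^ n) * (s / 2 ^ n)) = Rabs B / 2).
  { rewrite P4; unfold e; simpl; field; specialize (P2 n); lra. }
  assert (0 < Rabs B) by now apply Rabs_pos_lt.
  lra.
Qed.

(** * Mean values over circles *)

Notation is_cderive := (is_derive (K := C_AbsRing) (V := C_NormedModule)).
Notation ex_cderive := (ex_derive (K := C_AbsRing) (V := C_NormedModule)).

Lemma is_cderive_eps (f : C -> C) (z l : C) : is_cderive f z l <->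
  forall eps, 0 < eps -> exists d, 0 < d /\ forall w, Cmod (w - z) < d ->
    Cmod (f w - f z - (w - z) * l)%C <= eps * Cmod (w - z).
Proof.
split.
- intros [_ H] eps He.
  destruct (H z (fun P HP => HP) (mkposreal eps He)) as [d Hd].
  exists d; split; [apply cond_pos|]; intros w Hw; exact (Hd w Hw).
- intros H; split.
  + apply (is_linear_scal_l (K := C_AbsRing) (V := C_NormedModule)).
  + intros x Hx eps.
    assert (E := is_filter_lim_locally_unique
      (V := AbsRing_NormedModule C_AbsRing) _ _ Hx).
    rewrite <- E; clear x Hx E.
    destruct (H eps (cond_pos eps)) as [d [Hd HH]].
    exists (mkposreal d Hd); intros w Hw; exact (HH w Hw).
Qed.

Definition ccont (f : C -> C) (z : C) : Prop :=
  forall eps, 0 < eps -> exists d, 0 < d /\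
    forall w, Cmod (w - z) < d -> Cmod (f w - f z) < eps.

Lemma ex_cderive_ccont f z : ex_cderive f z -> ccont f z.
Proof.
intros [l Hl] eps He; apply is_cderive_eps with (eps := 1) in Hl; [|lra].
destruct Hl as [d [Hd H]]; assert (Hm := Cmod_ge_0 l).
assert (He' : 0 < eps / (Cmod l + 2)) by (apply Rdiv_lt_0_compat; lra).
exists (Rmin d (eps / (Cmod l + 2))); split; [now apply Rmin_pos|].
intros w Hw; specialize (H w (Rlt_le_trans _ _ _ Hw (Rmin_l _ _))).
assert (Hw2 := Rlt_le_trans _ _ _ Hw (Rmin_r _ _)).
replace (f w - f z)%C with ((f w - f z - (w - z) * l) + (w - z) * l)%C by ring.
apply Rle_lt_trans with (1 := Cmod_triangle _ _); rewrite Cmod_mult.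
apply (Rmult_lt_compat_r (Cmod l + 2)) in Hw2; [|lra].
replace (eps / (Cmod l + 2) * (Cmod l + 2)) with eps in Hw2 by (field; lra).
assert (Hz := Cmod_ge_0 (w - z)); lra.
Qed.

Lemma Cmod_le_Rmax (z : C) : Cmod z <= 2 * Rmax (Rabs (fst z)) (Rabs (snd z)).
Proof.
eapply Rle_trans; [apply Cmod_2Rmax|]; apply Rmult_le_compat_r.
- eapply Rle_trans; [apply Rabs_pos|apply Rmax_l].
- apply Rsqr_incr_0_var; [|lra]; rewrite Rsqr_sqrt; unfold Rsqr; lra.
Qed.

Lemma Re_le_Cmod (z : C) : Rabs (fst z) <= Cmod z.
Proof. eapply Rle_trans; [apply Rmax_l|apply Rmax_Cmod]. Qed.

Lemma Im_le_Cmod (z : C) : Rabs (snd z) <= Cmod z.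
Proof. eapply Rle_trans; [apply Rmax_r|apply Rmax_Cmod]. Qed.

Lemma is_cderive_Cauchy_Riemann f z l : is_cderive f z l ->
  differentiable_pt_lim (fun x y => Re (f (x, y))) (fst z) (snd z) (fst l) (- snd l) /\
  differentiable_pt_lim (fun x y => Im (f (x, y))) (fst z) (snd z) (snd l) (fst l).
Proof.
intros H.
assert (G : forall eps : posreal, locally_2d (fun x y =>
   Cmod (f (x, y) - f z - ((x, y) - z) * l)%C <=
     eps * Rmax (Rabs (x - fst z)) (Rabs (y - snd z))) (fst z) (snd z)).
{ intros eps; assert (He : 0 < eps / 2) by (apply is_pos_div_2).
  apply is_cderive_eps with (eps := eps / 2) in H; [|easy].
  destruct H as [d [Hd H]].
  assert (Hd2 : 0 < d / 2) by lra; exists (mkposreal _ Hd2); simpl.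
  intros x y Hx Hy.
  assert (B := Cmod_le_Rmax ((x, y) - z)%C).
  change (fst ((x, y) - z)%C) with (x - fst z) in B.
  change (snd ((x, y) - z)%C) with (y - snd z) in B.
  eapply Rle_trans; [apply H|].
  - assert (M := Rmax_lub_lt _ _ _ Hx Hy); lra.
  - apply Rle_trans with (eps / 2 * (2 * Rmax (Rabs (x - fst z)) (Rabs (y - snd z)))).
    + apply Rmult_le_compat_l; lra.
    + right; field. }
destruct z as [p q], l as [a b]; simpl in *; split; intros eps;
  destruct (G eps) as [d Hd]; exists d; intros x y Hx Hy;
  specialize (Hd x y Hx Hy); (eapply Rle_trans; [|exact Hd]).
- eapply Rle_trans; [|apply Re_le_Cmod]; right; f_equal.
  unfold Re; simpl; ring.
- eapply Rle_trans; [|apply Im_le_Cmod]; right; f_equal.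
  unfold Im; simpl; ring.
Qed.

Definition circ (c : C) (r t : R) : C := (c + r * (cos t, sin t))%C.

Lemma Cmod_unit_polar t : Cmod (cos t, sin t) = 1.
Proof.
unfold Cmod; simpl; rewrite !Rmult_1_r.
rewrite <- sqrt_1; f_equal; generalize (sin2_cos2 t); unfold Rsqr; lra.
Qed.

Lemma Cmod_circ c r t : 0 <= r -> Cmod (circ c r t - c) = r.
Proof.
intros Hr; unfold circ.
replace (c + r * (cos t, sin t) - c)%C with (r * (cos t, sin t))%C by ring.
rewrite Cmod_mult, Cmod_R, Cmod_unit_polar, Rabs_pos_eq; lra.
Qed.

Lemma differentiable_pt_lim_mult x y :
  differentiable_pt_lim (fun a b => a * b) x y y x.
Proof.
intros eps; exists eps; intros u v Hu Hv.
replace (u * v - x * y - (y * (u - x) + x * (v - y))) with ((u - x) * (v - y)) by ring.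
rewrite Rabs_mult, (Rmult_comm eps).
apply Rmult_le_compat; try apply Rabs_pos; [apply Rmax_l|lra].
Qed.

Lemma differentiable_pt_lim_plus_const k (f : R -> R -> R) x y a b :
  differentiable_pt_lim f x y a b ->
  differentiable_pt_lim (fun u v => k + f u v) x y a b.
Proof.
intros H eps; destruct (H eps) as [d Hd]; exists d; intros u v Hu Hv.
eapply Rle_trans; [|apply (Hd u v Hu Hv)]; right; f_equal; ring.
Qed.

Lemma differentiable_pt_lim_proj2 (f : R -> R) (x y l : R) :
  derivable_pt_lim f y l -> differentiable_pt_lim (fun _ v => f v) x y 0 l.
Proof.
intros H eps; destruct (differentiable_pt_lim_proj1_0 f y x l H eps) as [d Hd].
exists d; intros u v Hu Hv; specialize (Hd v u Hv Hu); simpl in Hd.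
rewrite Rmax_comm; eapply Rle_trans; [|exact Hd]; right; f_equal; ring.
Qed.

(** The point is c + exp(s + i t), a holomorphic function of s + i t, so the Cauchy-Riemann
    equations persist and rectangles of height 2 PI in (s, t) cover annuli about c. The witnesses
    are the real and imaginary parts of l exp(s + i t). *)
Lemma CR_differentiable_circ f c s t : ex_cderive f (circ c (exp s) t) ->
  CR_differentiable (fun s t => Re (f (circ c (exp s) t)))
    (fun s t => Im (f (circ c (exp s) t))) s t.
Proof.
intros [l Hl].
assert (E : forall s t, circ c (exp s) t =
  (fst c + exp s * cos t, snd c + exp s * sin t)).
{ intros s' t'; unfold circ; destruct c as [p q]; unfold Cmult, Cplus, RtoC; simpl.
  f_equal; ring. }
destruct (is_cderive_Cauchy_Riemann f _ _ Hl) as [HU HV].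
rewrite E in HU, HV; simpl in HU, HV.
assert (Hexp := differentiable_pt_lim_proj1_0 exp s t _ (derivable_pt_lim_exp s)).
assert (Hcos := differentiable_pt_lim_proj2 cos s t _ (derivable_pt_lim_cos t)).
assert (Hsin := differentiable_pt_lim_proj2 sin s t _ (derivable_pt_lim_sin t)).
assert (HX := differentiable_pt_lim_plus_const (fst c) _ _ _ _ _
  (differentiable_pt_lim_comp _ _ _ s t _ _ _ _ _ _ (differentiable_pt_lim_mult _ _) Hexp Hcos)).
assert (HY := differentiable_pt_lim_plus_const (snd c) _ _ _ _ _
  (differentiable_pt_lim_comp _ _ _ s t _ _ _ _ _ _ (differentiable_pt_lim_mult _ _) Hexp Hsin)).
assert (GU := differentiable_pt_lim_comp _ _ _ s t _ _ _ _ _ _ HU HX HY).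
assert (GV := differentiable_pt_lim_comp _ _ _ s t _ _ _ _ _ _ HV HX HY).
exists (fst l * exp s * cos t - snd l * exp s * sin t),
  (fst l * exp s * sin t + snd l * exp s * cos t); split.
- eapply differentiable_pt_lim_ext.
  { exists (mkposreal 1 Rlt_0_1); intros a b _ _; rewrite E; reflexivity. }
  match type of GU with differentiable_pt_lim _ _ _ ?a ?b =>
    match goal with |- differentiable_pt_lim _ _ _ ?a' ?b' =>
      replace a' with a by ring; replace b' with b by ring end end.
  exact GU.
- eapply differentiable_pt_lim_ext.
  { exists (mkposreal 1 Rlt_0_1); intros a b _ _; rewrite E; reflexivity. }
  match type of GV with differentiable_pt_lim _ _ _ ?a ?b =>
    match goal with |- differentiable_pt_lim _ _ _ ?a' ?b' =>
      replace a' with a by ring; replace b' with b by ring end end.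
  exact GV.
Qed.

(** The centre is left out so that mean values apply to quotients like f(z)/z without a theorem on
    removable singularities. *)
Definition punctured_holo (f : C -> C) (c : C) (R0 : R) : Prop :=
  forall z, 0 < Cmod (z - c) < R0 -> ex_cderive f z.

(** The radius is exp s. The base angle [t0] is free so that [circle_max] can place a given angle
    inside the interval of integration. *)
Definition circle_int (f : C -> C) c s t0 :=
  RInt (fun t => Re (f (circ c (exp s) t))) t0 (t0 + 2 * PI).

Lemma punctured_circ f c R0 s t : punctured_holo f c R0 -> exp s < R0 ->
  ex_cderive f (circ c (exp s) t).
Proof.
intros H Hs; apply H; assert (He := exp_pos s); rewrite Cmod_circ; lra.
Qed.

Lemma circ_periodic c r t : circ c r (t + 2 * PI) = circ c r t.
Proof.
unfold circ.
replace (t + 2 * PI) with (t + 2 * INR 1 * PI) by (simpl; ring).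
now rewrite cos_period, sin_period.
Qed.

Lemma circle_continuous f c R0 s t : punctured_holo f c R0 -> exp s < R0 ->
  continuous (fun t => Re (f (circ c (exp s) t))) t.
Proof.
intros H Hs; destruct (CR_differentiable_circ f c s t (punctured_circ f c R0 s t H Hs))
  as [a [b [D _]]].
apply differentiable_pt_lim_continuous in D; apply D.
Qed.

(** In Goursat's identity on the (s, t) rectangle, the two sides at angles t0 and t0 + 2 PI cancel
    by periodicity; the other two sides are the circle integrals. *)
Lemma circle_int_const f c R0 s s' t0 : punctured_holo f c R0 ->
  s <= s' -> exp s' < R0 -> circle_int f c s t0 = circle_int f c s' t0.
Proof.
intros H Hs Hs'; assert (HPI := PI_RGT_0).
assert (Hexp : forall x, x <= s' -> exp x < R0).
{ intros x [Hx| ->]; [|easy]; apply exp_increasing in Hx; lra. }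
assert (G := goursat_rectangle (fun s t => Re (f (circ c (exp s) t)))
  (fun s t => Im (f (circ c (exp s) t))) s s' t0 (t0 + 2 * PI) Hs ltac:(lra)
  (fun x y Hx _ => CR_differentiable_circ f c x y
     (punctured_circ f c R0 x y H (Hexp x (proj2 Hx))))).
unfold bdry in G.
rewrite (RInt_ext (fun x => Im (f (circ c (exp x) (t0 + 2 * PI))) - Im (f (circ c (exp x) t0)))
  (fun _ => 0)), RInt_const in G
  by (intros x _; rewrite circ_periodic; apply Rminus_diag).
assert (X : forall x, x <= s' ->
   ex_RInt (fun t => Re (f (circ c (exp x) t))) t0 (t0 + 2 * PI)).
{ intros x Hx; apply (ex_RInt_continuous (V := R_CompleteNormedModule)).
  intros t _; apply circle_continuous with R0; auto. }
change (fun y => Re (f (circ c (exp s') y)) - Re (f (circ c (exp s) y))) with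
  (fun y => minus (Re (f (circ c (exp s') y))) (Re (f (circ c (exp s) y)))) in G.
rewrite (RInt_minus (V := R_CompleteNormedModule)
  (fun y => Re (f (circ c (exp s') y))) (fun y => Re (f (circ c (exp s) y)))) in G;
  [|apply X; lra|apply X; lra].
unfold circle_int, minus, plus, opp, scal in *; simpl in *; unfold mult in G; simpl in G; lra.
Qed.

(** The integral is independent of the radius, and continuity at c gives its value as the radius
    shrinks to 0. *)
Lemma circle_mean_value f c R0 s t0 : punctured_holo f c R0 -> ccont f c ->
  exp s < R0 -> circle_int f c s t0 = Re (f c) * (2 * PI).
Proof.
intros H Hc Hs; assert (HPI := PI_RGT_0).
apply cond_eq; intros eps He.
assert (He' : 0 < eps / (4 * PI)) by (apply Rdiv_lt_0_compat; lra).
destruct (Hc _ He') as [d [Hd Hf]].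
set (s' := Rmin s (ln (d / 2))).
assert (Hs' : exp s' <= d / 2).
{ rewrite <- (exp_ln (d / 2)) by lra.
  destruct (Rmin_r s (ln (d / 2))) as [L|L]; fold s' in L;
    [left; now apply exp_increasing|rewrite L; right; easy]. }
rewrite <- (circle_int_const f c R0 s' s t0 H (Rmin_l _ _) Hs).
assert (Hs2 : exp s' < R0).
{ destruct (Rmin_l s (ln (d / 2))) as [L|L]; fold s' in L;
    [apply exp_increasing in L; lra|now rewrite L]. }
assert (K : Rabs (circle_int f c s' t0 - Re (f c) * (t0 + 2 * PI - t0)) <=
  eps / (4 * PI) * (t0 + 2 * PI - t0)).
{ apply RInt_near_const; [lra| |].
  - apply (ex_RInt_continuous (V := R_CompleteNormedModule)).
    intros t _; apply circle_continuous with R0; auto.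
  - intros t _; left.
    apply Rle_lt_trans with (Cmod (f (circ c (exp s') t) - f c)).
    + eapply Rle_trans; [|apply Re_le_Cmod]; right; f_equal.
    + apply Hf; rewrite Cmod_circ; [lra|left; apply exp_pos]. }
replace (t0 + 2 * PI - t0) with (2 * PI) in K by ring.
replace (eps / (4 * PI) * (2 * PI)) with (eps / 2) in K by (field; lra); lra.
Qed.

Lemma RInt_nonneg_zero (g : R -> R) a b t0 : a < t0 < b ->
  (forall t, continuous g t) -> (forall t, 0 <= g t) -> RInt g a b = 0 -> g t0 = 0.
Proof.
intros Ht Hg Hp H0; apply Rle_antisym; [|apply Hp]; apply Rnot_lt_le; intros Hpos.
destruct (Hg t0 (fun y => 0 < y)) as [d Hd].
{ exists (mkposreal _ Hpos); intros y Hy.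
  apply (proj1 (Rabs_lt_between _ _)) in Hy; simpl in Hy.
  unfold minus, plus, opp in Hy; simpl in Hy; lra. }
assert (X : forall x y, ex_RInt g x y).
{ intros; apply (ex_RInt_continuous (V := R_CompleteNormedModule)); auto. }
set (e := Rmin (d / 2) (b - t0)).
assert (He : 0 < e) by (apply Rmin_pos; [apply is_pos_div_2|lra]).
assert (e <= d / 2) by apply Rmin_l; assert (e <= b - t0) by apply Rmin_r.
assert (E1 := RInt_Chasles (V := R_CompleteNormedModule) g a t0 b (X _ _) (X _ _)).
assert (E2 := RInt_Chasles (V := R_CompleteNormedModule) g t0 (t0 + e) b (X _ _) (X _ _)).
unfold plus in E1, E2; simpl in E1, E2.
assert (A1 : 0 <= RInt g a t0) by (apply RInt_ge_0; auto; lra).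
assert (A2 : 0 <= RInt g (t0 + e) b) by (apply RInt_ge_0; auto; lra).
assert (A3 : 0 < RInt g t0 (t0 + e)).
{ apply RInt_gt_0; [lra| |auto]; intros x Hx; apply (Hd x).
  change (Rabs (x - t0) < d); apply Rabs_lt_between; assert (D := cond_pos d); lra. }
lra.
Qed.

(** The continuous function Re f(c) - Re f is nonnegative on the circle and has integral 0 there. *)
Theorem circle_max f c R0 r : punctured_holo f c R0 -> ccont f c -> 0 < r < R0 ->
  (forall t, Re (f (circ c r t)) <= Re (f c)) ->
  forall t, Re (f (circ c r t)) = Re (f c).
Proof.
intros H Hc Hr Hle t; assert (HPI := PI_RGT_0).
rewrite <- (exp_ln r) in * by easy; set (s := ln r) in *.
assert (M := circle_mean_value f c R0 s (t - PI) H Hc (proj2 Hr)); unfold circle_int in M.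
assert (C : forall t, continuous (fun t => Re (f (circ c (exp s) t))) t)
  by (intros; apply circle_continuous with R0; tauto).
assert (Z : minus (Re (f c)) (Re (f (circ c (exp s) t))) = 0).
{ apply (RInt_nonneg_zero (fun t => minus (Re (f c)) (Re (f (circ c (exp s) t))))
    (t - PI) (t - PI + 2 * PI)).
  - lra.
  - intros x; apply (continuous_minus (V := R_NormedModule)); [apply continuous_const|apply C].
  - intros x; specialize (Hle x); unfold minus, plus, opp; simpl; lra.
  - rewrite (RInt_minus (V := R_CompleteNormedModule) (fun _ => Re (f c))), M, RInt_const.
    + unfold minus, plus, opp, scal; simpl; unfold mult; simpl; ring.
    + apply ex_RInt_const.
    + apply (ex_RInt_continuous (V := R_CompleteNormedModule)); intros; apply C. }
unfold minus, plus, opp in Z; simpl in Z; lra.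
Qed.

(** * Compactness and the weak maximum principle *)

Lemma ex_cderive_ext_near (f g : C -> C) z d : 0 < d ->
  (forall w, Cmod (w - z) < d -> f w = g w) -> ex_cderive f z -> ex_cderive g z.
Proof.
intros Hd H [l Hl]; exists l; apply (is_derive_ext_loc (K := C_AbsRing) (V := C_NormedModule) f);
  [|exact Hl].
exists (mkposreal d Hd); intros w Hw; apply H; exact Hw.
Qed.

Lemma ex_cderive_const c z : ex_cderive (fun _ => c) z.
Proof. eexists; exact (is_derive_const (K := C_AbsRing) (V := C_NormedModule) c z). Qed.

Lemma ex_cderive_id z : ex_cderive (fun w => w) z.
Proof. eexists; apply is_derive_C_AbsRing; exact (is_derive_id (K := C_AbsRing) z). Qed.

Lemma ex_cderive_plus f g z : ex_cderive f z -> ex_cderive g z ->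
  ex_cderive (fun w => f w + g w)%C z.
Proof.
intros [l Hl] [m Hm]; eexists.
exact (is_derive_plus (K := C_AbsRing) (V := C_NormedModule) _ _ _ _ _ Hl Hm).
Qed.

Lemma ex_cderive_mult f g z : ex_cderive f z -> ex_cderive g z ->
  ex_cderive (fun w => f w * g w)%C z.
Proof.
intros [l Hl] [m Hm]; eexists; apply is_derive_C_AbsRing; apply is_derive_C_AbsRing in Hl, Hm.
exact (is_derive_mult (K := C_AbsRing) f g z l m Hl Hm Cmult_comm).
Qed.

Lemma ex_cderive_comp f g z : ex_cderive f (g z) -> ex_cderive g z ->
  ex_cderive (fun w => f (g w)) z.
Proof.
intros [l Hl] [m Hm]; eexists; apply is_derive_C_AbsRing in Hm.
exact (is_derive_comp (K := C_AbsRing) (V := C_NormedModule) f g z l m Hl Hm).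
Qed.

Lemma ex_cderive_minus f g z : ex_cderive f z -> ex_cderive g z ->
  ex_cderive (fun w => f w - g w)%C z.
Proof.
intros [l Hl] [m Hm]; eexists.
exact (is_derive_minus (K := C_AbsRing) (V := C_NormedModule) _ _ _ _ _ Hl Hm).
Qed.

Lemma Cmod_minus_sym (z w : C) : Cmod (z - w) = Cmod (w - z).
Proof. rewrite <- Cmod_opp; f_equal; ring. Qed.

Lemma Cmod_triangle_minus (z w : C) : Cmod z - Cmod w <= Cmod (z - w).
Proof.
assert (H := Cmod_triangle (z - w) w); replace (z - w + w)%C with z in H by ring; lra.
Qed.

Lemma Cmod_triangle_sub (z w v : C) : Cmod (z - v) <= Cmod (z - w) + Cmod (w - v).
Proof.
replace (z - v)%C with ((z - w) + (w - v))%C by ring; apply Cmod_triangle.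
Qed.

Lemma Cmod_pos_neq z : 0 < Cmod z -> z <> RtoC 0.
Proof. apply Cmod_gt_0. Qed.

Lemma ex_cderive_Cinv z : z <> RtoC 0 -> ex_cderive Cinv z.
Proof.
intros Hz; exists (- / (z * z))%C; apply is_cderive_eps; intros eps He.
assert (Hm := proj1 (Cmod_gt_0 z) Hz); set (m := Cmod z) in *.
assert (Hm2 : 0 < eps * m * m * m / 2).
{ apply Rdiv_lt_0_compat; [|lra]; repeat apply Rmult_lt_0_compat; easy. }
exists (Rmin (m / 2) (eps * m * m * m / 2)); split; [apply Rmin_pos; lra|].
intros w Hw.
assert (Hw1 := Rlt_le_trans _ _ _ Hw (Rmin_l _ _)).
assert (Hw2 := Rlt_le_trans _ _ _ Hw (Rmin_r _ _)).
assert (T := Cmod_triangle_minus z w); rewrite Cmod_minus_sym in T; fold m in T.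
assert (Hwm : m / 2 < Cmod w) by lra.
assert (Hw0 : w <> RtoC 0) by (apply Cmod_pos_neq; lra).
replace (/ w - / z - (w - z) * - / (z * z))%C with
  ((w - z) * ((w - z) * / (w * (z * z))))%C by (field; tauto).
rewrite Cmod_mult, Rmult_comm; apply Rmult_le_compat_r; [apply Cmod_ge_0|].
rewrite Cmod_mult, Cmod_inv, !Cmod_mult; fold m; [|repeat apply Cmult_neq_0; easy].
apply Rmult_le_reg_r with (Cmod w * (m * m)); [repeat apply Rmult_lt_0_compat; lra|].
rewrite Rmult_assoc, Rinv_l, Rmult_1_r by (apply Rgt_not_eq; repeat apply Rmult_lt_0_compat; lra).
apply Rle_trans with (eps * (m / 2 * (m * m))); [lra|].
apply Rmult_le_compat_l; [lra|]; apply Rmult_le_compat_r; nra.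
Qed.

Lemma ex_cderive_div f g z : ex_cderive f z -> ex_cderive g z -> g z <> RtoC 0 ->
  ex_cderive (fun w => f w / g w)%C z.
Proof.
intros Hf Hg H0; unfold Cdiv; apply ex_cderive_mult; [easy|].
apply (ex_cderive_comp Cinv); [now apply ex_cderive_Cinv|easy].
Qed.

Lemma ex_cderive_pow f z n : ex_cderive f z -> ex_cderive (fun w => f w ^ n)%C z.
Proof.
intros Hf; induction n as [|n IH]; simpl; [apply ex_cderive_const|].
now apply ex_cderive_mult.
Qed.

(** * Convergent subsequences and attained maxima *)

Definition cconv (u : nat -> C) (l : C) : Prop :=
  forall eps, 0 < eps -> exists N, forall n, (N <= n)%nat -> Cmod (u n - l) < eps.

Definition increasing_index (s : nat -> nat) : Prop := forall n, (s n < s (S n))%nat.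

Lemma increasing_index_ge s : increasing_index s -> forall n, (n <= s n)%nat.
Proof. intros H; induction n as [|n IH]; [lia|specialize (H n); lia]. Qed.

Lemma bounded_real_subseq (u : nat -> R) M : (forall n, Rabs (u n) <= M) ->
  exists s l, increasing_index s /\
    forall eps, 0 < eps -> exists N, forall n, (N <= n)%nat -> Rabs (u (s n) - l) < eps.
Proof.
intros H.
destruct (Bolzano_Weierstrass u (fun x => - M <= x <= M) (compact_P3 _ _)) as [l Hl].
{ intros n; now apply Rabs_le_between. }
assert (K : forall eps N, 0 < eps -> exists p, (N <= p)%nat /\ Rabs (u p - l) < eps).
{ intros eps N He; destruct (Hl (disc l (mkposreal eps He)) N) as [p Hp].
  - exists (mkposreal eps He); intros x Hx; exact Hx.
  - exists p; exact Hp. }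
destruct (K 1 O Rlt_0_1) as [p0 [_ Hp0]].
destruct (dependent_choice nat (fun n p => Rabs (u p - l) < / (INR n + 1))
  (fun _ p q => (p < q)%nat) p0) as [s [_ Hs]].
- simpl; rewrite Rplus_0_l, Rinv_1; exact Hp0.
- intros n p _; destruct (K (/ (INR (S n) + 1)) (S p)) as [q [Hq1 Hq2]].
  + apply Rinv_0_lt_compat; assert (P := pos_INR (S n)); lra.
  + exists q; split; [easy|lia].
- exists s, l; split; [intros n; apply Hs|].
  intros eps He; destruct (archimed_cor1 eps He) as [N [HN1 HN2]].
  exists N; intros n Hn; destruct (Hs n) as [D _].
  apply Rlt_trans with (1 := D); apply Rle_lt_trans with (2 := HN1).
  apply Rinv_le_contravar; [now apply lt_0_INR|apply le_INR in Hn; lra].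
Qed.

Lemma bounded_complex_subseq (u : nat -> C) M : (forall n, Cmod (u n) <= M) ->
  exists s l, increasing_index s /\ cconv (fun n => u (s n)) l.
Proof.
intros H.
destruct (bounded_real_subseq (fun n => fst (u n)) M) as [s [a [Hs Ha]]].
{ intros n; eapply Rle_trans; [apply Re_le_Cmod|apply H]. }
destruct (bounded_real_subseq (fun n => snd (u (s n))) M) as [s' [b [Hs' Hb]]].
{ intros n; eapply Rle_trans; [apply Im_le_Cmod|apply H]. }
exists (fun n => s (s' n)), (a, b); split.
- assert (Hm : forall p q, (p < q)%nat -> (s p < s q)%nat).
  { induction 1; [apply Hs|specialize (Hs m); lia]. }
  intros n; apply Hm, Hs'.
- intros eps He; assert (He2 : 0 < eps / 2) by lra.
  destruct (Ha _ He2) as [N1 H1], (Hb _ He2) as [N2 H2].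
  exists (N1 + N2)%nat; intros n Hn.
  eapply Rle_lt_trans; [apply Cmod_le_Rmax|].
  assert (G := increasing_index_ge s' Hs' n).
  assert (Rmax (Rabs (fst (u (s (s' n)) - (a, b))%C)) (Rabs (snd (u (s (s' n)) - (a, b))%C)) < eps / 2).
  { apply Rmax_lub_lt; [apply H1; lia|apply H2; lia]. }
  lra.
Qed.

Lemma inv_INR_S_small eps : 0 < eps ->
  exists N, forall n, (N <= n)%nat -> / (INR n + 1) < eps.
Proof.
intros He; destruct (archimed_cor1 eps He) as [N [HN1 HN2]].
exists N; intros n Hn; apply Rle_lt_trans with (2 := HN1).
apply Rinv_le_contravar; [now apply lt_0_INR|apply le_INR in Hn; lra].
Qed.

Lemma countable_choice (A : Type) (P : nat -> A -> Prop) :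
  (forall n, exists x, P n x) -> exists f, forall n, P n (f n).
Proof.
intros H; exists (fun n => proj1_sig (constructive_indefinite_description _ (H n))).
intros n; apply proj2_sig.
Qed.

Definition bounded_closed (K : C -> Prop) : Prop :=
  (exists M, forall z, K z -> Cmod z <= M) /\
  (forall u l, (forall n, K (u n)) -> cconv u l -> K l).

Definition rcont (v : C -> R) (z : C) : Prop :=
  forall eps, 0 < eps -> exists d, 0 < d /\
    forall w, Cmod (w - z) < d -> Rabs (v w - v z) < eps.

Lemma rcont_cconv v u z : rcont v z -> cconv u z ->
  forall eps, 0 < eps -> exists N, forall n, (N <= n)%nat -> Rabs (v (u n) - v z) < eps.
Proof.
intros Hv Hu eps He; destruct (Hv eps He) as [d [Hd H]].
destruct (Hu d Hd) as [N HN]; exists N; auto.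
Qed.

Lemma compact_max (K : C -> Prop) (v : C -> R) : bounded_closed K ->
  (exists z, K z) -> (forall z, K z -> rcont v z) ->
  exists a, K a /\ forall z, K z -> v z <= v a.
Proof.
intros [[M HM] HK] [z0 Hz0] Hv.
assert (Sub : forall u, (forall n, K (u n)) -> exists s a, increasing_index s /\ K a /\
  forall eps, 0 < eps -> exists N, forall n, (N <= n)%nat -> Rabs (v (u (s n)) - v a) < eps).
{ intros u Hu; destruct (bounded_complex_subseq u M) as [s [a [Hs Ha]]]; [auto|].
  assert (Ka : K a) by (apply (HK (fun n => u (s n))); auto).
  exists s, a; split; [easy|split; [easy|]].
  apply (rcont_cconv v (fun n => u (s n))); auto. }
destruct (completeness (fun r => exists z, K z /\ r = v z)) as [m [Hm1 Hm2]].
- apply NNPP; intros Hb.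
  destruct (countable_choice C (fun n z => K z /\ INR n < v z)) as [u Hu].
  { intros n; apply NNPP; intros Hn; apply Hb; exists (INR n).
    intros r [z [Hz ->]]; apply Rnot_lt_le; intros L; apply Hn; now exists z. }
  destruct (Sub u) as [s [a [Hs [_ Ha]]]]; [apply Hu|].
  destruct (Ha 1 Rlt_0_1) as [N HN].
  destruct (INR_unbounded (v a + 1)) as [N' HN'].
  specialize (HN (N + N')%nat ltac:(lia)).
  assert (G := increasing_index_ge s Hs (N + N')).
  assert (L := le_INR N' (s (N + N')%nat) ltac:(lia)).
  destruct (Hu (s (N + N')%nat)) as [_ Q].
  apply Rabs_lt_between in HN; lra.
- exists (v z0), z0; auto.
- destruct (countable_choice C (fun n z => K z /\ m - / (INR n + 1) < v z)) as [u Hu].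
  { intros n; apply NNPP; intros Hn.
    assert (P : 0 < / (INR n + 1)) by (apply Rinv_0_lt_compat; assert (Q := pos_INR n); lra).
    assert (B : m <= m - / (INR n + 1)); [|lra].
    apply Hm2; intros r [z [Hz ->]]; apply Rnot_lt_le; intros L; apply Hn; now exists z. }
  destruct (Sub u) as [s [a [Hs [Ka Ha]]]]; [apply Hu|].
  exists a; split; [easy|]; intros z Hz.
  apply Rle_trans with m; [apply Hm1; now exists z|].
  apply le_epsilon; intros eps He.
  destruct (Ha (eps / 2)) as [N HN]; [lra|].
  destruct (inv_INR_S_small (eps / 2)) as [N' HN']; [lra|].
  specialize (HN (N + N')%nat ltac:(lia)).
  assert (G := increasing_index_ge s Hs (N + N')).
  specialize (HN' (s (N + N')%nat) ltac:(lia)).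
  destruct (Hu (s (N + N')%nat)) as [_ Q].
  apply Rabs_lt_between in HN; lra.
Qed.

Lemma Cmod_Rabs_minus (z w : C) : Rabs (Cmod z - Cmod w) <= Cmod (z - w).
Proof.
apply Rabs_le_between; assert (H1 := Cmod_triangle_minus z w).
assert (H2 := Cmod_triangle_minus w z); rewrite Cmod_minus_sym in H2; lra.
Qed.

Lemma rcont_Cmod f z : ccont f z -> rcont (fun w => Cmod (f w)) z.
Proof.
intros H eps He; destruct (H eps He) as [d [Hd HH]]; exists d; split; [easy|].
intros w Hw; eapply Rle_lt_trans; [apply Cmod_Rabs_minus|auto].
Qed.

Lemma rcont_plus v w z : rcont v z -> rcont w z -> rcont (fun x => v x + w x) z.
Proof.
intros H1 H2 eps He; assert (He2 : 0 < eps / 2) by lra.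
destruct (H1 _ He2) as [d [Hd H]], (H2 _ He2) as [d' [Hd' H']].
exists (Rmin d d'); split; [now apply Rmin_pos|]; intros x Hx.
specialize (H x (Rlt_le_trans _ _ _ Hx (Rmin_l _ _))).
specialize (H' x (Rlt_le_trans _ _ _ Hx (Rmin_r _ _))).
apply Rabs_lt_between in H, H'; apply Rabs_lt_between; lra.
Qed.

Lemma Cmod_sqr (z : C) : Cmod z * Cmod z = fst z * fst z + snd z * snd z.
Proof. assert (H := Cmod2_alt z); unfold Re, Im in H; simpl in H; lra. Qed.

(** Multiplying by such a phase turns a question about a modulus into one about a real part, to
    which mean values apply. *)
Lemma unit_phase (z : C) : exists p, Cmod p = 1 /\ (p * z)%C = Cmod z.
Proof.
destruct (Req_dec (Cmod z) 0) as [H|H].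
- exists (RtoC 1); rewrite Cmod_1; split; [easy|].
  rewrite H; apply Cmod_eq_0 in H; rewrite H; ring.
- assert (Hr : RtoC (Cmod z) <> RtoC 0) by (intros E; apply H, RtoC_inj, E).
  exists (Cconj z / Cmod z)%C; split.
  + rewrite Cmod_div, Cmod_conj, Cmod_R, Rabs_pos_eq by (easy || apply Cmod_ge_0).
    now field.
  + replace (Cconj z / Cmod z * z)%C with ((z * Cconj z) / Cmod z)%C by (field; easy).
    rewrite <- Cmod2_conj; simpl; rewrite Rmult_1_r, RtoC_mult; field; easy.
Qed.

Lemma ccont_plus f g z : ccont f z -> ccont g z -> ccont (fun w => f w + g w)%C z.
Proof.
intros H1 H2 eps He; assert (He2 : 0 < eps / 2) by lra.
destruct (H1 _ He2) as [d [Hd H]], (H2 _ He2) as [d' [Hd' H']].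
exists (Rmin d d'); split; [now apply Rmin_pos|]; intros x Hx.
specialize (H x (Rlt_le_trans _ _ _ Hx (Rmin_l _ _))).
specialize (H' x (Rlt_le_trans _ _ _ Hx (Rmin_r _ _))).
replace (f x + g x - (f z + g z))%C with ((f x - f z) + (g x - g z))%C by ring.
eapply Rle_lt_trans; [apply Cmod_triangle|lra].
Qed.

Lemma ccont_mult f g z : ccont f z -> ccont g z -> ccont (fun w => f w * g w)%C z.
Proof.
intros H1 H2 eps He.
assert (P1 := Cmod_ge_0 (f z)); assert (P2 := Cmod_ge_0 (g z)).
set (m := Cmod (f z) + Cmod (g z) + 1).
assert (Hm : 0 < m) by (unfold m; lra).
set (e := Rmin 1 (eps / (2 * m))).
assert (He' : 0 < e) by (apply Rmin_pos; [lra|apply Rdiv_lt_0_compat; lra]).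
assert (He1 : e <= 1) by apply Rmin_l.
assert (He2 : e * m <= eps / 2).
{ apply Rle_trans with (eps / (2 * m) * m); [apply Rmult_le_compat_r; [lra|apply Rmin_r]|].
  right; field; lra. }
destruct (H1 _ He') as [d [Hd H]], (H2 _ He') as [d' [Hd' H']].
exists (Rmin d d'); split; [now apply Rmin_pos|]; intros x Hx.
specialize (H x (Rlt_le_trans _ _ _ Hx (Rmin_l _ _))).
specialize (H' x (Rlt_le_trans _ _ _ Hx (Rmin_r _ _))).
replace (f x * g x - f z * g z)%C with
  ((f x - f z) * (g x - g z) + (f z * (g x - g z) + (f x - f z) * g z))%C by ring.
assert (T1 := Cmod_triangle ((f x - f z) * (g x - g z)) (f z * (g x - g z) + (f x - f z) * g z)).
assert (T2 := Cmod_triangle (f z * (g x - g z)) ((f x - f z) * g z)).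
rewrite Cmod_mult in T1; rewrite !Cmod_mult in T2.
assert (Q1 := Cmod_ge_0 (f x - f z)); assert (Q2 := Cmod_ge_0 (g x - g z)).
assert (Cmod (f x - f z) * Cmod (g x - g z) <= e * 1) by (apply Rmult_le_compat; lra).
assert (Cmod (f z) * Cmod (g x - g z) <= Cmod (f z) * e) by (apply Rmult_le_compat_l; lra).
assert (Cmod (f x - f z) * Cmod (g z) <= e * Cmod (g z)) by (apply Rmult_le_compat_r; lra).
unfold m in He2; lra.
Qed.

(** The strictly subharmonic perturbation e |z|^2 rules out interior maxima at once, so no argument
    on connectedness occurs. The alternative in the hypothesis separates boundary points, where the
    bound is known, from interior ones. *)
Theorem weak_max (K : C -> Prop) (f : C -> C) (M : R) : bounded_closed K ->
  (forall z, K z -> ccont f z) ->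
  (forall a, K a -> Cmod (f a) <= M \/ exists R0, 0 < R0 /\
    (forall z, Cmod (z - a) < R0 -> K z) /\ punctured_holo f a R0) ->
  forall z, K z -> Cmod (f z) <= M.
Proof.
intros HK Hc Hb z0 Hz0; apply Rnot_lt_le; intros HM.
destruct (proj1 HK) as [B HB].
assert (Hden : 0 < B * B + 1) by nra.
(* On K the perturbation is at most e B^2, less than |f(z0)| - M, so the perturbed maximum is still
   at a point where |f| exceeds M. *)
set (e := (Cmod (f z0) - M) / (B * B + 1)).
assert (He : 0 < e) by (apply Rdiv_lt_0_compat; lra).
assert (HeB : e * (B * B + 1) = Cmod (f z0) - M) by (unfold e; field; lra).
set (g := fun z => (RtoC e * (z * z))%C).
assert (Hg : forall z, Cmod (g z) = e * (Cmod z * Cmod z)).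
{ intros z; unfold g; rewrite !Cmod_mult, Cmod_R, Rabs_pos_eq; lra. }
destruct (compact_max K (fun z => Cmod (f z) + Cmod (g z)) HK) as [a [Ka Ha]].
- now exists z0.
- intros z Hz; apply rcont_plus; apply rcont_Cmod; [auto|].
  apply ex_cderive_ccont, ex_cderive_mult; [apply ex_cderive_const|].
  apply ex_cderive_mult; apply ex_cderive_id.
- assert (Hz0a := Ha z0 Hz0); rewrite !Hg in Hz0a.
  assert (Hfa : M < Cmod (f a)).
  { assert (Cmod a * Cmod a <= B * B).
    { apply Rmult_le_compat; auto using Cmod_ge_0. }
    assert (0 <= e * (Cmod z0 * Cmod z0)).
    { apply Rmult_le_pos; [lra|apply Rmult_le_pos; apply Cmod_ge_0]. }
    assert (e * (Cmod a * Cmod a) <= e * (B * B)) by (apply Rmult_le_compat_l; lra).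
    lra. }
  destruct (Hb a Ka) as [L|[R0 [HR [HRK Hp]]]]; [lra|].
  destruct (unit_phase (f a)) as [p [Hp1 Hp2]].
  (* Since |z|^2 = |a|^2 + 2 Re(conj(a) (z - a)) + |z - a|^2, the perturbation is the real part of a
     holomorphic function plus e r^2 on the circle of radius r about a. This surplus makes Re h(a)
     strictly larger than Re h on the circle. *)
  set (h := fun z => (p * f z + RtoC (2 * e) * Cconj a * z)%C).
  assert (Hh : forall r t, 0 < r < R0 ->
    Cmod (f (circ a r t)) + Cmod (g (circ a r t)) >= Re (h (circ a r t)) - Re (h a)
      + Cmod (f a) + Cmod (g a) + e * (r * r)).
  { intros r t Hr; rewrite !Hg.
    assert (Hcr := Cmod_circ a r t ltac:(lra)); set (z := circ a r t) in *.
    assert (E1 : Re (h z) = Re (p * f z)%C + 2 * e * (fst a * fst z + snd a * snd z)).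
    { unfold h, Re; simpl; ring. }
    assert (E2 : Re (h a) = Cmod (f a) + 2 * e * (fst a * fst a + snd a * snd a)).
    { unfold h; rewrite Hp2; unfold Re; simpl; ring. }
    assert (E3 : Re (p * f z)%C <= Cmod (f z)).
    { apply Rle_trans with (Cmod (p * f z)); [apply Rle_trans with (1 := Rle_abs _), Re_le_Cmod|].
      rewrite Cmod_mult, Hp1; lra. }
    assert (E4 : r * r = (fst z - fst a) * (fst z - fst a) + (snd z - snd a) * (snd z - snd a)).
    { rewrite <- Hcr; apply (Cmod_sqr (z - a)%C). }
    rewrite E1, E2, E4, !Cmod_sqr; nra. }
  assert (Hr : 0 < R0 / 2 < R0) by lra.
  assert (Hmax : forall t, Re (h (circ a (R0 / 2) t)) < Re (h a)).
  { intros t; assert (Q := Hh (R0 / 2) t Hr).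
    assert (Q2 := Ha (circ a (R0 / 2) t)); rewrite !Hg in Q2, Q.
    assert (K (circ a (R0 / 2) t)) by (apply HRK; rewrite Cmod_circ; lra).
    specialize (Q2 H); assert (0 < e * (R0 / 2 * (R0 / 2))); [|lra].
    apply Rmult_lt_0_compat; [easy|apply Rmult_lt_0_compat; lra]. }
  assert (X := circle_max h a R0 (R0 / 2)).
  assert (Y := Hmax 0); rewrite X in Y; [lra| | |easy|intros; left; apply Hmax].
  + intros z Hz; apply ex_cderive_plus; apply ex_cderive_mult;
      solve [apply ex_cderive_const|apply ex_cderive_id|apply Hp; easy].
  + apply ccont_plus.
    * apply ccont_mult; [apply ex_cderive_ccont, ex_cderive_const|auto].
    * apply ex_cderive_ccont, ex_cderive_mult; [apply ex_cderive_const|apply ex_cderive_id].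
Qed.

(** * Schwarz and Schwarz-Pick lemmas *)

(** The automorphism exchanging 0 and a. Being an involution, it serves as its own inverse in all
    conjugations below. *)
Definition mob (a z : C) : C := ((a - z) / (1 - Cconj a * z))%C.

Lemma mob_denom_ge a z : unit_disc a -> Cmod z <= 1 ->
  1 - Cmod a <= Cmod (1 - Cconj a * z).
Proof.
intros Ha Hz; assert (T := Cmod_triangle_minus 1 (Cconj a * z)).
rewrite Cmod_1, Cmod_mult, Cmod_conj in T.
assert (P := Cmod_ge_0 a); assert (Cmod a * Cmod z <= Cmod a * 1); [|lra].
now apply Rmult_le_compat_l.
Qed.

Lemma mob_denom_neq a z : unit_disc a -> Cmod z <= 1 -> (1 - Cconj a * z)%C <> RtoC 0.
Proof.
intros Ha Hz; apply Cmod_pos_neq; assert (H := mob_denom_ge a z Ha Hz).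
unfold unit_disc in Ha; lra.
Qed.

Lemma mob_identity a z :
  Cmod (1 - Cconj a * z) * Cmod (1 - Cconj a * z) =
  Cmod (a - z) * Cmod (a - z) + (1 - Cmod a * Cmod a) * (1 - Cmod z * Cmod z).
Proof. rewrite !Cmod_sqr; simpl; ring. Qed.

Lemma unit_disc_sqr z : unit_disc z -> 0 < 1 - Cmod z * Cmod z <= 1.
Proof. unfold unit_disc; intros H; assert (P := Cmod_ge_0 z); nra. Qed.

Lemma mob_disc a z : unit_disc a -> unit_disc z -> unit_disc (mob a z).
Proof.
intros Ha Hz; unfold mob, unit_disc.
assert (Hn := mob_denom_neq a z Ha (Rlt_le _ _ Hz)).
assert (Hp := proj1 (Cmod_gt_0 _) Hn).
rewrite Cmod_div by easy; apply Rmult_lt_reg_r with (1 := Hp).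
unfold Rdiv; rewrite Rmult_assoc, Rinv_l, Rmult_1_r, Rmult_1_l by lra.
assert (I := mob_identity a z); assert (A := unit_disc_sqr a Ha); assert (B := unit_disc_sqr z Hz).
assert (0 < (1 - Cmod a * Cmod a) * (1 - Cmod z * Cmod z)) by (apply Rmult_lt_0_compat; lra).
assert (Q := Cmod_ge_0 (a - z)); nra.
Qed.

Lemma mob_invol a z : unit_disc a -> unit_disc z -> mob a (mob a z) = z.
Proof.
intros Ha Hz.
assert (Hn := mob_denom_neq a z Ha (Rlt_le _ _ Hz)).
assert (Hn2 := mob_denom_neq a a Ha (Rlt_le _ _ Ha)).
assert (Hn3 := mob_denom_neq a (mob a z) Ha (Rlt_le _ _ (mob_disc a z Ha Hz))).
unfold mob in *; field; split; [exact Hn|cbv beta].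
intros E; apply Hn2; rewrite <- E; ring.
Qed.

Lemma mob_0 a : mob a 0 = a.
Proof. unfold mob; replace (a - 0)%C with a by ring.
replace (1 - Cconj a * 0)%C with (RtoC 1) by ring; field. Qed.

Lemma mob_self a : mob a a = RtoC 0.
Proof. unfold mob; replace (a - a)%C with (RtoC 0) by ring; unfold Cdiv; ring. Qed.

Lemma ex_cderive_mob a z : unit_disc a -> Cmod z <= 1 -> ex_cderive (mob a) z.
Proof.
intros Ha Hz; unfold mob; apply ex_cderive_div.
- apply ex_cderive_minus; [apply ex_cderive_const|apply ex_cderive_id].
- apply ex_cderive_minus; [apply ex_cderive_const|].
  apply ex_cderive_mult; [apply ex_cderive_const|apply ex_cderive_id].
- now apply mob_denom_neq.
Qed.

Lemma mob_self_map a : unit_disc a -> self_map (mob a).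
Proof.
intros Ha; split; [intros z Hz; now apply mob_disc|].
intros z Hz; apply ex_cderive_mob; [easy|now left].
Qed.

Lemma mob_automorphism a : unit_disc a -> disc_automorphism (mob a).
Proof.
intros Ha; split; [now apply mob_self_map|split].
- intros z w Hz Hw E; rewrite <- (mob_invol a z), <- (mob_invol a w), E; easy.
- intros w Hw; exists (mob a w); split; [now apply mob_disc|now apply mob_invol].
Qed.

(** Transfers uniform convergence to 0 of conjugated iterates into convergence of the original
    iterates to a. *)
Lemma mob_dist a z : unit_disc a -> unit_disc z ->
  Cmod (mob a z - a) <= Cmod z * (2 / (1 - Cmod a)).
Proof.
intros Ha Hz; assert (Hn := mob_denom_neq a z Ha (Rlt_le _ _ Hz)).
replace (mob a z - a)%C with (z * ((a * Cconj a - 1) / (1 - Cconj a * z)))%C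
  by (unfold mob; field; easy).
rewrite Cmod_mult; apply Rmult_le_compat_l; [apply Cmod_ge_0|].
rewrite Cmod_div by easy; assert (D := mob_denom_ge a z Ha (Rlt_le _ _ Hz)).
unfold unit_disc in Ha.
apply Rmult_le_compat; [apply Cmod_ge_0|left; apply Rinv_0_lt_compat; lra| |
  apply Rinv_le_contravar; lra].
replace (a * Cconj a - 1)%C with (RtoC (Cmod a ^ 2 - 1)).
- rewrite Cmod_R; apply Rabs_le_between; assert (P := Cmod_ge_0 a); nra.
- now rewrite RtoC_minus, Cmod2_conj.
Qed.

Lemma disc_bounded_closed r1 r2 : bounded_closed (fun z => r1 <= Cmod z <= r2).
Proof.
split; [exists r2; tauto|].
intros u l Hu Hl; split; apply le_epsilon; intros eps He;
  destruct (Hl eps He) as [N HN]; specialize (HN N (Nat.le_refl N)); specialize (Hu N);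
  [assert (T := Cmod_triangle_minus (u N) l)|
   assert (T := Cmod_triangle_minus l (u N)); rewrite Cmod_minus_sym in T]; lra.
Qed.

(** The value [l] at 0 is meant to be f'(0), which makes the quotient continuous there when f(0) =
    0. *)
Definition divz (l : C) (f : C -> C) (z : C) : C :=
  if Req_EM_T (Cmod z) 0 then l else (f z / z)%C.

Lemma divz_0 l f : divz l f 0 = l.
Proof. unfold divz; destruct (Req_EM_T (Cmod 0) 0) as [_|H]; [easy|]; now rewrite Cmod_0 in H. Qed.

Lemma divz_neq l f z : z <> RtoC 0 -> divz l f z = (f z / z)%C.
Proof.
unfold divz; destruct (Req_EM_T (Cmod z) 0) as [H|H]; [|easy].
intros Hz; apply Cmod_eq_0 in H; contradiction.
Qed.

Lemma divz_cderive l f z : z <> RtoC 0 -> ex_cderive f z -> ex_cderive (divz l f) z.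
Proof.
intros Hz Hf; apply (ex_cderive_ext_near (fun w => f w / w)%C _ z (Cmod z)).
- now apply Cmod_gt_0.
- intros w Hw; rewrite divz_neq; [easy|]; intros ->.
  rewrite Cmod_minus_sym in Hw; replace (z - 0)%C with z in Hw by ring; lra.
- now apply ex_cderive_div; [|apply ex_cderive_id|].
Qed.

Lemma divz_ccont_0 l f : f (RtoC 0) = RtoC 0 -> is_cderive f (RtoC 0) l ->
  ccont (divz l f) (RtoC 0).
Proof.
intros H0 H eps He; apply is_cderive_eps with (eps := eps / 2) in H; [|lra].
destruct H as [d [Hd H]]; exists d; split; [easy|]; intros w Hw; rewrite divz_0.
destruct (Req_dec (Cmod w) 0) as [E|E].
- apply Cmod_eq_0 in E; rewrite E, divz_0.
  replace (l - l)%C with (RtoC 0) by ring; now rewrite Cmod_0.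
- assert (Hw0 : w <> RtoC 0) by (intros ->; apply E, Cmod_0).
  assert (P := proj1 (Cmod_gt_0 w) Hw0).
  rewrite divz_neq by easy; specialize (H w Hw); rewrite H0 in H.
  replace (f w / w - l)%C with ((f w - 0 - (w - 0) * l) / w)%C by (field; easy).
  rewrite Cmod_div by easy; replace (w - 0)%C with w in H at 2 by ring.
  apply Rle_lt_trans with (eps / 2); [|lra].
  apply Rmult_le_reg_r with (Cmod w); [easy|].
  unfold Rdiv at 1; rewrite Rmult_assoc, Rinv_l, Rmult_1_r by lra; exact H.
Qed.

Lemma bernoulli m x : 0 <= x <= 1 -> 1 - INR m * (1 - x) <= x ^ m.
Proof.
intros Hx; induction m as [|m IH]; [simpl; lra|].
rewrite S_INR; change (x ^ S m) with (x * x ^ m).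
assert (P : x ^ m <= 1) by (rewrite <- (pow1 m); apply pow_incr; lra).
assert (Q : 0 <= x ^ m) by (apply pow_le; lra).
assert (N := pos_INR m); nra.
Qed.

(** Maximum principles are applied on closed discs of radius r < 1, where the bound loses a power of
    r; this lets r tend to 1, with Bernoulli's inequality in place of continuity of powers. *)
Lemma le_of_radii A B s m : 0 <= A -> 0 <= s < 1 ->
  (forall r, s < r < 1 -> A * r ^ m <= B) -> A <= B.
Proof.
intros HA Hs H; apply le_epsilon; intros e He.
assert (N := pos_INR m).
assert (Hden : 0 < A * INR m + 1) by nra.
set (d := Rmin ((1 - s) / 2) (e / (A * INR m + 1))).
assert (Hd : 0 < d) by (apply Rmin_pos; [lra|apply Rdiv_lt_0_compat; lra]).
assert (d <= (1 - s) / 2) by apply Rmin_l.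
assert (Hd2 : d * (A * INR m + 1) <= e).
{ apply Rle_trans with (e / (A * INR m + 1) * (A * INR m + 1)).
  - apply Rmult_le_compat_r; [lra|apply Rmin_r].
  - right; field; lra. }
specialize (H (1 - d) ltac:(lra)).
assert (B1 := bernoulli m (1 - d) ltac:(lra)).
assert (A * (1 - INR m * (1 - (1 - d))) <= A * (1 - d) ^ m) by (apply Rmult_le_compat_l; lra).
nra.
Qed.

(** On the circle of radius r the quotient is at most 1/r. The point 0 is included, which also gives
    |f'(0)| <= 1. *)
Lemma divz_bound f l : self_map f -> f (RtoC 0) = RtoC 0 -> is_cderive f (RtoC 0) l ->
  forall z, unit_disc z -> Cmod (divz l f z) <= 1.
Proof.
intros [Hd Hh] H0 Hl z Hz; unfold unit_disc in Hz.
apply (le_of_radii _ _ (Cmod z) 1); [apply Cmod_ge_0|split; [apply Cmod_ge_0|easy]|].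
intros r Hr; rewrite pow_1; assert (Pz := Cmod_ge_0 z).
assert (Hr0 : 0 < r) by lra.
enough (E : Cmod (divz l f z) <= / r).
{ apply (Rmult_le_compat_r r) in E; [|lra]; rewrite Rinv_l in E; lra. }
apply (weak_max (fun z => 0 <= Cmod z <= r)); [apply disc_bounded_closed| | |lra].
- intros w Hw; destruct (classic (w = RtoC 0)) as [->|Hw0]; [now apply divz_ccont_0|].
  apply ex_cderive_ccont, divz_cderive, Hh; [easy|unfold unit_disc; lra].
- intros a [_ Ha]; destruct (Rle_lt_or_eq_dec _ _ Ha) as [La|Ea].
  + right; destruct (classic (a = RtoC 0)) as [->|Ha0].
    * exists r; split; [easy|]; split.
      -- intros w Hw; replace (w - 0)%C with w in Hw by ring.
         split; [apply Cmod_ge_0|lra].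
      -- intros w Hw; replace (w - 0)%C with w in Hw by ring.
         apply divz_cderive; [now apply Cmod_pos_neq|apply Hh; unfold unit_disc; lra].
    * apply Cmod_gt_0 in Ha0; exists (Rmin (Cmod a) (r - Cmod a)).
      assert (Hs : forall w, Cmod (w - a) < Rmin (Cmod a) (r - Cmod a) -> 0 < Cmod w < r).
      { intros w Hw; assert (L1 := Rmin_l (Cmod a) (r - Cmod a)).
        assert (L2 := Rmin_r (Cmod a) (r - Cmod a)).
        assert (T1 := Cmod_triangle_minus w a).
        assert (T2 := Cmod_triangle_minus a w); rewrite Cmod_minus_sym in T2; lra. }
      split; [apply Rmin_pos; lra|split].
      -- intros w Hw; specialize (Hs w Hw); lra.
      -- intros w [_ Hw]; specialize (Hs w Hw).
         apply divz_cderive; [now apply Cmod_pos_neq|apply Hh; unfold unit_disc; lra].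
  + left; rewrite divz_neq by (apply Cmod_pos_neq; lra).
    rewrite Cmod_div, Ea by (apply Cmod_pos_neq; lra).
    assert (D : unit_disc a) by (unfold unit_disc; lra).
    specialize (Hd a D); unfold unit_disc in Hd; unfold Rdiv; rewrite <- (Rmult_1_l (/ r)) at 2.
    apply Rmult_le_compat_r; [left; now apply Rinv_0_lt_compat|lra].
Qed.

Lemma schwarz f : self_map f -> f (RtoC 0) = RtoC 0 ->
  forall z, unit_disc z -> Cmod (f z) <= Cmod z.
Proof.
intros Hf H0 z Hz; destruct (proj2 Hf (RtoC 0) unit_disc_0) as [l Hl].
destruct (classic (z = RtoC 0)) as [->|Hz0]; [rewrite H0; lra|].
assert (B := divz_bound f l Hf H0 Hl z Hz); rewrite divz_neq, Cmod_div in B by easy.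
apply Cmod_gt_0 in Hz0; apply (Rmult_le_compat_r (Cmod z)) in B; [|lra].
unfold Rdiv in B; rewrite Rmult_assoc, Rinv_l in B; lra.
Qed.

Lemma polar_form (z : C) : exists t, z = circ 0 (Cmod z) t.
Proof.
destruct (classic (z = RtoC 0)) as [->|Hz].
- exists 0; rewrite Cmod_0; unfold circ; ring.
- apply Cmod_gt_0 in Hz.
  set (x := fst z / Cmod z); set (y := snd z / Cmod z).
  assert (E : x * x + y * y = 1).
  { unfold x, y; replace (fst z / Cmod z * (fst z / Cmod z) + snd z / Cmod z * (snd z / Cmod z))
      with ((fst z * fst z + snd z * snd z) / (Cmod z * Cmod z)) by (field; lra).
    rewrite <- Cmod_sqr; field; lra. }
  assert (Ht : exists t, cos t = x /\ sin t = y).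
  { assert (Hx : -1 <= x <= 1) by nra.
    destruct (Rle_dec 0 y) as [L|L].
    - exists (acos x); split; [now apply cos_acos|].
      rewrite sin_acos by easy; replace (1 - Rsqr x) with (Rsqr y) by (unfold Rsqr; lra).
      now apply sqrt_Rsqr.
    - exists (- acos x); rewrite cos_neg, sin_neg; split; [now apply cos_acos|].
      rewrite sin_acos by easy; replace (1 - Rsqr x) with (Rsqr (- y)) by (unfold Rsqr; lra).
      rewrite sqrt_Rsqr; lra. }
  destruct Ht as [t [Hx Hy]]; exists t; unfold circ; rewrite Hx, Hy; unfold x, y.
  destruct z as [p q]; unfold Cmult, Cplus, RtoC; simpl; f_equal; field; simpl in Hz; lra.
Qed.

(** After rotating f(0) to 1, [circle_max] on the circle through z gives real part 1, and a number
    of modulus at most 1 with real part 1 is 1. Mere continuity at 0 lets this apply to [divz]. *)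
Lemma max_at_0 (f : C -> C) : (forall z, 0 < Cmod z < 1 -> ex_cderive f z) -> ccont f (RtoC 0) ->
  (forall z, unit_disc z -> Cmod (f z) <= 1) -> Cmod (f (RtoC 0)) = 1 ->
  forall z, unit_disc z -> f z = f (RtoC 0).
Proof.
intros Hf Hc Hb H1 z Hz.
destruct (classic (z = RtoC 0)) as [->|Hz0]; [easy|]; apply Cmod_gt_0 in Hz0.
destruct (unit_phase (f (RtoC 0))) as [p [Hp1 Hp2]].
set (g := fun w => (p * f w)%C).
assert (Hg0 : g (RtoC 0) = RtoC 1) by (unfold g; now rewrite Hp2, H1).
assert (Hgb : forall w, unit_disc w -> Cmod (g w) <= 1).
{ intros w Hw; unfold g; rewrite Cmod_mult, Hp1, Rmult_1_l; auto. }
assert (HD : forall t, unit_disc (circ 0 (Cmod z) t)).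
{ intros t; assert (E := Cmod_circ 0 (Cmod z) t ltac:(lra)).
  replace (circ 0 (Cmod z) t - 0)%C with (circ 0 (Cmod z) t) in E by ring.
  unfold unit_disc in *; lra. }
destruct (polar_form z) as [t Ht].
assert (M : Re (g z) = 1).
{ rewrite Ht, (circle_max g 0 1 (Cmod z)), Hg0; [easy| | |unfold unit_disc in Hz; lra|].
  - intros w Hw; replace (w - 0)%C with w in Hw by ring.
    apply ex_cderive_mult; [apply ex_cderive_const|auto].
  - apply ccont_mult; [apply ex_cderive_ccont, ex_cderive_const|easy].
  - intros s; rewrite Hg0; change (Re (RtoC 1)) with 1.
    apply Rle_trans with (1 := Rle_abs _).
    exact (Rle_trans _ _ _ (Re_le_Cmod _) (Hgb _ (HD s))). }
assert (E : g z = RtoC 1).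
{ specialize (Hgb z Hz); assert (S := Cmod_sqr (g z)); unfold Re in M.
  assert (Q := Cmod_ge_0 (g z)).
  destruct (g z) as [x y]; simpl in M, S; subst x; unfold RtoC; f_equal; nra. }
assert (Hp0 : p <> RtoC 0) by (apply Cmod_pos_neq; lra).
assert (E2 : (p * f z)%C = (p * f (RtoC 0))%C) by (rewrite Hp2, H1; exact E).
replace (f z) with ((p * f z) / p)%C by (field; easy); rewrite E2; field; easy.
Qed.

Lemma schwarz_rotation f l : self_map f -> f (RtoC 0) = RtoC 0 ->
  is_cderive f (RtoC 0) l -> Cmod l = 1 -> forall z, unit_disc z -> f z = (l * z)%C.
Proof.
intros Hf H0 Hl H1 z Hz.
destruct (classic (z = RtoC 0)) as [->|Hz0]; [rewrite H0; ring|].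
assert (E : divz l f z = divz l f (RtoC 0)).
{ apply max_at_0; [| |apply divz_bound; easy|now rewrite divz_0|easy].
  - intros w Hw; apply divz_cderive; [now apply Cmod_pos_neq|apply Hf, Hw].
  - now apply divz_ccont_0. }
rewrite divz_0, divz_neq in E by easy; rewrite <- E; field; easy.
Qed.

Lemma self_map_comp f g : self_map f -> self_map g -> self_map (fun z => f (g z)).
Proof.
intros [Hf1 Hf2] [Hg1 Hg2]; split; [auto|].
intros z Hz; apply ex_cderive_comp; [apply Hf2; auto|apply Hg2; auto].
Qed.

Lemma max_principle (f : C -> C) (p : C) : holomorphic_on_disc f -> unit_disc p ->
  (forall z, unit_disc z -> Cmod (f z) <= 1) -> Cmod (f p) = 1 ->
  forall z, unit_disc z -> f z = f p.
Proof.
intros Hf Hp Hb H1 z Hz; rewrite <- (mob_invol p z Hp Hz), <- (mob_0 p) at 1.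
assert (Hh : forall w, unit_disc w -> ex_cderive (fun w => f (mob p w)) w).
{ intros w Hw; apply ex_cderive_comp; [apply Hf, mob_disc; easy|].
  apply ex_cderive_mob; [easy|now left]. }
rewrite (mob_0 p).
rewrite (max_at_0 (fun w => f (mob p w))); [now rewrite mob_0| | | | |now apply mob_disc].
- intros w Hw; apply Hh, Hw.
- apply ex_cderive_ccont, Hh, unit_disc_0.
- intros w Hw; apply Hb, mob_disc; easy.
- now rewrite mob_0.
Qed.

Lemma mob_sqr a z : unit_disc a -> unit_disc z ->
  (1 - Cmod (mob a z) * Cmod (mob a z)) *
    (Cmod (1 - Cconj a * z) * Cmod (1 - Cconj a * z)) =
  (1 - Cmod a * Cmod a) * (1 - Cmod z * Cmod z).
Proof.
intros Ha Hz; assert (Hn := mob_denom_neq a z Ha (Rlt_le _ _ Hz)).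
assert (Hp := proj1 (Cmod_gt_0 _) Hn); unfold mob; rewrite Cmod_div by easy.
assert (I := mob_identity a z); field_simplify; [|lra]; simpl; lra.
Qed.

Theorem schwarz_pick_mob f z w : self_map f -> unit_disc z -> unit_disc w ->
  Cmod (mob (f w) (f z)) <= Cmod (mob w z).
Proof.
intros Hf Hz Hw; assert (Hfw := proj1 Hf w Hw).
assert (E := schwarz (fun x => mob (f w) (f (mob w x)))).
rewrite <- (mob_invol w z) at 1 by easy; apply E.
- apply (self_map_comp (mob (f w)) (fun x => f (mob w x))); [now apply mob_self_map|].
  apply (self_map_comp f (mob w)); [easy|now apply mob_self_map].
- rewrite mob_0; apply mob_self.
- now apply mob_disc.
Qed.

(** The form without denominators: when w is fixed by f, the factor 1 - |w|^2 can be cancelled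
    before w tends to the circle, which yields Wolff's lemma. *)
Theorem schwarz_pick f z w : self_map f -> unit_disc z -> unit_disc w ->
  (1 - Cmod z * Cmod z) * (1 - Cmod w * Cmod w) *
    (Cmod (1 - Cconj (f w) * f z) * Cmod (1 - Cconj (f w) * f z)) <=
  (1 - Cmod (f z) * Cmod (f z)) * (1 - Cmod (f w) * Cmod (f w)) *
    (Cmod (1 - Cconj w * z) * Cmod (1 - Cconj w * z)).
Proof.
intros Hf Hz Hw; assert (Hfw := proj1 Hf w Hw); assert (Hfz := proj1 Hf z Hz).
assert (S := schwarz_pick_mob f z w Hf Hz Hw).
assert (E1 := mob_sqr (f w) (f z) Hfw Hfz); assert (E2 := mob_sqr w z Hw Hz).
rewrite (Rmult_comm (1 - Cmod z * Cmod z)), (Rmult_comm (1 - Cmod (f z) * Cmod (f z))).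
rewrite <- E1, <- E2.
assert (S2 : Cmod (mob (f w) (f z)) * Cmod (mob (f w) (f z)) <= Cmod (mob w z) * Cmod (mob w z)).
{ apply Rmult_le_compat; auto using Cmod_ge_0. }
set (A := Cmod (1 - Cconj w * z) * _); set (B := Cmod (1 - Cconj (f w) * f z) * _).
assert (0 <= A) by (apply Rmult_le_pos; apply Cmod_ge_0).
assert (0 <= B) by (apply Rmult_le_pos; apply Cmod_ge_0).
assert (0 <= A * B) by now apply Rmult_le_pos.
nra.
Qed.

(* [|f|^k <= |z|^(k+1)] on an annulus [e <= |z| < 1] comes from the maximum
   principle for [f^k / z^(k+1)], which is at most [1] on the inner circle as
   soon as [q^k <= e]. *)
Lemma schwarz_strict f l : self_map f -> f (RtoC 0) = RtoC 0 ->
  is_cderive f (RtoC 0) l -> Cmod l < 1 ->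
  exists e q k, 0 < e < 1 /\ 0 < q < 1 /\
    (forall z, Cmod z <= e -> Cmod (f z) <= q * Cmod z) /\
    (forall z, e <= Cmod z < 1 -> Cmod (f z) ^ k <= Cmod z ^ (S k)).
Proof.
intros [Hd Hh] H0 Hl H1; assert (Pl := Cmod_ge_0 l).
set (q := (1 + Cmod l) / 2).
destruct (divz_ccont_0 l f H0 Hl (q - Cmod l)) as [d [Hdp Hcl]]; [unfold q; lra|].
set (e := Rmin (d / 2) (1 / 2)).
assert (He : 0 < e) by (apply Rmin_pos; lra).
assert (e <= d / 2) by apply Rmin_l; assert (e <= 1 / 2) by apply Rmin_r.
assert (Hq : 0 < q < 1) by (unfold q; lra).
assert (Hs : forall z, Cmod z <= e -> Cmod (f z) <= q * Cmod z).
{ intros z Hz; destruct (classic (z = RtoC 0)) as [->|Hz0].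
  - rewrite H0, Cmod_0; lra.
  - specialize (Hcl z); replace (z - 0)%C with z in Hcl by ring.
    specialize (Hcl ltac:(lra)); rewrite divz_0, divz_neq in Hcl by easy.
    assert (T := Cmod_triangle_minus (f z / z) l); rewrite Cmod_div in T by easy.
    assert (P := proj1 (Cmod_gt_0 z) Hz0).
    assert (Q : Cmod (f z) / Cmod z <= q) by lra.
    apply (Rmult_le_compat_r (Cmod z)) in Q; [|lra].
    unfold Rdiv in Q; rewrite Rmult_assoc, Rinv_l in Q; lra. }
destruct (pow_lt_1_zero q) with (y := e) as [k Hk]; [rewrite Rabs_pos_eq; lra|easy|].
specialize (Hk k (Nat.le_refl k)); rewrite Rabs_pos_eq in Hk by (apply pow_le; lra).
exists e, q, k; split; [lra|split; [easy|split; [easy|]]].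
intros z [Hz1 Hz2]; assert (Hz0 : 0 < Cmod z) by lra.
apply (le_of_radii _ _ (Cmod z) (S k)); [apply pow_le, Cmod_ge_0|lra|].
intros r Hr.
assert (Pr : 0 < r ^ S k) by (apply pow_lt; lra).
assert (Pz : 0 < Cmod z ^ S k) by (apply pow_lt; lra).
set (g := fun z => (f z ^ k / z ^ S k)%C).
assert (Hpn : forall w m, 0 < Cmod w -> (w ^ m)%C <> RtoC 0).
{ intros w m Hw; apply Cmod_pos_neq; rewrite Cmod_pow; now apply pow_lt. }
assert (Hg : forall w, 0 < Cmod w < 1 -> ex_cderive g w).
{ intros w Hw; apply ex_cderive_div; [apply ex_cderive_pow, Hh, Hw| |now apply Hpn].
  apply ex_cderive_pow, ex_cderive_id. }
assert (Hgm : forall w, 0 < Cmod w -> Cmod (g w) = Cmod (f w) ^ k / Cmod w ^ S k).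
{ intros w Hw; unfold g; rewrite Cmod_div, !Cmod_pow; auto. }
assert (B : Cmod (g z) <= / r ^ S k).
{ apply (weak_max (fun z => e <= Cmod z <= r)); [apply disc_bounded_closed| | |lra].
  - intros w Hw; apply ex_cderive_ccont, Hg; lra.
  - intros a [Ha1 Ha2].
    assert (Pa : 0 < Cmod a ^ S k) by (apply pow_lt; lra).
    destruct (Rle_lt_or_eq_dec _ _ Ha1) as [L1|E1];
      [destruct (Rle_lt_or_eq_dec _ _ Ha2) as [L2|E2]|].
    + right; exists (Rmin (Cmod a - e) (r - Cmod a)).
      assert (Hs' : forall w, Cmod (w - a) < Rmin (Cmod a - e) (r - Cmod a) -> e < Cmod w < r).
      { intros w Hw; assert (M1 := Rmin_l (Cmod a - e) (r - Cmod a)).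
        assert (M2 := Rmin_r (Cmod a - e) (r - Cmod a)).
        assert (T1 := Cmod_triangle_minus w a).
        assert (T2 := Cmod_triangle_minus a w); rewrite Cmod_minus_sym in T2; lra. }
      split; [apply Rmin_pos; lra|split].
      * intros w Hw; specialize (Hs' w Hw); lra.
      * intros w [_ Hw]; specialize (Hs' w Hw); apply Hg; lra.
    + left; rewrite Hgm, E2 by lra; unfold Rdiv; rewrite <- (Rmult_1_l (/ r ^ S k)) at 2.
      apply Rmult_le_compat_r; [left; now apply Rinv_0_lt_compat|].
      rewrite <- (pow1 k); apply pow_incr; split; [apply Cmod_ge_0|].
      left; apply Hd; unfold unit_disc; lra.
    + left; rewrite Hgm, <- E1 by lra.
      apply Rle_trans with 1.
      * apply Rmult_le_reg_r with (e ^ S k); [apply pow_lt; lra|].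
        unfold Rdiv; rewrite Rmult_assoc, Rinv_l by (apply Rgt_not_eq, pow_lt; lra).
        rewrite Rmult_1_r, Rmult_1_l.
        apply Rle_trans with ((q * e) ^ k).
        -- apply pow_incr; split; [apply Cmod_ge_0|]; rewrite E1; apply Hs; lra.
        -- rewrite Rpow_mult_distr; simpl; apply Rmult_le_compat_r; [apply pow_le; lra|lra].
      * rewrite <- Rinv_1; apply Rinv_le_contravar; [easy|].
        rewrite <- (pow1 (S k)); apply pow_incr; lra. }
rewrite Hgm in B by easy.
apply (Rmult_le_compat_r (Cmod z ^ S k)) in B; [|lra].
apply (Rmult_le_compat_r (r ^ S k)) in B; [|lra].
unfold Rdiv in B; rewrite !(Rmult_assoc (Cmod (f z) ^ k)) in B.
replace (/ Cmod z ^ S k * Cmod z ^ S k * r ^ S k) with (r ^ S k) in B by (field; lra).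
replace (/ r ^ S k * Cmod z ^ S k * r ^ S k) with (Cmod z ^ S k) in B by (field; lra).
exact B.
Qed.

(** * Bounded functions defined by series of poles *)

Fixpoint rsum (u : nat -> R) (n : nat) : R :=
  match n with O => 0 | S m => rsum u m + u m end.

Fixpoint csum (u : nat -> C) (n : nat) : C :=
  match n with O => RtoC 0 | S m => (csum u m + u m)%C end.

Lemma rsum_le u v n : (forall k, (k < n)%nat -> u k <= v k) -> rsum u n <= rsum v n.
Proof.
induction n as [|n IH]; simpl; intros H; [lra|].
specialize (IH (fun k Hk => H k (Nat.lt_lt_succ_r _ _ Hk))); specialize (H n ltac:(lia)); lra.
Qed.

Lemma rsum_nonneg u n : (forall k, (k < n)%nat -> 0 <= u k) -> 0 <= rsum u n.
Proof.
intros H; apply Rle_trans with (rsum (fun _ => 0) n).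
- clear; induction n; simpl; lra.
- now apply rsum_le.
Qed.

Lemma rsum_term_le u j n : (forall k, (k < n)%nat -> 0 <= u k) -> (j < n)%nat -> u j <= rsum u n.
Proof.
intros H; induction n as [|n IH]; [lia|]; intros Hj; simpl.
assert (Pn := H n ltac:(lia)); destruct (Nat.eq_dec j n) as [->|Hne].
- assert (P := rsum_nonneg u n (fun k Hk => H k ltac:(lia))); lra.
- specialize (IH (fun k Hk => H k ltac:(lia)) ltac:(lia)); lra.
Qed.

Lemma rsum_scal c u n : rsum (fun k => c * u k) n = c * rsum u n.
Proof. induction n as [|n IH]; simpl; [|rewrite IH]; ring. Qed.

Lemma rsum_const c n : rsum (fun _ => c) n = INR n * c.
Proof.
induction n as [|n IH]; [simpl; ring|].
rewrite S_INR; simpl; rewrite IH; ring.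
Qed.

Lemma rsum_half n c : 0 <= c -> rsum (fun k => c * (/ 2) ^ k) n <= 2 * c.
Proof.
intros Hc; enough (E : rsum (fun k => c * (/ 2) ^ k) n = 2 * c - 2 * c * (/ 2) ^ n).
{ assert (P : 0 <= (/ 2) ^ n) by (apply pow_le; lra); rewrite E; nra. }
induction n as [|n IH]; simpl; [ring|rewrite IH; simpl; field].
Qed.

Lemma Cmod_csum u n : Cmod (csum u n) <= rsum (fun k => Cmod (u k)) n.
Proof.
induction n as [|n IH]; simpl; [rewrite Cmod_0; lra|].
eapply Rle_trans; [apply Cmod_triangle|lra].
Qed.

Lemma csum_ext u v n : (forall k, (k < n)%nat -> u k = v k) -> csum u n = csum v n.
Proof.
induction n as [|n IH]; simpl; intros H; [easy|].
rewrite IH by (intros; apply H; lia); rewrite H by lia; easy.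
Qed.

Lemma fst_csum u n : fst (csum u n) = rsum (fun k => fst (u k)) n.
Proof. induction n as [|n IH]; simpl; [easy|now rewrite IH]. Qed.

Lemma snd_csum u n : snd (csum u n) = rsum (fun k => snd (u k)) n.
Proof. induction n as [|n IH]; simpl; [easy|now rewrite IH]. Qed.

Lemma cconv_ext u v l : (forall n, u n = v n) -> cconv u l -> cconv v l.
Proof. intros E H eps He; destruct (H eps He) as [N HN]; exists N; intros; rewrite <- E; auto. Qed.

Lemma cconv_const l : cconv (fun _ => l) l.
Proof.
intros eps He; exists O; intros; replace (l - l)%C with (RtoC 0) by ring; now rewrite Cmod_0.
Qed.

Lemma cconv_plus u v l m : cconv u l -> cconv v m -> cconv (fun n => u n + v n)%C (l + m)%C.
Proof.
intros H1 H2 eps He; assert (He2 : 0 < eps / 2) by lra.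
destruct (H1 _ He2) as [N HN], (H2 _ He2) as [N' HN'].
exists (N + N')%nat; intros n Hn; specialize (HN n ltac:(lia)); specialize (HN' n ltac:(lia)).
replace (u n + v n - (l + m))%C with ((u n - l) + (v n - m))%C by ring.
eapply Rle_lt_trans; [apply Cmod_triangle|lra].
Qed.

Lemma cconv_scal c u l : cconv u l -> cconv (fun n => c * u n)%C (c * l)%C.
Proof.
intros H eps He; assert (Pc := Cmod_ge_0 c).
destruct (H (eps / (Cmod c + 1))) as [N HN]; [apply Rdiv_lt_0_compat; lra|].
exists N; intros n Hn; specialize (HN n Hn).
replace (c * u n - c * l)%C with (c * (u n - l))%C by ring; rewrite Cmod_mult.
assert (P := Cmod_ge_0 (u n - l)).
apply (Rmult_lt_compat_l (Cmod c + 1)) in HN; [|lra].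
replace ((Cmod c + 1) * (eps / (Cmod c + 1))) with eps in HN by (field; lra).
lra.
Qed.

Lemma cconv_ccont f u l : ccont f l -> cconv u l -> cconv (fun n => f (u n)) (f l).
Proof.
intros Hf Hu eps He; destruct (Hf eps He) as [d [Hd H]]; destruct (Hu d Hd) as [N HN].
exists N; auto.
Qed.

Lemma cconv_Cmod_le u l M : (forall n, Cmod (u n) <= M) -> cconv u l -> Cmod l <= M.
Proof.
intros H Hu; apply le_epsilon; intros eps He; destruct (Hu eps He) as [N HN].
specialize (HN N (Nat.le_refl N)); specialize (H N).
assert (T := Cmod_triangle_minus l (u N)); rewrite Cmod_minus_sym in T; lra.
Qed.

Lemma cconv_Re_ge u l a N : (forall n, (N <= n)%nat -> a <= Re (u n)) -> cconv u l -> a <= Re l.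
Proof.
intros H Hu; apply le_epsilon; intros eps He; destruct (Hu eps He) as [N' HN].
specialize (HN (N + N')%nat ltac:(lia)); specialize (H (N + N')%nat ltac:(lia)).
assert (T := Re_le_Cmod (u (N + N')%nat - l)); apply Rabs_le_between in T.
change (fst (u (N + N')%nat - l)%C) with (Re (u (N + N')%nat) - Re l) in T; lra.
Qed.

Lemma cconv_unique u l m : cconv u l -> cconv u m -> l = m.
Proof.
intros H1 H2; assert (E : (l - m)%C = RtoC 0).
{ apply Cmod_eq_0, Rle_antisym; [|apply Cmod_ge_0].
  apply le_epsilon; intros eps He.
  destruct (H1 (eps / 2)) as [N HN]; [lra|]; destruct (H2 (eps / 2)) as [N' HN']; [lra|].
  specialize (HN (N + N')%nat ltac:(lia)); specialize (HN' (N + N')%nat ltac:(lia)).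
  assert (T := Cmod_triangle_sub l (u (N + N')%nat) m).
  rewrite (Cmod_minus_sym l (u (N + N')%nat)) in T; lra. }
replace l with (l - m + m)%C by ring; rewrite E; ring.
Qed.

(** The partial sums of B and of u + B are both nondecreasing and bounded; those of u are their
    difference. *)
Lemma rsum_converges u B S : (forall k, Rabs (u k) <= B k) -> (forall n, rsum B n <= S) ->
  exists l, forall eps, 0 < eps -> exists N, forall n, (N <= n)%nat -> Rabs (rsum u n - l) < eps.
Proof.
intros H HS.
assert (HB : forall k, 0 <= B k) by (intros k; apply Rle_trans with (2 := H k), Rabs_pos).
destruct (ex_finite_lim_seq_incr (rsum B) S) as [b Hb]; [|easy|].
{ intros n; simpl; specialize (HB n); lra. }
destruct (ex_finite_lim_seq_incr (fun n => rsum u n + rsum B n) (2 * S)) as [a Ha].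
{ intros n; simpl; specialize (H n); apply Rabs_le_between in H; lra. }
{ intros n; assert (rsum u n <= rsum B n).
  { apply rsum_le; intros k _; apply Rle_trans with (1 := Rle_abs _), H. }
  specialize (HS n); lra. }
assert (L := is_lim_seq_minus' _ _ _ _ Ha Hb); exists (a - b); intros eps He.
apply is_lim_seq_Reals in L; destruct (L eps He) as [N HN]; exists N; intros n Hn.
specialize (HN n Hn); unfold Rdist in HN.
replace (rsum u n + rsum B n - rsum B n) with (rsum u n) in HN by ring; exact HN.
Qed.

Lemma csum_converges u B S : (forall k, Cmod (u k) <= B k) -> (forall n, rsum B n <= S) ->
  exists l, cconv (csum u) l.
Proof.
intros H HS.
destruct (rsum_converges (fun k => fst (u k)) B S) as [a Ha]; [|easy|].
{ intros k; apply Rle_trans with (2 := H k), Re_le_Cmod. }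
destruct (rsum_converges (fun k => snd (u k)) B S) as [b Hb]; [|easy|].
{ intros k; apply Rle_trans with (2 := H k), Im_le_Cmod. }
exists (a, b); intros eps He.
destruct (Ha (eps / 2)) as [N HN]; [lra|]; destruct (Hb (eps / 2)) as [N' HN']; [lra|].
exists (N + N')%nat; intros n Hn; eapply Rle_lt_trans; [apply Cmod_le_Rmax|].
specialize (HN n ltac:(lia)); specialize (HN' n ltac:(lia)).
rewrite <- fst_csum in HN; rewrite <- snd_csum in HN'.
assert (M := Rmax_lub_lt _ _ _ HN HN').
change (fst (csum u n - (a, b))%C) with (fst (csum u n) - a).
change (snd (csum u n - (a, b))%C) with (snd (csum u n) - b); lra.
Qed.

(* The bounds satisfied by [c / (1 - a z)] for [|a| <= 1] and [|c| <= A]: they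
   add up, so that a series of such functions can be differentiated termwise. *)
Definition tame_with (A : R) (f df : C -> C) : Prop :=
  forall z, unit_disc z ->
    Cmod (f z) <= A * / (1 - Cmod z) /\
    Cmod (df z) <= A * (/ (1 - Cmod z) * / (1 - Cmod z)) /\
    forall w, unit_disc w -> Cmod (f w - f z - (w - z) * df z)%C <=
      A * (Cmod (w - z) * Cmod (w - z) * (/ (1 - Cmod w) * (/ (1 - Cmod z) * / (1 - Cmod z)))).

Definition tame (A : R) (f : C -> C) : Prop := exists df, tame_with A f df.

Lemma unit_disc_inv z : unit_disc z -> 1 <= / (1 - Cmod z).
Proof.
unfold unit_disc; intros Hz; assert (P := Cmod_ge_0 z).
rewrite <- Rinv_1 at 1; apply Rinv_le_contravar; lra.
Qed.

Lemma tame_holomorphic A f : tame A f -> holomorphic_on_disc f.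
Proof.
intros [df H] z Hz; exists (df z); apply is_cderive_eps; intros eps He.
destruct (H z Hz) as [H1 [_ H2]]; unfold unit_disc in *.
set (r := 1 - Cmod z) in *; assert (Hr : 0 < r) by (unfold r; lra).
assert (HA : 0 <= A).
{ apply Rmult_le_reg_r with (/ r); [now apply Rinv_0_lt_compat|].
  rewrite Rmult_0_l; apply Rle_trans with (2 := H1), Cmod_ge_0. }
assert (Hd : 0 < eps * r * r * r / (2 * (A + 1))).
{ apply Rdiv_lt_0_compat; [repeat apply Rmult_lt_0_compat; easy|lra]. }
exists (Rmin (r / 2) (eps * r * r * r / (2 * (A + 1)))); split; [apply Rmin_pos; lra|].
intros w Hw; assert (Hw1 := Rlt_le_trans _ _ _ Hw (Rmin_l _ _)).
assert (Hw2 := Rlt_le_trans _ _ _ Hw (Rmin_r _ _)).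
assert (T := Cmod_triangle_minus w z).
assert (Hwr : r / 2 < 1 - Cmod w) by (unfold r in *; lra).
eapply Rle_trans; [apply H2; unfold r in *; lra|].
assert (P := Cmod_ge_0 (w - z)).
replace (A * (Cmod (w - z) * Cmod (w - z) * (/ (1 - Cmod w) * (/ r * / r)))) with
  (A * (Cmod (w - z) * (/ (1 - Cmod w) * (/ r * / r))) * Cmod (w - z)) by ring.
apply Rmult_le_compat_r; [easy|].
apply Rle_trans with ((A + 1) * (eps * r * r * r / (2 * (A + 1)) * (/ (r / 2) * (/ r * / r)))).
- assert (Q : 0 < / r * / r) by (apply Rmult_lt_0_compat; now apply Rinv_0_lt_compat).
  assert (Q1 : 0 < / (1 - Cmod w)) by (apply Rinv_0_lt_compat; lra).
  assert (Q2 : / (1 - Cmod w) <= / (r / 2)) by (apply Rinv_le_contravar; lra).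
  apply Rmult_le_compat; [easy| |lra|].
  + apply Rmult_le_pos; [easy|apply Rmult_le_pos; lra].
  + apply Rmult_le_compat; [easy|apply Rmult_le_pos; lra|lra|].
    apply Rmult_le_compat_r; lra.
- right; field; lra.
Qed.

Lemma tame_weaken A B f : A <= B -> tame A f -> tame B f.
Proof.
intros HAB [df H]; exists df; intros z Hz; destruct (H z Hz) as [H1 [H2 H3]].
assert (P := unit_disc_inv z Hz); split; [|split].
- eapply Rle_trans; [exact H1|apply Rmult_le_compat_r; lra].
- eapply Rle_trans; [exact H2|apply Rmult_le_compat_r; [nra|lra]].
- intros w Hw; eapply Rle_trans; [exact (H3 w Hw)|]; apply Rmult_le_compat_r; [|lra].
  assert (Q := unit_disc_inv w Hw).
  repeat apply Rmult_le_pos; try apply Cmod_ge_0; lra.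
Qed.

Lemma tame_plus A B f g : tame A f -> tame B g -> tame (A + B) (fun z => f z + g z)%C.
Proof.
intros [df H] [dg G]; exists (fun z => df z + dg z)%C; intros z Hz.
destruct (H z Hz) as [H1 [H2 H3]]; destruct (G z Hz) as [G1 [G2 G3]].
rewrite !(Rmult_plus_distr_r A B); split; [|split].
- eapply Rle_trans; [apply Cmod_triangle|lra].
- eapply Rle_trans; [apply Cmod_triangle|lra].
- intros w Hw; specialize (H3 w Hw); specialize (G3 w Hw).
  replace (f w + g w - (f z + g z) - (w - z) * (df z + dg z))%C with
    ((f w - f z - (w - z) * df z) + (g w - g z - (w - z) * dg z))%C by ring.
  rewrite (Rmult_plus_distr_r A B); eapply Rle_trans; [apply Cmod_triangle|lra].
Qed.

Lemma tame_const c : tame (Cmod c) (fun _ => c).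
Proof.
exists (fun _ => RtoC 0); intros z Hz; assert (P := unit_disc_inv z Hz).
assert (Pc := Cmod_ge_0 c); split; [nra|split].
- rewrite Cmod_0; repeat apply Rmult_le_pos; lra.
- intros w Hw; assert (Q := unit_disc_inv w Hw).
  replace (c - c - (w - z) * 0)%C with (RtoC 0) by ring; rewrite Cmod_0.
  repeat apply Rmult_le_pos; try apply Cmod_ge_0; lra.
Qed.

Lemma pole_denom_ge a z : Cmod a <= 1 -> 1 - Cmod z <= Cmod (1 - a * z).
Proof.
intros Ha; assert (T := Cmod_triangle_minus 1 (a * z)).
rewrite Cmod_1, Cmod_mult in T; assert (P := Cmod_ge_0 z); nra.
Qed.

(** The second-order remainder is exactly c a^2 (w - z)^2 / ((1 - a w) (1 - a z)^2), and |1 - a z|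
    >= 1 - |z|. *)
Lemma tame_pole a c : Cmod a <= 1 -> tame (Cmod c) (fun z => c / (1 - a * z))%C.
Proof.
intros Ha; exists (fun z => c * a / ((1 - a * z) * (1 - a * z)))%C; intros z Hz.
assert (Pc := Cmod_ge_0 c); assert (Pa := Cmod_ge_0 a).
assert (N : forall w, unit_disc w -> (1 - a * w)%C <> RtoC 0 /\
  0 < / Cmod (1 - a * w) <= / (1 - Cmod w)).
{ intros w Hw; assert (G := pole_denom_ge a w Ha); unfold unit_disc in Hw.
  split; [apply Cmod_pos_neq; lra|split; [apply Rinv_0_lt_compat; lra|]].
  apply Rinv_le_contravar; lra. }
destruct (N z Hz) as [Nz [Nz1 Nz2]].
assert (Nzz : ((1 - a * z) * (1 - a * z))%C <> RtoC 0) by now apply Cmult_neq_0.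
assert (Nz3 : / Cmod (1 - a * z) * / Cmod (1 - a * z) <= / (1 - Cmod z) * / (1 - Cmod z))
  by (apply Rmult_le_compat; lra).
assert (Nz4 : 0 <= / Cmod (1 - a * z) * / Cmod (1 - a * z)) by (apply Rmult_le_pos; lra).
split; [|split].
- rewrite Cmod_div by easy; apply Rmult_le_compat_l; easy.
- rewrite Cmod_div, !Cmod_mult by easy; unfold Rdiv; rewrite Rinv_mult.
  rewrite Rmult_assoc; apply Rmult_le_compat_l; [easy|].
  apply Rle_trans with (1 * (/ Cmod (1 - a * z) * / Cmod (1 - a * z))); [|lra].
  now apply Rmult_le_compat_r.
- intros w Hw; destruct (N w Hw) as [Nw [Nw1 Nw2]].
  replace (c / (1 - a * w) - c / (1 - a * z) - (w - z) * (c * a / ((1 - a * z) * (1 - a * z))))%C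
    with (c * ((w - z) * (w - z) * ((a * a) * (/ (1 - a * w) * (/ (1 - a * z) * / (1 - a * z))))))%C
    by (field; split; easy).
  rewrite !Cmod_mult, !Cmod_inv by easy; apply Rmult_le_compat_l; [easy|].
  apply Rmult_le_compat_l; [apply Rmult_le_pos; apply Cmod_ge_0|].
  apply Rle_trans with (1 * (/ Cmod (1 - a * w) * (/ Cmod (1 - a * z) * / Cmod (1 - a * z)))).
  + apply Rmult_le_compat_r; [apply Rmult_le_pos; lra|nra].
  + rewrite Rmult_1_l; apply Rmult_le_compat; try lra.
Qed.

Lemma tame_with_csum A f df : (forall k, tame_with (A k) (f k) (df k)) ->
  forall n, tame_with (rsum A n) (fun z => csum (fun k => f k z) n)
    (fun z => csum (fun k => df k z) n).
Proof.
intros H n z Hz; induction n as [|n IH]; simpl.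
- replace (0 - 0)%C with (RtoC 0) by ring; rewrite Cmod_0, !Rmult_0_l.
  split; [lra|split; [lra|]]; intros w _; rewrite Rmult_0_l.
  replace (0 - (w - z) * 0)%C with (RtoC 0) by ring; rewrite Cmod_0; lra.
- destruct IH as [I1 [I2 I3]]; destruct (H n z Hz) as [H1 [H2 H3]].
  rewrite !(Rmult_plus_distr_r (rsum A n) (A n)); split; [|split].
  + eapply Rle_trans; [apply Cmod_triangle|lra].
  + eapply Rle_trans; [apply Cmod_triangle|lra].
  + intros w Hw; specialize (H3 w Hw); specialize (I3 w Hw).
    rewrite (Rmult_plus_distr_r (rsum A n) (A n)).
    match goal with |- Cmod ?X <= _ => replace X with
      ((csum (fun k => f k w) n - csum (fun k => f k z) n - (w - z) * csum (fun k => df k z) n) +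
       (f n w - f n z - (w - z) * df n z))%C by ring end.
    eapply Rle_trans; [apply Cmod_triangle|lra].
Qed.

Lemma tame_csum A f n : (forall k, tame (A k) (f k)) ->
  tame (rsum A n) (fun z => csum (fun k => f k z) n).
Proof.
intros H; destruct (countable_choice _ _ H) as [df Hdf].
exists (fun z => csum (fun k => df k z) n); now apply tame_with_csum.
Qed.

(** Partial sums satisfy the quadratic remainder bound with the common constant M, and such a
    pointwise inequality survives a pointwise limit. So no uniform convergence of derivatives
    enters. *)
Lemma tame_series A f M : (forall k, tame (A k) (f k)) -> (forall n, rsum A n <= M) ->
  exists F, tame M F /\ forall z, unit_disc z -> cconv (csum (fun k => f k z)) (F z).
Proof.
intros H HM; destruct (countable_choice _ _ H) as [df Hdf].
assert (L : forall g : nat -> C -> C,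
  (forall z, unit_disc z -> exists q, 0 <= q /\ forall k, Cmod (g k z) <= A k * q) ->
  exists F, forall z, unit_disc z -> cconv (csum (fun k => g k z)) (F z)).
{ intros g Hg.
  (* Off the disc, where the series may diverge, [epsilon] gives an irrelevant value. *)
  exists (fun z => epsilon (inhabits (RtoC 0)) (fun l => cconv (csum (fun k => g k z)) l)).
  intros z Hz; apply epsilon_spec; destruct (Hg z Hz) as [q [Hq Hgq]].
  apply (csum_converges _ (fun k => q * A k) (q * M)).
  - intros k; rewrite Rmult_comm; apply Hgq.
  - intros n; rewrite rsum_scal; now apply Rmult_le_compat_l. }
destruct (L f) as [F HF].
{ intros z Hz; exists (/ (1 - Cmod z)); split; [assert (P := unit_disc_inv z Hz); lra|].
  intros k; apply (Hdf k z Hz). }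
destruct (L df) as [DF HDF].
{ intros z Hz; exists (/ (1 - Cmod z) * / (1 - Cmod z)).
  split; [assert (P := unit_disc_inv z Hz); nra|]; intros k; apply (Hdf k z Hz). }
exists F; split; [|easy].
assert (T := tame_with_csum A f df Hdf).
exists DF; intros z Hz; assert (P := unit_disc_inv z Hz); split; [|split].
- apply cconv_Cmod_le with (2 := HF z Hz); intros n; destruct (T n z Hz) as [T1 _].
  apply Rle_trans with (1 := T1), Rmult_le_compat_r; [lra|easy].
- apply cconv_Cmod_le with (2 := HDF z Hz); intros n; destruct (T n z Hz) as [_ [T2 _]].
  apply Rle_trans with (1 := T2), Rmult_le_compat_r; [nra|easy].
- intros w Hw; assert (Q := unit_disc_inv w Hw).
  apply cconv_Cmod_le with (u := fun n => (csum (fun k => f k w) n +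
    ((-1) * csum (fun k => f k z) n + (- (w - z)) * csum (fun k => df k z) n))%C).
  + intros n; destruct (T n z Hz) as [_ [_ T3]]; specialize (T3 w Hw).
    match goal with |- Cmod ?X <= _ => match type of T3 with Cmod ?Y <= _ =>
      replace X with Y by ring end end.
    apply Rle_trans with (1 := T3), Rmult_le_compat_r; [|easy].
    repeat apply Rmult_le_pos; try apply Cmod_ge_0; lra.
  + replace (F w - F z - (w - z) * DF z)%C with
      (F w + ((-1) * F z + (- (w - z)) * DF z))%C by ring.
    apply cconv_plus; [now apply HF|apply cconv_plus; apply cconv_scal; auto].
Qed.

(** Equal to e (1 + conj(w) z) / (1 - conj(w) z), the Herglotz kernel of mass e at w, whose real
    part is the Poisson kernel when |w| = 1. Split as constant plus pole to be visibly tame. *)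
Definition herglotz (e : R) (w z : C) : C := (RtoC (- e) + RtoC (2 * e) / (1 - Cconj w * z))%C.

Lemma tame_herglotz e w : 0 <= e -> Cmod w <= 1 -> tame (3 * e) (herglotz e w).
Proof.
intros He Hw; apply tame_weaken with (Cmod (RtoC (- e)) + Cmod (RtoC (2 * e))).
- rewrite !Cmod_R, Rabs_Ropp, !Rabs_pos_eq; lra.
- apply tame_plus; [apply tame_const|apply tame_pole; now rewrite Cmod_conj].
Qed.

Lemma herglotz_0 e w : herglotz e w 0 = RtoC e.
Proof.
unfold herglotz; replace (1 - Cconj w * 0)%C with (RtoC 1) by ring.
rewrite RtoC_mult, RtoC_opp; field.
Qed.

Lemma Re_herglotz e w z : Cmod w <= 1 -> unit_disc z ->
  Re (herglotz e w z) * (Cmod (1 - Cconj w * z) * Cmod (1 - Cconj w * z)) =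
  e * (1 - Cmod (Cconj w * z) * Cmod (Cconj w * z)).
Proof.
intros Hw Hz; assert (G := pole_denom_ge (Cconj w) z); rewrite Cmod_conj in G.
specialize (G Hw); unfold unit_disc in Hz; unfold herglotz.
set (u := (Cconj w * z)%C) in *; rewrite !Cmod_sqr.
assert (P : 0 < Cmod (1 - u) * Cmod (1 - u)) by (apply Rmult_lt_0_compat; lra).
rewrite Cmod_sqr in P; destruct u as [x y]; unfold Cdiv, Cinv, Cmult, Cplus, Re; simpl in *.
field; lra.
Qed.

Lemma Re_herglotz_nonneg e w z : 0 <= e -> Cmod w <= 1 -> unit_disc z ->
  0 <= Re (herglotz e w z).
Proof.
intros He Hw Hz; assert (E := Re_herglotz e w z Hw Hz).
assert (G := pole_denom_ge (Cconj w) z); rewrite Cmod_conj in G; specialize (G Hw).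
unfold unit_disc in Hz.
assert (P : 0 < Cmod (1 - Cconj w * z) * Cmod (1 - Cconj w * z))
  by (apply Rmult_lt_0_compat; lra).
apply Rmult_le_reg_r with (1 := P); rewrite E, Rmult_0_l.
apply Rmult_le_pos; [easy|]; rewrite Cmod_mult, Cmod_conj.
assert (Pw := Cmod_ge_0 w); assert (Pz := Cmod_ge_0 z).
assert (Cmod w * Cmod z <= 1) by nra; assert (0 <= Cmod w * Cmod z) by nra; nra.
Qed.

Lemma Re_herglotz_radial e w z s : 0 <= e -> Cmod w <= 1 -> unit_disc z -> 0 <= s < 1 ->
  (Cconj w * z)%C = RtoC s -> e / (1 - s) <= Re (herglotz e w z).
Proof.
intros He Hw Hz Hs E; assert (G := Re_herglotz e w z Hw Hz); rewrite E in G.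
rewrite <- RtoC_minus, !Cmod_R, !Rabs_pos_eq in G by lra.
apply Rmult_le_reg_r with ((1 - s) * (1 - s)); [apply Rmult_lt_0_compat; lra|].
rewrite G; replace (e / (1 - s) * ((1 - s) * (1 - s))) with (e * (1 - s)) by (field; lra).
apply Rmult_le_compat_l; [easy|]; nra.
Qed.

(** With H the sum of the series, f = H / (1 + H): this map sends the right half-plane into the unit
    disc, infinity to 1 and 0 to 0. Positivity of the real parts means that one large term suffices
    to bring f near 1. *)
Theorem positive_series_test (h : nat -> C -> C) A M :
  (forall k, tame (A k) (h k)) -> (forall n, rsum A n <= M) ->
  (forall k z, unit_disc z -> 0 <= Re (h k z)) ->
  exists f, holomorphic_on_disc f /\
    (forall z, unit_disc z -> Cmod (f z) <= 1) /\
    (forall z k a, unit_disc z -> 0 < a -> a <= Re (h k z) -> Cmod (f z - 1) <= / a) /\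
    (forall b, (forall n, rsum (fun k => Cmod (h k (RtoC 0))) n <= b) -> Cmod (f (RtoC 0)) <= b).
Proof.
intros Ht HM Hp; destruct (tame_series A h M Ht HM) as [H [HH Hc]].
assert (RS : forall z k n, unit_disc z -> (k < n)%nat -> Re (h k z) <= Re (csum (fun k => h k z) n)).
{ intros z k n Hz Hk; unfold Re; rewrite fst_csum.
  apply (rsum_term_le (fun k => fst (h k z))); [|easy]; intros; now apply Hp. }
assert (RH : forall z k, unit_disc z -> Re (h k z) <= Re (H z)).
{ intros z k Hz; apply cconv_Re_ge with (2 := Hc z Hz) (N := S k); intros; now apply RS. }
assert (R1 : forall z, unit_disc z -> 0 <= Re (H z)).
{ intros z Hz; apply Rle_trans with (2 := RH z O Hz); now apply Hp. }
assert (D1 : forall z, unit_disc z -> 1 + Re (H z) <= Cmod (1 + H z)).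
{ intros z Hz; apply Rle_trans with (2 := Re_le_Cmod _), Rle_trans with (2 := Rle_abs _).
  simpl; unfold Re; lra. }
assert (D2 : forall z, unit_disc z -> Cmod (H z) <= Cmod (1 + H z)).
{ intros z Hz; specialize (R1 z Hz); unfold Re in R1.
  apply Rsqr_incr_0; try apply Cmod_ge_0; unfold Rsqr; rewrite !Cmod_sqr; simpl; nra. }
assert (N : forall z, unit_disc z -> (1 + H z)%C <> RtoC 0).
{ intros z Hz; apply Cmod_pos_neq; specialize (D1 z Hz); specialize (R1 z Hz); lra. }
assert (B : forall z c, unit_disc z -> 0 <= c -> Cmod (H z) <= c * Cmod (1 + H z) ->
  Cmod (H z / (1 + H z)) <= c).
{ intros z c Hz Hc0 L; assert (P := proj1 (Cmod_gt_0 _) (N z Hz)).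
  rewrite Cmod_div by (now apply N); apply Rmult_le_reg_r with (1 := P).
  unfold Rdiv; rewrite Rmult_assoc, Rinv_l; lra. }
exists (fun z => H z / (1 + H z))%C; split; [|split; [|split]].
- assert (Hh := tame_holomorphic M H HH); intros z Hz; apply ex_cderive_div; [now apply Hh| |now apply N].
  apply ex_cderive_plus; [apply ex_cderive_const|now apply Hh].
- intros z Hz; apply B; [easy|lra|]; specialize (D2 z Hz); lra.
- intros z k a Hz Ha L; replace (H z / (1 + H z) - 1)%C with (- / (1 + H z))%C
    by (field; now apply N).
  rewrite Cmod_opp, Cmod_inv by (now apply N).
  apply Rinv_le_contravar; [easy|].
  specialize (D1 z Hz); specialize (RH z k Hz); lra.
- intros b Hb; assert (D0 := unit_disc_0).
  assert (Hb0 : 0 <= b) by apply (Hb O).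
  apply B; [easy|easy|].
  assert (Cmod (H (RtoC 0)) <= b).
  { apply cconv_Cmod_le with (2 := Hc _ D0); intros n.
    apply Rle_trans with (1 := Cmod_csum _ _), Hb. }
  specialize (D1 _ D0); specialize (R1 _ D0); nra.
Qed.

(** * Cesaro means and rotations *)

Definition avg (u : nat -> C) (n : nat) : C :=
  (RtoC (/ INR n) * csum (fun m => u (S m)) n)%C.

Definition bounded_on_disc (f : C -> C) : Prop :=
  exists M, forall z, unit_disc z -> Cmod (f z) <= M.

(** The consequence of mean ergodicity used for necessity, phrased for maps instead of operators so
    that it can be conjugated. The uniformity in z is what the test functions exploit. *)
Definition cesaro_convergent (phi : C -> C) : Prop :=
  forall f, holomorphic_on_disc f -> bounded_on_disc f ->
  exists g, holomorphic_on_disc g /\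
    forall eps, 0 < eps -> exists N, forall n, (N <= n)%nat -> forall z, unit_disc z ->
      Cmod (avg (fun m => f (Nat.iter m phi z)) n - g z) < eps.

Lemma csum_plus u v n : csum (fun k => u k + v k)%C n = (csum u n + csum v n)%C.
Proof. induction n as [|n IH]; simpl; [|rewrite IH]; ring. Qed.

Lemma csum_scal c u n : csum (fun k => c * u k)%C n = (c * csum u n)%C.
Proof. induction n as [|n IH]; simpl; [|rewrite IH]; ring. Qed.

Lemma csum_const c n : csum (fun _ => c) n = (RtoC (INR n) * c)%C.
Proof.
induction n as [|n IH]; [simpl; ring|].
rewrite S_INR, RtoC_plus; simpl; rewrite IH; ring.
Qed.

Lemma RtoC_INR_neq n : (1 <= n)%nat -> RtoC (INR n) <> RtoC 0.
Proof. intros Hn E; apply RtoC_inj in E; apply le_INR in Hn; simpl in Hn; lra. Qed.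

Lemma avg_dist u l n : (1 <= n)%nat ->
  Cmod (avg u n - l) <= / INR n * rsum (fun m => Cmod (u (S m) - l)) n.
Proof.
intros Hn; assert (N := RtoC_INR_neq n Hn).
replace (avg u n - l)%C with (RtoC (/ INR n) * csum (fun m => u (S m) - l)%C n)%C.
- rewrite Cmod_mult, Cmod_R, Rabs_pos_eq.
  + apply Rmult_le_compat_l; [|apply Cmod_csum].
    left; apply Rinv_0_lt_compat; apply le_INR in Hn; simpl in Hn; lra.
  + left; apply Rinv_0_lt_compat; apply le_INR in Hn; simpl in Hn; lra.
- unfold avg.
  change (fun m => (u (S m) - l)%C) with (fun m => (u (S m) + - l)%C).
  rewrite csum_plus, csum_const, RtoC_inv by (intros E; apply N; now rewrite E).
  field; easy.
Qed.

Lemma avg_const u l n : (1 <= n)%nat -> (forall m, u (S m) = l) -> avg u n = l.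
Proof.
intros Hn H; assert (N := RtoC_INR_neq n Hn); unfold avg.
rewrite (csum_ext _ (fun _ => l)), csum_const, RtoC_inv by
  (auto; intros E; apply N; now rewrite E).
field; easy.
Qed.

Lemma rsum_split v N n B e : (forall k, (k < N)%nat -> v k <= B) ->
  (forall k, (N <= k < n)%nat -> v k <= e) -> 0 <= B -> 0 <= e ->
  rsum v n <= INR N * B + INR n * e.
Proof.
intros H1 H2 HB He; induction n as [|n IH].
- simpl; assert (P := pos_INR N); nra.
- destruct (Nat.lt_ge_cases n N) as [L|L].
  + apply Rle_trans with (rsum (fun _ => B) (S n)); [apply rsum_le; intros; apply H1; lia|].
    rewrite rsum_const; assert (INR (S n) <= INR N) by (apply le_INR; lia).
    assert (P := pos_INR (S n)); nra.
  + specialize (IH (fun k Hk => H2 k ltac:(lia))); specialize (H2 n ltac:(lia)).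
    rewrite S_INR; simpl; lra.
Qed.

(** The first N terms cost at most B each, the others e. It is used with N = 0 when the whole orbit
    segment is good. *)
Lemma avg_near u l N n B e : (1 <= n)%nat ->
  (forall k, (1 <= k)%nat -> Cmod (u k - l) <= B) ->
  (forall k, (N < k <= n)%nat -> Cmod (u k - l) <= e) -> 0 <= e ->
  Cmod (avg u n - l) <= INR N * B / INR n + e.
Proof.
intros Hn H1 H2 He; apply Rle_trans with (1 := avg_dist u l n Hn).
assert (HB : 0 <= B) by (apply Rle_trans with (2 := H1 1%nat ltac:(lia)), Cmod_ge_0).
assert (P : 1 <= INR n) by (now apply (le_INR 1)).
apply Rle_trans with (/ INR n * (INR N * B + INR n * e)).
- apply Rmult_le_compat_l; [left; apply Rinv_0_lt_compat; lra|].
  apply rsum_split; auto; intros k Hk; [apply H1; lia|apply H2; lia].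
- right; field; lra.
Qed.

Lemma archimed_div B e : 0 < e ->
  exists N, (1 <= N)%nat /\ forall n, (N <= n)%nat -> B / INR n <= e.
Proof.
intros He; destruct (INR_unbounded (Rabs B / e)) as [N HN].
exists (S N); split; [lia|]; intros n Hn.
assert (L := le_INR _ _ Hn); rewrite S_INR in L; assert (P := pos_INR N).
apply Rmult_le_reg_r with (INR n); [lra|].
unfold Rdiv; rewrite Rmult_assoc, Rinv_l, Rmult_1_r by lra.
apply Rle_trans with (1 := Rle_abs B).
apply Rmult_le_reg_r with (/ e); [now apply Rinv_0_lt_compat|].
replace (e * INR n * / e) with (INR n) by (field; lra); unfold Rdiv in HN; lra.
Qed.

Lemma avg_shift u n :
  (avg (fun m => u (S m)) n - avg u n)%C = (RtoC (/ INR n) * (u (S n) - u 1%nat))%C.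
Proof.
unfold avg.
enough (E : (csum (fun m => u (S (S m))) n + u 1%nat)%C = (csum (fun m => u (S m)) n + u (S n))%C).
{ replace (u (S n)) with (csum (fun m => u (S (S m))) n + u 1%nat - csum (fun m => u (S m)) n)%C
    by (rewrite E; ring). ring. }
induction n as [|n IH]; simpl; [ring|].
rewrite <- Cplus_assoc, (Cplus_comm (u (S (S n)))), Cplus_assoc, IH; ring.
Qed.

Lemma iter_disc phi n z : self_map phi -> unit_disc z -> unit_disc (Nat.iter n phi z).
Proof. intros [H _] Hz; induction n as [|n IH]; simpl; auto. Qed.

Lemma Cmod_small_eq z w : (forall eps, 0 < eps -> Cmod (z - w) < eps) -> z = w.
Proof.
intros H; apply (cconv_unique (fun _ => z)); [apply cconv_const|].
intros eps He; exists O; auto.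
Qed.

Lemma Cmod_bound_diff z w M : Cmod z <= M -> Cmod w <= M -> Cmod (z - w) <= 2 * M.
Proof. intros; assert (T := Cmod_triangle z (- w)); rewrite Cmod_opp in T; unfold Cminus; lra. Qed.

(** Passing from z to phi(z) shifts the sum by one index, which changes the mean by at most 2 M /
    n. *)
Lemma cesaro_limit_invariant phi f g : self_map phi -> bounded_on_disc f ->
  (forall eps, 0 < eps -> exists N, forall n, (N <= n)%nat -> forall z, unit_disc z ->
      Cmod (avg (fun m => f (Nat.iter m phi z)) n - g z) < eps) ->
  forall z, unit_disc z -> g (phi z) = g z.
Proof.
intros Hphi [M HM] H z Hz; apply Cmod_small_eq; intros eps He.
destruct (H (eps / 3)) as [N HN]; [lra|].
destruct (archimed_div (2 * M) (eps / 6)) as [N' [HN1 HN']]; [lra|].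
set (n := (N + N')%nat).
assert (A := HN n ltac:(lia) z Hz).
assert (B := HN n ltac:(lia) (phi z) (proj1 Hphi z Hz)).
assert (Hsh := avg_shift (fun m => f (Nat.iter m phi z)) n).
assert (Q : Cmod (avg (fun m => f (Nat.iter m phi (phi z))) n -
  avg (fun m => f (Nat.iter m phi z)) n) <= eps / 6).
{ replace (avg (fun m => f (Nat.iter m phi (phi z))) n) with
    (avg (fun m => f (Nat.iter (S m) phi z)) n)
    by (unfold avg; f_equal; apply csum_ext; intros; now rewrite !Nat.iter_succ_r).
  rewrite Hsh, Cmod_mult, Cmod_R, Rabs_pos_eq, Rmult_comm.
  - eapply Rle_trans; [|apply (HN' n); lia]; apply Rmult_le_compat_r.
    + left; apply Rinv_0_lt_compat, lt_0_INR; lia.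
    + apply Cmod_bound_diff; apply HM, iter_disc; easy.
  - left; apply Rinv_0_lt_compat, lt_0_INR; lia. }
set (a := avg (fun m => f (Nat.iter m phi (phi z))) n) in *.
set (b := avg (fun m => f (Nat.iter m phi z)) n) in *.
assert (T1 := Cmod_triangle_sub (g (phi z)) a (g z)).
assert (T2 := Cmod_triangle_sub a b (g z)).
rewrite (Cmod_minus_sym (g (phi z)) a) in T1; lra.
Qed.

Lemma flat_const (F : R -> R) a b : a < b ->
  (forall t, a <= t <= b -> forall eps, 0 < eps -> exists d, 0 < d /\
     forall h, Rabs h < d -> Rabs (F (t + h) - F t) <= eps * Rabs h) -> F a = F b.
Proof.
intros Hab H; apply (eq_is_derive (V := R_NormedModule)); [|easy].
intros t Ht; apply is_derive_Reals; intros eps He.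
destruct (H t Ht (eps / 2)) as [d [Hd HH]]; [lra|].
exists (mkposreal d Hd); intros h Hh Hhd; simpl in Hhd.
specialize (HH h Hhd); assert (P := Rabs_pos_lt h Hh).
unfold zero; simpl; rewrite Rminus_0_r; unfold Rdiv; rewrite Rabs_mult, Rabs_inv.
apply Rle_lt_trans with (eps / 2); [|lra].
apply Rmult_le_reg_r with (Rabs h); [easy|].
rewrite Rmult_assoc, Rinv_l, Rmult_1_r by lra; exact HH.
Qed.

(** Along the segment from s z to z the derivative vanishes; then s tends to 0 by continuity. The
    origin is excluded from the hypothesis because invariance under rotations gives no difference
    quotient there. *)
Lemma derivative_zero_const g : holomorphic_on_disc g ->
  (forall z, unit_disc z -> z <> RtoC 0 -> is_cderive g z (RtoC 0)) ->
  forall z, unit_disc z -> g z = g (RtoC 0).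
Proof.
intros Hg H z Hz; destruct (classic (z = RtoC 0)) as [->|Hz0]; [easy|].
assert (Hzp := proj1 (Cmod_gt_0 z) Hz0); unfold unit_disc in Hz.
assert (E : forall s, 0 < s < 1 -> g (RtoC s * z)%C = g z).
{ intros s Hs.
  assert (F : forall t, s <= t <= 1 -> forall eps, 0 < eps -> exists d, 0 < d /\
    forall h, Rabs h < d -> Cmod (g (RtoC (t + h) * z) - g (RtoC t * z))%C <= eps * Rabs h).
  { intros t Ht eps He.
    assert (Ht2 : Cmod (RtoC t * z) = t * Cmod z) by (rewrite Cmod_mult, Cmod_R, Rabs_pos_eq; lra).
    assert (D : is_cderive g (RtoC t * z)%C (RtoC 0)).
    { apply H; [unfold unit_disc; rewrite Ht2; nra|].
      apply Cmod_pos_neq; rewrite Ht2; apply Rmult_lt_0_compat; lra. }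
    apply is_cderive_eps with (eps := eps / Cmod z) in D; [|now apply Rdiv_lt_0_compat].
    destruct D as [d [Hd D]]; exists (d / Cmod z); split; [now apply Rdiv_lt_0_compat|].
    intros h Hh.
    assert (Eh : Cmod (RtoC (t + h) * z - RtoC t * z)%C = Rabs h * Cmod z).
    { rewrite RtoC_plus; replace ((t + h) * z - t * z)%C with (RtoC h * z)%C by ring.
      now rewrite Cmod_mult, Cmod_R. }
    assert (Hh2 : Rabs h * Cmod z < d).
    { apply (Rmult_lt_compat_r (Cmod z)) in Hh; [|easy].
      replace (d / Cmod z * Cmod z) with d in Hh by (field; lra); easy. }
    specialize (D (RtoC (t + h) * z)%C); rewrite Eh in D; specialize (D Hh2).
    match type of D with Cmod ?X <= _ => replace X with
      (g (RtoC (t + h) * z) - g (RtoC t * z))%C in D by ring end.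
    apply Rle_trans with (1 := D); right; field; lra. }
  assert (E1 : Re (g (RtoC s * z)%C) = Re (g (RtoC 1 * z)%C)).
  { apply (flat_const (fun t => Re (g (RtoC t * z)%C)) s 1); [lra|].
    intros t Ht eps He; destruct (F t Ht eps He) as [d [Hd D]]; exists d; split; [easy|].
    intros h Hh; apply Rle_trans with (2 := D h Hh), (Re_le_Cmod (_ - _)%C). }
  assert (E2 : Im (g (RtoC s * z)%C) = Im (g (RtoC 1 * z)%C)).
  { apply (flat_const (fun t => Im (g (RtoC t * z)%C)) s 1); [lra|].
    intros t Ht eps He; destruct (F t Ht eps He) as [d [Hd D]]; exists d; split; [easy|].
    intros h Hh; apply Rle_trans with (2 := D h Hh), (Im_le_Cmod (_ - _)%C). }
  rewrite Cmult_1_l in E1, E2; destruct (g (RtoC s * z)%C), (g z); simpl in *; congruence. }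
assert (Hc := ex_cderive_ccont g (RtoC 0) (Hg _ unit_disc_0)).
apply Cmod_small_eq; intros eps He; destruct (Hc eps He) as [d [Hd D]].
assert (Hm : 0 < Rmin d 1 / 2) by (assert (P := Rmin_pos d 1 Hd Rlt_0_1); lra).
assert (Rmin d 1 <= d) by apply Rmin_l; assert (Rmin d 1 <= 1) by apply Rmin_r.
rewrite <- (E (Rmin d 1 / 2)) by lra; apply D.
replace (RtoC (Rmin d 1 / 2) * z - 0)%C with (RtoC (Rmin d 1 / 2) * z)%C by ring.
rewrite Cmod_mult, Cmod_R, Rabs_pos_eq by lra; nra.
Qed.

Lemma Cpow_plus (z : C) m n : (z ^ (m + n) = z ^ m * z ^ n)%C.
Proof. induction m as [|m IH]; simpl; [|rewrite IH]; ring. Qed.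

(** Two late terms of a convergent subsequence of powers are close, and dividing by the smaller
    power preserves the distance. *)
Lemma unimodular_recurrence lambda d : Cmod lambda = 1 -> 0 < d ->
  exists n, (1 <= n)%nat /\ Cmod (lambda ^ n - 1) < d.
Proof.
intros Hl Hd.
assert (Hp : forall n, Cmod (lambda ^ n) = 1) by (intros; rewrite Cmod_pow, Hl; apply pow1).
destruct (bounded_complex_subseq (fun n => lambda ^ n)%C 1) as [s [l [Hs Hc]]].
{ intros n; rewrite Hp; lra. }
destruct (Hc (d / 2)) as [N HN]; [lra|].
assert (A := HN N ltac:(lia)); assert (B := HN (S N) ltac:(lia)); assert (L := Hs N).
exists (s (S N) - s N)%nat; split; [lia|].
assert (T := Cmod_triangle_sub (lambda ^ s (S N)) l (lambda ^ s N)).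
rewrite (Cmod_minus_sym l) in T.
replace (s (S N)) with (s N + (s (S N) - s N))%nat in T at 1 by lia.
rewrite Cpow_plus in T.
replace (lambda ^ s N * lambda ^ (s (S N) - s N) - lambda ^ s N)%C with
  (lambda ^ s N * (lambda ^ (s (S N) - s N) - 1))%C in T by ring.
rewrite Cmod_mult, Hp in T; lra.
Qed.

Lemma Cconj_mult_self z : (Cconj z * z)%C = RtoC (Cmod z * Cmod z).
Proof. replace (Cmod z * Cmod z) with (Cmod z ^ 2) by ring; rewrite Cmod2_conj; ring. Qed.

Theorem rotation_not_cesaro phi lambda : self_map phi -> Cmod lambda = 1 ->
  (forall z, unit_disc z -> phi z = (lambda * z)%C) ->
  (forall n, (1 <= n)%nat -> (lambda ^ n)%C <> RtoC 1) -> ~ cesaro_convergent phi.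
Proof.
intros Hphi Hl Hrot Hroot HC.
assert (Hp : forall n, Cmod (lambda ^ n) = 1) by (intros; rewrite Cmod_pow, Hl; apply pow1).
assert (Hit : forall n z, unit_disc z -> Nat.iter n phi z = (lambda ^ n * z)%C).
{ induction n as [|n IH]; intros z Hz; simpl; [ring|].
  rewrite Hrot by (now apply iter_disc); rewrite IH by easy; ring. }
(* The total mass is at most 1/2, hence |f(0)| <= 1/2. *)
set (e := fun k => / 4 * (/ 2) ^ k).
assert (He : forall k, 0 < e k) by (intros; apply Rmult_lt_0_compat; [lra|apply pow_lt; lra]).
destruct (positive_series_test (fun k => herglotz (e k) (lambda ^ k)) (fun k => 3 * e k) (3 * (2 * / 4)))
  as [f [Hf [Hf1 [Hf2 Hf3]]]].
- intros k; apply tame_herglotz; [specialize (He k); lra|rewrite Hp; lra].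
- intros n; rewrite rsum_scal; apply Rmult_le_compat_l; [lra|]; apply rsum_half; lra.
- intros k z Hz; apply Re_herglotz_nonneg; [specialize (He k); lra|rewrite Hp; lra|easy].
- specialize (Hf3 (2 * / 4)).
  destruct (HC f Hf) as [g [Hg Hlim]]; [now exists 1|].
  assert (Inv := cesaro_limit_invariant phi f g Hphi (ex_intro _ 1 Hf1) Hlim).
  assert (Inv' : forall n z, unit_disc z -> g (lambda ^ n * z)%C = g z).
  { intros n z Hz; rewrite <- Hit by easy; induction n as [|n IH]; [easy|].
    simpl; rewrite Inv by (now apply iter_disc); easy. }
  assert (G0 : g (RtoC 0) = f (RtoC 0)).
  { apply Cmod_small_eq; intros eps Heps; destruct (Hlim eps Heps) as [N HN].
    specialize (HN (S N) ltac:(lia) (RtoC 0) unit_disc_0).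
    rewrite (avg_const _ (f (RtoC 0))) in HN; [now rewrite Cmod_minus_sym|lia|].
    intros m; rewrite Hit by apply unit_disc_0; f_equal; ring. }
  (* The points lambda^n z return arbitrarily close to z without equalling it, and g takes the same
     value there; so the derivative of g at z is 0. *)
  assert (Gc : forall z, unit_disc z -> g z = g (RtoC 0)).
  { apply derivative_zero_const; [easy|]; intros z Hz Hz0.
    destruct (Hg z Hz : exists l : C, is_cderive g z l) as [l Hgl].
    replace (RtoC 0) with l; [easy|].
    apply Cmod_small_eq; intros eps Heps; replace (l - 0)%C with l by ring.
    apply is_cderive_eps with (eps := eps / 2) in Hgl; [|lra].
    destruct Hgl as [d [Hd Hgl]].
    assert (Pz := proj1 (Cmod_gt_0 z) Hz0).
    destruct (unimodular_recurrence lambda d Hl Hd) as [n [Hn1 Hn2]].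
    assert (Ez : (lambda ^ n * z - z)%C = ((lambda ^ n - 1) * z)%C) by ring.
    assert (Px : 0 < Cmod (lambda ^ n - 1)).
    { apply Cmod_gt_0; intros E; apply (Hroot n Hn1).
      replace (lambda ^ n)%C with (lambda ^ n - 1 + 1)%C by ring; rewrite E; ring. }
    specialize (Hgl (lambda ^ n * z)%C); rewrite Inv', Ez, Cmod_mult in Hgl by easy.
    replace (g z - g z - (lambda ^ n - 1) * z * l)%C with
      (- ((lambda ^ n - 1) * z * l))%C in Hgl by ring.
    rewrite Cmod_opp, !Cmod_mult in Hgl.
    unfold unit_disc in Hz.
    assert (Cmod (lambda ^ n - 1) * Cmod z < d) by nra.
    specialize (Hgl H); apply Rle_lt_trans with (eps / 2); [|lra].
    apply Rmult_le_reg_l with (Cmod (lambda ^ n - 1) * Cmod z); [|lra].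
    now apply Rmult_lt_0_compat. }
  destruct (Hlim (1 / 4)) as [N HN]; [lra|].
  set (n := S N).
  assert (Hr : exists r, 0 < r < 1 /\ forall k, (k <= n)%nat -> 8 <= e k / (1 - r)).
  (* So close to the circle, each of the first kernels has real part at least 8 at its own node,
     whence |f - 1| <= 1/8 along the orbit of r. *)
  { exists (1 - e n / 8).
    assert (Hen : 0 < e n <= 1).
    { split; [easy|]; unfold e; assert ((/ 2) ^ n <= 1); [|lra].
      rewrite <- (pow1 n); apply pow_incr; lra. }
    split; [lra|]; intros k Hk; replace (1 - (1 - e n / 8)) with (e n / 8) by ring.
    apply Rmult_le_reg_r with (e n / 8); [lra|].
    unfold Rdiv at 2; rewrite Rmult_assoc, Rinv_l by lra.
    enough (e n <= e k) by lra.
    unfold e; apply Rmult_le_compat_l; [lra|].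
    rewrite !pow_inv; apply Rinv_le_contravar; [apply pow_lt; lra|].
    apply Rle_pow; [lra|easy]. }
  destruct Hr as [r [Hr1 Hr2]].
  assert (Dr : forall k, unit_disc (lambda ^ k * RtoC r)%C).
  { intros k; unfold unit_disc; rewrite Cmod_mult, Hp, Cmod_R, Rabs_pos_eq; lra. }
  assert (Hav : Cmod (avg (fun m => f (Nat.iter m phi (RtoC r))) n - 1) <= INR 0 * 2 / INR n + / 8).
  { assert (D0 : unit_disc (RtoC r)) by (unfold unit_disc; rewrite Cmod_R, Rabs_pos_eq; lra).
    apply avg_near; [lia| | |lra].
    - intros k _; apply Rle_trans with (2 * 1); [|lra].
      apply Cmod_bound_diff; [apply Hf1, iter_disc; easy|rewrite Cmod_1; lra].
    - intros k Hk; rewrite Hit by easy; apply (Hf2 _ k); [apply Dr|lra|].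
      apply Rle_trans with (1 := Hr2 k ltac:(lia)).
      apply Re_herglotz_radial; [specialize (He k); lra|rewrite Hp; lra|apply Dr|lra|].
      rewrite Cmult_assoc, Cconj_mult_self, Hp; rewrite !Rmult_1_r; ring. }
  assert (Dr0 : unit_disc (RtoC r)) by (unfold unit_disc; rewrite Cmod_R, Rabs_pos_eq; lra).
  specialize (HN n ltac:(lia) (RtoC r) Dr0).
  rewrite Gc, G0 in HN by easy.
  assert (B : Cmod (f (RtoC 0)) <= 2 * / 4).
  { apply Hf3; intros m; apply Rle_trans with (rsum e m); [|apply rsum_half; lra].
    apply rsum_le; intros k _; rewrite herglotz_0, Cmod_R, Rabs_pos_eq; specialize (He k); lra. }
  set (a := avg _ n) in *.
  (* The clash: |1 - f(0)| is at least 1/2, but less than 1/8 + 1/4. *)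
  assert (T1 := Cmod_triangle_minus 1 (f (RtoC 0))); rewrite Cmod_1 in T1.
  assert (T2 := Cmod_triangle_sub 1 a (f (RtoC 0))); rewrite (Cmod_minus_sym 1 a) in T2.
  simpl in Hav; lra.
Qed.

(** * Attracting fixed points *)

Lemma one_minus_le_neg_ln x : 0 < x -> 1 - x <= - ln x.
Proof. intros Hx; assert (H := exp_ineq1_le (ln x)); rewrite exp_ln in H by easy; lra. Qed.

Lemma iterates_decrease phi z n : self_map phi -> phi (RtoC 0) = RtoC 0 -> unit_disc z ->
  Cmod (Nat.iter (S n) phi z) <= Cmod (Nat.iter n phi z).
Proof. intros Hphi H0 Hz; simpl; apply schwarz; [easy|easy|now apply iter_disc]. Qed.

Lemma iterates_antitone phi z m n : self_map phi -> phi (RtoC 0) = RtoC 0 -> unit_disc z ->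
  (m <= n)%nat -> Cmod (Nat.iter n phi z) <= Cmod (Nat.iter m phi z).
Proof.
intros Hphi H0 Hz; induction 1 as [|n Hn IH]; [lra|].
apply Rle_trans with (2 := IH), iterates_decrease; easy.
Qed.

(** On |z| <= r there is a uniform factor p < 1 with |phi(z)| <= p |z|, hence geometric
    convergence. *)
Lemma attracting_compact phi l r eps : self_map phi -> phi (RtoC 0) = RtoC 0 ->
  is_cderive phi (RtoC 0) l -> Cmod l < 1 -> 0 <= r < 1 -> 0 < eps ->
  exists N, forall n, (N <= n)%nat -> forall z, Cmod z <= r -> Cmod (Nat.iter n phi z) < eps.
Proof.
intros Hphi H0 Hl Hl1 Hr Heps.
destruct (schwarz_strict phi l Hphi H0 Hl Hl1) as [e [q [k [He [Hq [S1 S2]]]]]].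
(* Bernoulli's inequality gives q2^k > r >= |z|, so |phi(z)|^k <= |z|^(k+1) forces |phi(z)| < q2 |z|
   on the annulus without taking k-th roots. *)
set (q2 := 1 - (1 - r) / (INR k + 1)); assert (Pk := pos_INR k).
assert (Hq2 : 0 <= q2 < 1).
{ assert (0 < (1 - r) / (INR k + 1)) by (apply Rdiv_lt_0_compat; lra).
  assert ((1 - r) / (INR k + 1) <= 1); [|unfold q2; lra].
  apply Rmult_le_reg_r with (INR k + 1); [lra|].
  unfold Rdiv; rewrite Rmult_assoc, Rinv_l; lra. }
assert (Bq : r < q2 ^ k).
{ apply Rlt_le_trans with (2 := bernoulli k q2 ltac:(lra)).
  unfold q2; replace (1 - INR k * (1 - (1 - (1 - r) / (INR k + 1)))) with
    (r + (1 - r) / (INR k + 1)) by (field; lra).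
  assert (0 < (1 - r) / (INR k + 1)) by (apply Rdiv_lt_0_compat; lra); lra. }
assert (Q : forall z, Cmod z <= r -> Cmod (phi z) <= Rmax q q2 * Cmod z).
{ intros z Hz; assert (Pz := Cmod_ge_0 z).
  destruct (Rle_dec (Cmod z) e) as [L|L].
  - apply Rle_trans with (1 := S1 z L), Rmult_le_compat_r; [easy|apply Rmax_l].
  - apply Rle_trans with (q2 * Cmod z); [|apply Rmult_le_compat_r; [easy|apply Rmax_r]].
    apply Rnot_lt_le; intros K; specialize (S2 z ltac:(lra)).
    assert ((q2 * Cmod z) ^ k <= Cmod (phi z) ^ k).
    { apply pow_incr; split; [apply Rmult_le_pos; lra|lra]. }
    rewrite Rpow_mult_distr in H; simpl in S2.
    assert (Pzk : 0 < Cmod z ^ k) by (apply pow_lt; lra).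
    assert (q2 ^ k <= Cmod z) by (apply Rmult_le_reg_r with (Cmod z ^ k); lra); lra. }
set (p := Rmax q q2) in *.
assert (Hp : 0 <= p < 1).
{ split; [apply Rle_trans with q; [lra|apply Rmax_l]|apply Rmax_lub_lt; lra]. }
assert (I : forall n z, Cmod z <= r -> Cmod (Nat.iter n phi z) <= p ^ n * Cmod z).
{ induction n as [|n IH]; intros z Hz; simpl; [lra|].
  assert (Pz := Cmod_ge_0 z); specialize (IH z Hz).
  assert (Pn : p ^ n <= 1) by (rewrite <- (pow1 n); apply pow_incr; lra).
  assert (Qn : 0 <= p ^ n) by (apply pow_le; lra).
  apply Rle_trans with (1 := Q (Nat.iter n phi z) ltac:(nra)).
  rewrite Rmult_assoc; apply Rmult_le_compat_l; [lra|easy]. }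
destruct (pow_lt_1_zero p) with (y := eps) as [N HN]; [rewrite Rabs_pos_eq; lra|easy|].
exists N; intros n Hn z Hz; specialize (HN n Hn); rewrite Rabs_pos_eq in HN by (apply pow_le; lra).
apply Rle_lt_trans with (2 := HN), Rle_trans with (1 := I n z Hz).
rewrite <- (Rmult_1_r (p ^ n)) at 2; apply Rmult_le_compat_l; [apply pow_le; lra|lra].
Qed.

Lemma attracting_limit phi l f g : self_map phi -> phi (RtoC 0) = RtoC 0 ->
  is_cderive phi (RtoC 0) l -> Cmod l < 1 -> holomorphic_on_disc f ->
  bounded_on_disc f ->
  (forall eps, 0 < eps -> exists N, forall n, (N <= n)%nat -> forall z, unit_disc z ->
      Cmod (avg (fun m => f (Nat.iter m phi z)) n - g z) < eps) ->
  forall z, unit_disc z -> g z = f (RtoC 0).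
Proof.
intros Hphi H0 Hl Hl1 Hf [M HM] Hlim z Hz; apply Cmod_small_eq; intros eps Heps.
destruct (Hlim (eps / 4)) as [N HN]; [lra|].
destruct (ex_cderive_ccont f _ (Hf _ unit_disc_0) (eps / 4)) as [d [Hd Hc]]; [lra|].
destruct (attracting_compact phi l (Cmod z) d Hphi H0 Hl Hl1) as [N1 HN1];
  [split; [apply Cmod_ge_0|exact Hz]|easy|].
destruct (archimed_div (INR N1 * (2 * M)) (eps / 4)) as [N2 [_ HN2]]; [lra|].
set (n := S (N + N1 + N2)).
specialize (HN n ltac:(lia) z Hz); specialize (HN2 n ltac:(lia)).
assert (A : Cmod (avg (fun m => f (Nat.iter m phi z)) n - f (RtoC 0)) <=
  INR N1 * (2 * M) / INR n + eps / 4).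
{ apply avg_near; [lia| | |lra].
  - intros k _; apply Cmod_bound_diff; apply HM; [now apply iter_disc|apply unit_disc_0].
  - intros k Hk; left; apply Hc.
    replace (Nat.iter k phi z - 0)%C with (Nat.iter k phi z) by ring.
    apply HN1; [lia|apply Rle_refl]. }
set (a := avg _ n) in *; rewrite Cmod_minus_sym in HN.
assert (T := Cmod_triangle_sub (g z) a (f (RtoC 0))); lra.
Qed.

(** For L_j = -ln |phi^j(z)| the annulus inequality reads (k + 1) L_j <= k L_(j+1). This geometric
    growth bounds the sum by k + 1 times its last term. *)
Lemma neg_ln_orbit_sum phi e k z n : self_map phi -> phi (RtoC 0) = RtoC 0 -> 0 < e ->
  (forall z, e <= Cmod z < 1 -> Cmod (phi z) ^ k <= Cmod z ^ (S k)) ->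
  unit_disc z -> e <= Cmod (Nat.iter (S n) phi z) ->
  rsum (fun j => - ln (Cmod (Nat.iter (S j) phi z))) (S n) <=
    (INR k + 1) * - ln (Cmod (Nat.iter (S n) phi z)).
Proof.
intros Hphi H0 He S2 Hz.
assert (L0 : forall j, e <= Cmod (Nat.iter j phi z) -> 0 <= - ln (Cmod (Nat.iter j phi z))).
{ intros j Hj; assert (B := one_minus_le_neg_ln (Cmod (Nat.iter j phi z)) ltac:(lra)).
  assert (D := iter_disc phi j z Hphi Hz); unfold unit_disc in D; lra. }
assert (Pk := pos_INR k).
induction n as [|n IH]; intros Hn.
- specialize (L0 1%nat Hn); change (rsum (fun j => - ln (Cmod (Nat.iter (S j) phi z))) 1)
    with (0 + - ln (Cmod (Nat.iter 1 phi z))); nra.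
- assert (D := iterates_decrease phi z (S n) Hphi H0 Hz); specialize (IH ltac:(lra)).
  change (rsum (fun j => - ln (Cmod (Nat.iter (S j) phi z))) (S (S n))) with
    (rsum (fun j => - ln (Cmod (Nat.iter (S j) phi z))) (S n)
      + - ln (Cmod (Nat.iter (S (S n)) phi z))).
  set (x := Nat.iter (S n) phi z) in *; change (Nat.iter (S (S n)) phi z) with (phi x) in *.
  assert (Dx : unit_disc x) by now apply iter_disc.
  specialize (S2 x ltac:(unfold unit_disc in Dx; lra)).
  apply ln_le in S2; [|apply pow_lt; lra].
  rewrite !ln_pow, S_INR in S2 by lra; lra.
Qed.

Theorem attracting_cesaro phi l : self_map phi -> phi (RtoC 0) = RtoC 0 ->
  is_cderive phi (RtoC 0) l -> Cmod l < 1 -> cesaro_convergent phi ->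
  iterates_converge_uniformly_on unit_disc phi (RtoC 0).
Proof.
intros Hphi H0 Hl Hl1 HC.
(* If some iterate maps the disc into a smaller one, [attracting_compact] finishes. Otherwise every
   iterate comes arbitrarily close to the circle. *)
destruct (classic (exists n r, 0 <= r < 1 /\ forall z, unit_disc z -> Cmod (Nat.iter n phi z) <= r))
  as [[n [r [Hr Hn]]]|Hno].
{ intros eps Heps; destruct (attracting_compact phi l r eps) as [N HN]; try easy.
  exists (N + n)%nat; intros m Hm z Hz; replace (Nat.iter m phi z - 0)%C with (Nat.iter m phi z) by ring.
  replace m with ((m - n) + n)%nat by lia; rewrite Nat.iter_add; apply HN; [lia|now apply Hn]. }
exfalso.
assert (Far : forall n r, 0 <= r < 1 -> exists z, unit_disc z /\ r < Cmod (Nat.iter n phi z)).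
{ intros n r Hr; apply NNPP; intros K; apply Hno; exists n, r; split; [easy|].
  intros z Hz; apply Rnot_lt_le; intros L; apply K; now exists z. }
destruct (schwarz_strict phi l Hphi H0 Hl Hl1) as [e [q [k [He [Hq [_ S2]]]]]].
assert (Pk := pos_INR k).
(* [c i] is the mass allotted to the i-th orbit segment; the total 1/20 bounds |f(0)|. *)
set (c := fun i => / 40 * (/ 2) ^ i).
assert (Hc : forall i, 0 < c i) by (intros; apply Rmult_lt_0_compat; [lra|apply pow_lt; lra]).
(* The (i+1)-th iterate of z_i is required so near the circle that the whole segment up to it fits
   in the mass [c i]. *)
destruct (countable_choice C (fun i z => unit_disc z /\ e <= Cmod (Nat.iter (S i) phi z) /\
  18 * ((INR k + 1) * - ln (Cmod (Nat.iter (S i) phi z))) <= c i)) as [z Hz].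
{ intros i; set (d := c i / (18 * (INR k + 1))).
  assert (Hd : 0 < d) by (apply Rdiv_lt_0_compat; [easy|lra]).
  destruct (Far (S i) (Rmax e (exp (- d)))) as [z [Hz Hz2]].
  { split; [apply Rle_trans with e; [lra|apply Rmax_l]|apply Rmax_lub_lt; [lra|]].
    rewrite <- exp_0; apply exp_increasing; lra. }
  exists z; split; [easy|]; assert (M1 := Rmax_l e (exp (- d))); assert (M2 := Rmax_r e (exp (- d))).
  split; [lra|].
  assert (L : - d <= ln (Cmod (Nat.iter (S i) phi z))).
  { rewrite <- (ln_exp (- d)); apply ln_le; [apply exp_pos|lra]. }
  replace (c i) with (18 * ((INR k + 1) * d)) by (unfold d; field; lra).
  apply Rmult_le_compat_l; [lra|]; apply Rmult_le_compat_l; lra. }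
set (w := fun i j => Nat.iter (S j) phi (z i)).
(* The factor 9 gives each kernel real part at least 9 at its own node, so |f - 1| <= 1/9 there. The
   18 above comes from 9 (1 - x^2) <= 18 (1 - x) <= -18 ln x. *)
set (m := fun i j => 9 * (1 - Cmod (w i j) * Cmod (w i j))).
assert (Hw : forall i j, unit_disc (w i j)) by (intros; apply iter_disc; [easy|apply Hz]).
assert (Hm : forall i j, 0 < m i j).
{ intros i j; assert (P := unit_disc_sqr _ (Hw i j)); unfold m; lra. }
assert (Hdec : forall i j, (j <= i)%nat -> Cmod (w i i) <= Cmod (w i j)).
{ intros i j Hj; apply iterates_antitone; [easy|easy|apply Hz|lia]. }
assert (Hsum : forall i, rsum (m i) (S i) <= c i).
{ intros i; destruct (Hz i) as [Hzi [Hei Hci]].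
  apply Rle_trans with (2 := Hci).
  assert (O := neg_ln_orbit_sum phi e k (z i) i Hphi H0 (proj1 He) S2 Hzi Hei).
  apply (Rmult_le_compat_l 18) in O; [|lra]; apply Rle_trans with (2 := O).
  rewrite <- rsum_scal; apply rsum_le; intros j Hj.
  fold (w i j); assert (D := Hdec i j ltac:(lia)); fold (w i i) in Hei.
  assert (B := one_minus_le_neg_ln (Cmod (w i j)) ltac:(lra)).
  specialize (Hw i j); unfold unit_disc in Hw; unfold m; nra. }
set (h := fun i x => csum (fun j => herglotz (m i j) (w i j) x) (S i)).
assert (Hhp : forall i x, unit_disc x -> forall j, 0 <= Re (herglotz (m i j) (w i j) x)).
{ intros; apply Re_herglotz_nonneg; [left; apply Hm|left; apply Hw|easy]. }
destruct (positive_series_test h (fun i => 3 * c i) (3 * (2 * / 40))) as [f [Hf [Hf1 [Hf2 Hf3]]]].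
- intros i; apply tame_weaken with (rsum (fun j => 3 * m i j) (S i)).
  + rewrite rsum_scal; apply Rmult_le_compat_l; [lra|apply Hsum].
  + apply (tame_csum (fun j => 3 * m i j) (fun j => herglotz (m i j) (w i j))).
    intros j; apply tame_herglotz; left; [apply Hm|apply Hw].
- intros n; rewrite rsum_scal; apply Rmult_le_compat_l; [lra|apply rsum_half; lra].
- intros i x Hx; unfold h, Re; rewrite fst_csum; apply rsum_nonneg; intros; now apply Hhp.
- destruct (HC f Hf) as [g [Hg Hlim]]; [now exists 1|].
  assert (G := attracting_limit phi l f g Hphi H0 Hl Hl1 Hf (ex_intro _ 1 Hf1) Hlim).
  assert (B : Cmod (f (RtoC 0)) <= 2 * / 40).
  { apply Hf3; intros n; apply Rle_trans with (rsum c n); [|apply rsum_half; lra].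
    apply rsum_le; intros i _; apply Rle_trans with (2 := Hsum i).
    apply Rle_trans with (1 := Cmod_csum _ _), rsum_le; intros j _.
    assert (Pm := Hm i j); rewrite herglotz_0, Cmod_R, Rabs_pos_eq; [apply Rle_refl|now left]. }
  assert (Hpeak : forall i j, (j <= i)%nat -> Cmod (f (w i j) - 1) <= / 9).
  { intros i j Hj; apply (Hf2 _ i); [apply Hw|lra|].
    apply Rle_trans with (Re (herglotz (m i j) (w i j) (w i j))).
    - assert (P := unit_disc_sqr _ (Hw i j)).
      eapply Rle_trans; [|apply (Re_herglotz_radial _ _ _ (Cmod (w i j) * Cmod (w i j)))].
      + unfold m; right; field; lra.
      + left; apply Hm.
      + left; apply Hw.
      + apply Hw.
      + lra.
      + apply Cconj_mult_self.
    - unfold h, Re; rewrite fst_csum.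
      apply (rsum_term_le (fun j' => fst (herglotz (m i j') (w i j') (w i j)))); [|lia].
      intros j' _; now apply Hhp. }
  destruct (Hlim (1 / 2)) as [N HN]; [lra|].
  destruct (Hz N) as [HzN _]; specialize (HN (S N) ltac:(lia) (z N) HzN); rewrite G in HN by easy.
  assert (A : Cmod (avg (fun m => f (Nat.iter m phi (z N))) (S N) - 1) <= INR 0 * 2 / INR (S N) + / 9).
  { apply avg_near; [lia| | |lra].
    - intros j _; apply Rle_trans with (2 * 1); [|lra].
      apply Cmod_bound_diff; [apply Hf1, iter_disc; easy|rewrite Cmod_1; lra].
    - intros j Hj; destruct j as [|j]; [lia|]; apply (Hpeak N j); lia. }
  set (a := avg _ (S N)) in *.
  (* Here 1 - 1/20 would have to be less than 1/9 + 1/2. *)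
  assert (T1 := Cmod_triangle_minus 1 (f (RtoC 0))); rewrite Cmod_1 in T1.
  assert (T2 := Cmod_triangle_sub 1 a (f (RtoC 0))); rewrite (Cmod_minus_sym 1 a) in T2.
  simpl (INR 0) in A; lra.
Qed.

(** * Maps without fixed points *)

Lemma ccont_comp f g z : ccont f (g z) -> ccont g z -> ccont (fun w => f (g w)) z.
Proof.
intros Hf Hg eps He; destruct (Hf eps He) as [d [Hd H]]; destruct (Hg d Hd) as [d' [Hd' H']].
exists d'; auto.
Qed.

Lemma Cconj_minus z w : (Cconj z - Cconj w)%C = Cconj (z - w).
Proof. destruct z, w; unfold Cconj, Cminus, Cplus, Copp; simpl; f_equal; ring. Qed.

Lemma ccont_conj z : ccont Cconj z.
Proof.
intros eps He; exists eps; split; [easy|]; intros w Hw.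
now rewrite Cconj_minus, Cmod_conj.
Qed.

(** |mob a b| is the pseudo-hyperbolic distance, and z -> r z contracts it strictly. With u =
    conj(a) b this reduces to |1 - r^2 u|^2 - r^2 |1 - u|^2 = (1 - r^2) (1 - r^2 |u|^2) > 0. *)
Lemma mob_shrink r a b : 0 < r < 1 -> unit_disc a -> unit_disc b -> a <> b ->
  Cmod (mob (RtoC r * a) (RtoC r * b)) < Cmod (mob a b).
Proof.
intros Hr Ha Hb Hab.
assert (Hra : unit_disc (RtoC r * a)).
{ unfold unit_disc in *; rewrite Cmod_mult, Cmod_R, Rabs_pos_eq by lra.
  assert (P := Cmod_ge_0 a); nra. }
assert (Hrb : Cmod (RtoC r * b) <= 1).
{ unfold unit_disc in *; rewrite Cmod_mult, Cmod_R, Rabs_pos_eq by lra.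
  assert (P := Cmod_ge_0 b); nra. }
assert (N1 := mob_denom_neq _ _ Hra Hrb).
assert (N2 := mob_denom_neq a b Ha (Rlt_le _ _ Hb)).
unfold mob; rewrite !Cmod_div by easy.
assert (P1 := proj1 (Cmod_gt_0 _) N1); assert (P2 := proj1 (Cmod_gt_0 _) N2).
set (d1 := Cmod (1 - Cconj (RtoC r * a) * (RtoC r * b))) in *.
set (d2 := Cmod (1 - Cconj a * b)) in *.
replace (RtoC r * a - RtoC r * b)%C with (RtoC r * (a - b))%C by ring.
rewrite Cmod_mult, Cmod_R, Rabs_pos_eq by lra.
assert (Pab : 0 < Cmod (a - b)).
{ apply Cmod_gt_0; intros E; apply Hab; replace a with (a - b + b)%C by ring; rewrite E; ring. }
assert (K : r * d2 < d1).
{ assert (E : d1 * d1 - r * r * (d2 * d2) =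
    (1 - r * r) * (1 - r * r * (Cmod (Cconj a * b) * Cmod (Cconj a * b)))).
  { unfold d1, d2; rewrite !Cmod_sqr; simpl; ring. }
  assert (Hu : Cmod (Cconj a * b) < 1).
  { rewrite Cmod_mult, Cmod_conj; unfold unit_disc in *.
    assert (Q1 := Cmod_ge_0 a); assert (Q2 := Cmod_ge_0 b); nra. }
  assert (Q := Cmod_ge_0 (Cconj a * b)); set (x := Cmod (Cconj a * b)) in *.
  assert (x * x < 1) by nra; assert (r * r < 1) by nra; assert (0 <= r * r) by nra.
  assert (r * r * (x * x) < 1) by nra.
  assert (0 < (1 - r * r) * (1 - r * r * (x * x))) by (apply Rmult_lt_0_compat; lra).
  apply Rnot_le_lt; intros L.
  assert (d1 * d1 <= r * d2 * (r * d2)) by (apply Rmult_le_compat; lra); nra. }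
apply Rmult_lt_reg_r with (d1 * d2); [now apply Rmult_lt_0_compat|].
replace (r * Cmod (a - b) / d1 * (d1 * d2)) with (Cmod (a - b) * (r * d2)) by (field; lra).
replace (Cmod (a - b) / d2 * (d1 * d2)) with (Cmod (a - b) * d1) by (field; lra).
now apply Rmult_lt_compat_l.
Qed.

Lemma self_map_shrink r phi : 0 < r < 1 -> self_map phi ->
  self_map (fun z => RtoC r * phi z)%C /\
  forall z, unit_disc z -> Cmod (RtoC r * phi z) <= r.
Proof.
intros Hr [H1 H2].
assert (B : forall z, unit_disc z -> Cmod (RtoC r * phi z) <= r).
{ intros z Hz; rewrite Cmod_mult, Cmod_R, Rabs_pos_eq by lra.
  assert (Q := H1 z Hz); unfold unit_disc in Q; assert (P := Cmod_ge_0 (phi z)); nra. }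
split; [split|easy].
- intros z Hz; specialize (B z Hz); unfold unit_disc; lra.
- intros z Hz; apply ex_cderive_mult; [apply ex_cderive_const|auto].
Qed.

(* A point of least pseudo-hyperbolic displacement is fixed, since
   multiplication by [r] is strictly contracting. *)
Lemma shrink_fixed_point r phi : 0 < r < 1 -> self_map phi ->
  exists z, unit_disc z /\ (RtoC r * phi z)%C = z.
Proof.
intros Hr Hphi; destruct (self_map_shrink r phi Hr Hphi) as [Hpsi B].
set (psi := fun z => (RtoC r * phi z)%C) in *.
change (forall z, unit_disc z -> Cmod (psi z) <= r) in B.
(* The displacement is negated to turn a minimum into a maximum. The disc of radius r contains every
   psi(z), so psi(a) competes with a. *)
destruct (compact_max (fun z => 0 <= Cmod z <= r) (fun z => - Cmod (mob z (psi z))))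
  as [a [[_ Ka] Ha]].
- apply disc_bounded_closed.
- exists (RtoC 0); rewrite Cmod_0; lra.
- intros z [_ Hz]; assert (Dz : unit_disc z) by (unfold unit_disc; lra).
  enough (Hc : ccont (fun z => mob z (psi z)) z).
  { intros eps He; destruct (rcont_Cmod _ _ Hc eps He) as [d [Hd H]].
    exists d; split; [easy|]; intros w Hw; specialize (H w Hw).
    apply Rabs_lt_between in H; apply Rabs_lt_between; lra. }
  assert (Cp : ccont psi z) by (apply ex_cderive_ccont, Hpsi, Dz).
  assert (Cneg : forall g, ccont g z -> ccont (fun w => (-1) * g w)%C z).
  { intros g Hg; apply ccont_mult; [apply ex_cderive_ccont, ex_cderive_const|easy]. }
  assert (Cd : ccont (fun w => 1 + (-1) * (Cconj w * psi w))%C z).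
  { apply ccont_plus; [apply ex_cderive_ccont, ex_cderive_const|].
    apply Cneg, ccont_mult; [apply ccont_conj|easy]. }
  assert (E : forall w, mob w (psi w) = ((w + (-1) * psi w) * / (1 + (-1) * (Cconj w * psi w)))%C).
  { intros w; unfold mob, Cdiv; f_equal; [ring|f_equal; ring]. }
  intros eps He; destruct (ccont_mult (fun w => w + (-1) * psi w)%C
    (fun w => / (1 + (-1) * (Cconj w * psi w)))%C z) with (eps := eps) as [d [Hd H]]; [| |easy|].
  + apply ccont_plus; [apply ex_cderive_ccont, ex_cderive_id|now apply Cneg].
  + apply (ccont_comp Cinv (fun w => 1 + (-1) * (Cconj w * psi w))%C); [|easy].
    apply ex_cderive_ccont, ex_cderive_Cinv.
    replace (1 + (-1) * (Cconj z * psi z))%C with (1 - Cconj z * psi z)%C by ring.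
    apply mob_denom_neq; [easy|specialize (B z Dz); lra].
  + exists d; split; [easy|]; intros w Hw; rewrite !E; now apply H.
- assert (Da : unit_disc a) by (unfold unit_disc; lra).
  exists a; split; [easy|]; apply NNPP; intros Hne; change ((psi a) <> a) in Hne.
  assert (Bb := B a Da); assert (Db : unit_disc (psi a)) by (apply Hpsi; easy).
  specialize (Ha (psi a) (conj (Cmod_ge_0 _) Bb)); cbv beta in Ha.
  assert (S := schwarz_pick_mob phi (psi a) a Hphi Db Da).
  assert (L : Cmod (mob (psi a) (psi (psi a))) < Cmod (mob a (psi a))); [|lra].
  (* [mob_shrink] needs distinct points. If the images coincide, psi(a) is itself fixed and has
     displacement 0. *)
  destruct (classic (phi a = phi (psi a))) as [E|E].
  + unfold psi at 1 2; rewrite <- E, mob_self, Cmod_0.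
    apply Cmod_gt_0; intros F.
    apply Hne; rewrite <- (mob_invol a (psi a)), F by easy; apply mob_0.
  + apply Rlt_le_trans with (2 := S), mob_shrink; [easy| | |easy]; now apply Hphi.
Qed.

Lemma cconv_is_lim_seq u l : cconv u l -> is_lim_seq (fun n => Cmod (u n)) (Cmod l).
Proof.
intros H; apply is_lim_seq_Reals; intros eps He; destruct (H eps He) as [N HN].
exists N; intros n Hn; unfold Rdist; eapply Rle_lt_trans; [apply Cmod_Rabs_minus|auto].
Qed.

(* [wolff zeta phi] says that [phi] maps each horodisc at [zeta] into itself. *)
Definition wolff (zeta : C) (phi : C -> C) : Prop :=
  Cmod zeta = 1 /\ forall z, unit_disc z ->
    (1 - Cmod z * Cmod z) * (Cmod (1 - Cconj zeta * phi z) * Cmod (1 - Cconj zeta * phi z)) <=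
    (1 - Cmod (phi z) * Cmod (phi z)) * (Cmod (1 - Cconj zeta * z) * Cmod (1 - Cconj zeta * z)).

(** Take for zeta a cluster point of the fixed points w_n of r_n phi, with r_n tending to 1. Inside
    the disc it would be fixed by phi, so it is on the circle, and Schwarz-Pick for the pair (z,
    w_n) passes to the limit. *)
Theorem wolff_point phi : self_map phi -> (forall z, unit_disc z -> phi z <> z) ->
  exists zeta, wolff zeta phi.
Proof.
intros Hphi Hfix.
set (r := fun n : nat => 1 - / (INR n + 2)).
assert (Hr : forall n, 0 < r n < 1).
{ intros n; assert (P := pos_INR n); assert (0 < / (INR n + 2)) by (apply Rinv_0_lt_compat; lra).
  assert (/ (INR n + 2) <= / 2) by (apply Rinv_le_contravar; lra); unfold r; lra. }
destruct (countable_choice C (fun n z => unit_disc z /\ (RtoC (r n) * phi z)%C = z)) as [z0 Hz0].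
{ intros n; now apply shrink_fixed_point. }
destruct (bounded_complex_subseq z0 1) as [s [zeta [Hs Hzeta]]].
{ intros n; left; apply Hz0. }
set (w := fun n => z0 (s n)) in *; set (q := fun n => r (s n)).
assert (Hw : forall n, unit_disc (w n) /\ (RtoC (q n) * phi (w n))%C = w n) by (intros; apply Hz0).
assert (Hq : cconv (fun n => RtoC (q n)) (RtoC 1)).
{ intros eps He; destruct (inv_INR_S_small eps He) as [N HN]; exists N; intros n Hn.
  rewrite <- RtoC_minus, Cmod_R; unfold q, r; rewrite Rabs_left1.
  - apply Rle_lt_trans with (/ (INR (s n) + 1)).
    + assert (P := pos_INR (s n)).
      assert (/ (INR (s n) + 2) <= / (INR (s n) + 1)) by (apply Rinv_le_contravar; lra); lra.
    + apply HN; assert (G := increasing_index_ge s Hs n); lia.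
  - assert (P := pos_INR (s n)); assert (0 < / (INR (s n) + 2)) by (apply Rinv_0_lt_compat; lra); lra. }
assert (H1 : Cmod zeta <= 1).
{ apply cconv_Cmod_le with (2 := Hzeta); intros n; left; apply Hw. }
exists zeta; destruct (Rle_lt_or_eq_dec _ _ H1) as [L|E].
- exfalso; apply (Hfix zeta L).
  apply (cconv_unique w); [|exact Hzeta].
  apply (cconv_ext (fun n => phi (w n) + (RtoC (q n) - 1) * phi (w n))%C).
  { intros n; destruct (Hw n) as [_ En]; rewrite <- En at 3; ring. }
  replace (phi zeta) with (phi zeta + 0)%C by ring; apply cconv_plus.
  + apply (cconv_ccont phi w); [apply ex_cderive_ccont, Hphi, L|exact Hzeta].
  + intros eps He; destruct (Hq eps He) as [N HN]; exists N; intros n Hn.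
    specialize (HN n Hn).
    replace ((RtoC (q n) - 1) * phi (w n) - 0)%C with ((RtoC (q n) - 1) * phi (w n))%C by ring.
    rewrite Cmod_mult; assert (D := proj1 Hphi (w n) (proj1 (Hw n))); unfold unit_disc in D.
    assert (P := Cmod_ge_0 (phi (w n))); assert (P2 := Cmod_ge_0 (RtoC (q n) - 1)); nra.
- split; [easy|]; intros z Hz.
  assert (I : forall n, (1 - Cmod z * Cmod z) *
     (Cmod (1 - Cconj (w n) * (RtoC (q n) * phi z)) * Cmod (1 - Cconj (w n) * (RtoC (q n) * phi z))) <=
     (1 - Cmod (RtoC (q n) * phi z) * Cmod (RtoC (q n) * phi z)) *
     (Cmod (1 - Cconj (w n) * z) * Cmod (1 - Cconj (w n) * z))).
  { intros n; destruct (Hw n) as [Dn En].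
    destruct (self_map_shrink (q n) phi (Hr _) Hphi) as [Hpsi _].
    assert (S := schwarz_pick _ z (w n) Hpsi Hz Dn); simpl in S; rewrite En in S.
    assert (P := unit_disc_sqr _ Dn).
    (* As w_n is fixed by the shrunk map, this factor occurs on both sides; it must be removed now,
       since it tends to 0. *)
    apply Rmult_le_reg_r with (1 - Cmod (w n) * Cmod (w n)); [lra|].
    eapply Rle_trans; [|eapply Rle_trans; [exact S|]]; right; ring. }
  assert (Cw : forall x, cconv (fun n => 1 - Cconj (w n) * x)%C (1 - Cconj zeta * x)%C).
  { intros x; apply (cconv_ccont (fun y => 1 - Cconj y * x)%C w); [|exact Hzeta].
    intros eps He; destruct (ccont_plus (fun _ => RtoC 1) (fun y => (-1) * (Cconj y * x))%C zeta)
      with (eps := eps) as [d [Hd H]]; [| |easy|].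
    - apply ex_cderive_ccont, ex_cderive_const.
    - apply ccont_mult; [apply ex_cderive_ccont, ex_cderive_const|].
      apply ccont_mult; [apply ccont_conj|apply ex_cderive_ccont, ex_cderive_const].
    - exists d; split; [easy|]; intros y Hy; specialize (H y Hy).
      replace (1 - Cconj y * x - (1 - Cconj zeta * x))%C with
        (1 + (-1) * (Cconj y * x) - (1 + (-1) * (Cconj zeta * x)))%C by ring; exact H. }
  assert (Cq : forall x, cconv (fun n => RtoC (q n) * x)%C x).
  { intros x; assert (X := cconv_scal x _ _ Hq); rewrite Cmult_1_r in X.
    apply cconv_ext with (2 := X); intros; ring. }
  assert (Cwq : cconv (fun n => 1 - Cconj (w n) * (RtoC (q n) * phi z))%C (1 - Cconj zeta * phi z)%C).
  { apply (cconv_ext (fun n => (1 - Cconj (w n) * phi z) + (1 - RtoC (q n)) * (Cconj (w n) * phi z))%C).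
    { intros; ring. }
    replace (1 - Cconj zeta * phi z)%C with ((1 - Cconj zeta * phi z) + 0)%C by ring.
    apply cconv_plus; [apply Cw|].
    intros eps He; destruct (Hq eps He) as [N HN]; exists N; intros n Hn.
    specialize (HN n Hn); rewrite Cmod_minus_sym in HN.
    match goal with |- Cmod ?X < _ => replace X with
      ((1 - RtoC (q n)) * (Cconj (w n) * phi z))%C by ring end.
    rewrite !Cmod_mult, Cmod_conj; assert (D := proj1 Hphi z Hz); unfold unit_disc in D.
    assert (D2 := proj1 (Hw n)); unfold unit_disc in D2.
    assert (P := Cmod_ge_0 (phi z)); assert (P2 := Cmod_ge_0 (1 - RtoC (q n))).
    assert (P3 := Cmod_ge_0 (w n)); assert (Cmod (w n) * Cmod (phi z) <= 1) by nra; nra. }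
  apply cconv_is_lim_seq in Cwq; assert (L1 := cconv_is_lim_seq _ _ (Cw z)).
  assert (L2 := cconv_is_lim_seq _ _ (Cq (phi z))).
  apply (is_lim_seq_le _ _ (Finite _) (Finite _) I).
  + apply is_lim_seq_mult'; [apply is_lim_seq_const|now apply is_lim_seq_mult'].
  + apply is_lim_seq_mult'; [|now apply is_lim_seq_mult'].
    apply is_lim_seq_minus'; [apply is_lim_seq_const|now apply is_lim_seq_mult'].
Qed.

(** For |zeta| = 1 this is (zeta + z) / (zeta - z), sending the disc to the right half-plane and
    zeta to infinity; this form has the denominator that occurs in [wolff]. *)
Definition cayley (zeta z : C) : C := ((1 + Cconj zeta * z) / (1 - Cconj zeta * z))%C.

Lemma cayley_denom zeta z : Cmod zeta = 1 -> unit_disc z ->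
  (1 - Cconj zeta * z)%C <> RtoC 0.
Proof.
intros H Hz; apply Cmod_pos_neq; assert (G := pole_denom_ge (Cconj zeta) z).
rewrite Cmod_conj in G; unfold unit_disc in Hz; specialize (G ltac:(lra)); lra.
Qed.

Lemma cayley_Re zeta z : Cmod zeta = 1 -> unit_disc z ->
  Re (cayley zeta z) * (Cmod (1 - Cconj zeta * z) * Cmod (1 - Cconj zeta * z)) =
  1 - Cmod z * Cmod z.
Proof.
intros H Hz; assert (N := cayley_denom zeta z H Hz).
assert (P := proj1 (Cmod_gt_0 _) N); unfold cayley.
assert (E : Cmod z * Cmod z = Cmod (Cconj zeta * z) * Cmod (Cconj zeta * z)).
{ rewrite Cmod_mult, Cmod_conj, H; ring. }
rewrite E; set (u := (Cconj zeta * z)%C) in *.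
assert (P2 : 0 < Cmod (1 - u) * Cmod (1 - u)) by now apply Rmult_lt_0_compat.
rewrite !Cmod_sqr; rewrite Cmod_sqr in P2.
destruct u as [x y]; unfold Cdiv, Cinv, Cmult, Cplus, Re; simpl in *; field; lra.
Qed.

Lemma cayley_Re_pos zeta z : Cmod zeta = 1 -> unit_disc z -> 0 < Re (cayley zeta z).
Proof.
intros H Hz; assert (E := cayley_Re zeta z H Hz); assert (P := unit_disc_sqr z Hz).
assert (N := proj1 (Cmod_gt_0 _) (cayley_denom zeta z H Hz)).
apply Rnot_le_lt; intros L; assert (0 < Cmod (1 - Cconj zeta * z) * Cmod (1 - Cconj zeta * z))
  by now apply Rmult_lt_0_compat.
nra.
Qed.

Lemma cayley_holo zeta : Cmod zeta = 1 -> holomorphic_on_disc (cayley zeta).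
Proof.
intros H z Hz; apply ex_cderive_div; [| |now apply cayley_denom].
- apply ex_cderive_plus; [apply ex_cderive_const|].
  apply ex_cderive_mult; [apply ex_cderive_const|apply ex_cderive_id].
- apply ex_cderive_minus; [apply ex_cderive_const|].
  apply ex_cderive_mult; [apply ex_cderive_const|apply ex_cderive_id].
Qed.

Lemma wolff_cayley zeta phi z : self_map phi -> wolff zeta phi -> unit_disc z ->
  Re (cayley zeta z) <= Re (cayley zeta (phi z)).
Proof.
intros Hphi [H HW] Hz; specialize (HW z Hz); assert (Hpz := proj1 Hphi z Hz).
assert (E1 := cayley_Re zeta z H Hz); assert (E2 := cayley_Re zeta (phi z) H Hpz).
assert (N1 := proj1 (Cmod_gt_0 _) (cayley_denom zeta z H Hz)).
assert (N2 := proj1 (Cmod_gt_0 _) (cayley_denom zeta (phi z) H Hpz)).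
rewrite <- E1, <- E2 in HW.
set (A := Cmod (1 - Cconj zeta * z) * Cmod (1 - Cconj zeta * z)) in *.
set (B := Cmod (1 - Cconj zeta * phi z) * Cmod (1 - Cconj zeta * phi z)) in *.
assert (0 < A) by (now apply Rmult_lt_0_compat).
assert (0 < B) by (now apply Rmult_lt_0_compat).
apply Rmult_le_reg_r with (A * B); [now apply Rmult_lt_0_compat|]; lra.
Qed.

(** The maximum principle applied to (1 - G) / (1 + G), whose modulus is at most 1, and equal to 1
    where Re G = 0. *)
Lemma Re_nonneg_const G p : holomorphic_on_disc G -> unit_disc p ->
  (forall z, unit_disc z -> 0 <= Re (G z)) -> Re (G p) = 0 ->
  forall z, unit_disc z -> G z = G p.
Proof.
intros HG Hp Hpos H0 z Hz.
assert (N : forall w, unit_disc w -> (1 + G w)%C <> RtoC 0).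
{ intros w Hw E; assert (P := Hpos w Hw); apply (f_equal Re) in E; unfold Re in *; simpl in E; lra. }
assert (Dsq : forall w, Cmod (1 + G w) * Cmod (1 + G w) - Cmod (1 - G w) * Cmod (1 - G w) = 4 * Re (G w)).
{ intros w; rewrite !Cmod_sqr; unfold Re; simpl; ring. }
assert (M : forall w, unit_disc w -> 0 < Cmod (1 + G w)) by (intros; apply Cmod_gt_0; auto).
assert (E : ((1 - G z) / (1 + G z))%C = ((1 - G p) / (1 + G p))%C).
{ apply (max_principle (fun w => (1 - G w) / (1 + G w))%C p); [|easy| | |easy].
  - intros w Hw; apply ex_cderive_div; [| |auto].
    + apply ex_cderive_minus; [apply ex_cderive_const|now apply HG].
    + apply ex_cderive_plus; [apply ex_cderive_const|now apply HG].
  - intros w Hw; rewrite Cmod_div by auto; specialize (M w Hw); specialize (Dsq w).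
    specialize (Hpos w Hw); assert (Q := Cmod_ge_0 (1 - G w)).
    apply Rmult_le_reg_r with (1 := M); unfold Rdiv; rewrite Rmult_assoc, Rinv_l by lra; nra.
  - rewrite Cmod_div by auto; specialize (M p Hp); specialize (Dsq p); rewrite H0 in Dsq.
    assert (Q := Cmod_ge_0 (1 - G p)).
    assert (E : Cmod (1 - G p) = Cmod (1 + G p)) by nra; rewrite E; field; lra. }
assert (Nz := N z Hz); assert (Np := N p Hp).
assert (X : ((1 - G z) * (1 + G p))%C = ((1 - G p) * (1 + G z))%C).
{ replace ((1 - G z) * (1 + G p))%C with
    ((1 - G z) / (1 + G z) * ((1 + G z) * (1 + G p)))%C by (field; easy).
  rewrite E; field; easy. }
assert (N2 : RtoC 2 <> RtoC 0) by (intros F; apply RtoC_inj in F; lra).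
replace (G z) with (G p + ((1 - G p) * (1 + G z) - (1 - G z) * (1 + G p)) / 2)%C
  by (field; easy).
rewrite X; field; easy.
Qed.

(* If the orbit of [0] does not escape, then it clusters at a point [p] of the
   disc where [Re W] is preserved by [phi]; hence [W o phi = W + c] and the
   orbit of [0] is [1 + n c], which only recurs when [c = 0]. *)
Theorem orbit_escapes zeta phi : self_map phi -> wolff zeta phi ->
  phi (RtoC 0) <> RtoC 0 ->
  forall B, exists N, forall n, (N <= n)%nat -> B <= Cmod (cayley zeta (Nat.iter n phi (RtoC 0))).
Proof.
intros Hphi HW Hfix B; apply NNPP; intros Hno.
assert (Hz1 := proj1 HW); assert (D0 := unit_disc_0).
set (W := cayley zeta) in *; set (P := fun n => Nat.iter n phi (RtoC 0)).
assert (HP : forall n, unit_disc (P n)) by (intros; now apply iter_disc).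
destruct (countable_choice nat (fun N n => (N <= n)%nat /\ Cmod (W (P n)) < B)) as [f Hf].
{ intros N; apply NNPP; intros K; apply Hno; exists N; intros n Hn.
  apply Rnot_lt_le; intros L; apply K; now exists n. }
assert (W0 : W (RtoC 0) = RtoC 1).
{ unfold W, cayley; replace (Cconj zeta * 0)%C with (RtoC 0) by ring; field. }
assert (Mono : forall m n, (m <= n)%nat -> Re (W (P m)) <= Re (W (P n))).
{ intros m n; induction 1 as [|n Hn IH]; [lra|]; apply Rle_trans with (1 := IH).
  apply (wolff_cayley zeta phi (P n)); easy. }
destruct (bounded_complex_subseq (fun n => P (f n)) 1) as [s [p [Hs Hp]]].
{ intros n; left; apply HP. }
assert (HB : 0 < B) by (apply Rle_lt_trans with (2 := proj2 (Hf O)), Cmod_ge_0).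
assert (Dp : unit_disc p).
(* From (W + 1) (1 - conj(zeta) x) = 2 and |W| < B one gets |1 - conj(zeta) x| >= d, and Re W >= 1
   then gives 1 - |x|^2 >= d^2: the cluster point stays off the circle. *)
{ set (d := 2 / (B + 1)).
  assert (Hd : 0 < d) by (apply Rdiv_lt_0_compat; lra).
  assert (Bd : forall n, Cmod (P (f n)) * Cmod (P (f n)) <= 1 - d * d).
  { intros n; set (x := P (f n)); assert (Dx : unit_disc x) by apply HP.
    assert (Ex := cayley_Re zeta x Hz1 Dx); assert (Nx := cayley_denom zeta x Hz1 Dx).
    assert (R1 : 1 <= Re (W x)).
    { change 1 with (Re (RtoC 1)); rewrite <- W0; apply (Mono O); lia. }
    assert (Px := proj1 (Cmod_gt_0 _) Nx).
    assert (Q : d <= Cmod (1 - Cconj zeta * x)).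
    { apply Rmult_le_reg_r with (B + 1); [lra|]; unfold d, Rdiv.
      rewrite Rmult_assoc, Rinv_l, Rmult_1_r by lra.
      assert (Ew : ((W x + 1) * (1 - Cconj zeta * x))%C = RtoC 2)
        by (unfold W, cayley; field; easy).
      apply (f_equal Cmod) in Ew; rewrite Cmod_mult, Cmod_R, Rabs_pos_eq in Ew by lra.
      assert (T := Cmod_triangle (W x) 1); rewrite Cmod_1 in T.
      destruct (Hf n) as [_ Hfn]; fold x in Hfn.
      rewrite <- Ew, Rmult_comm; apply Rmult_le_compat_l; lra. }
    fold W in Ex; set (y := Cmod (1 - Cconj zeta * x)) in *.
    assert (d * d <= y * y) by (apply Rmult_le_compat; lra).
    assert (1 * (y * y) <= Re (W x) * (y * y)) by (apply Rmult_le_compat_r; nra); lra. }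
  assert (Bs : Cmod p * Cmod p <= 1 - d * d).
  { rewrite <- Cmod_mult; apply cconv_Cmod_le with (u := fun n => (P (f (s n)) * P (f (s n)))%C).
    - intros n; rewrite Cmod_mult; apply Bd.
    - apply (cconv_ccont (fun z => z * z)%C (fun n => P (f (s n)))); [|exact Hp].
      apply ex_cderive_ccont, ex_cderive_mult; apply ex_cderive_id. }
  unfold unit_disc; assert (Q := Cmod_ge_0 p); nra. }
assert (Hh := cayley_holo zeta Hz1); fold W in Hh.
assert (Up : forall n, Re (W (P n)) <= Re (W p)).
{ intros n; apply (cconv_Re_ge (fun k => W (P (f (s k)))) _ _ n).
  - intros k Hk; apply Mono; assert (G := increasing_index_ge s Hs k); destruct (Hf (s k)); lia.
  - apply (cconv_ccont W (fun k => P (f (s k)))); [apply ex_cderive_ccont, Hh, Dp|exact Hp]. }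
assert (HWp : holomorphic_on_disc (fun z => W (phi z))).
{ intros z Hz; apply ex_cderive_comp; [apply Hh, Hphi, Hz|apply Hphi, Hz]. }
(* W(phi(p)) is a limit of W along the subsequence shifted by one, still bounded by Re W(p).
   Together with Wolff's inequality this gives equality of real parts at p. *)
assert (Up2 : Re (W (phi p)) <= Re (W p)).
{ apply Ropp_le_cancel.
  change (- Re (W p) <= Re (- W (phi p))%C).
  apply (cconv_Re_ge (fun k => - W (phi (P (f (s k)))))%C _ _ O).
  - intros k _; change (Re (- W (phi (P (f (s k)))))%C) with (- Re (W (P (S (f (s k)))))).
    apply Ropp_le_contravar, Up.
  - apply (cconv_ext (fun k => (-1) * W (phi (P (f (s k)))))%C); [intros; ring|].
    replace (- W (phi p))%C with ((-1) * W (phi p))%C by ring; apply cconv_scal.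
    apply (cconv_ccont (fun z => W (phi z)) (fun k => P (f (s k))));
      [apply ex_cderive_ccont, HWp, Dp|exact Hp]. }
assert (C : forall z, unit_disc z -> (W (phi z) - W z)%C = (W (phi p) - W p)%C).
{ apply (Re_nonneg_const (fun z => W (phi z) - W z)%C p); [|easy| |].
  - intros z Hz; apply ex_cderive_minus; [now apply HWp|now apply Hh].
  - intros z Hz; assert (Q := wolff_cayley zeta phi z Hphi HW Hz); fold W in Q.
    change (0 <= Re (W (phi z)) - Re (W z)); lra.
  - assert (Q := wolff_cayley zeta phi p Hphi HW Dp); fold W in Q.
    change (Re (W (phi p)) - Re (W p) = 0); lra. }
set (c := (W (phi p) - W p)%C) in *.
assert (Orb : forall n, W (P n) = (1 + RtoC (INR n) * c)%C).
{ induction n as [|n IH].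
  - change (P O) with (RtoC 0); rewrite W0; simpl; ring.
  - change (P (S n)) with (phi (P n)); rewrite S_INR, RtoC_plus.
    replace (W (phi (P n))) with (W (phi (P n)) - W (P n) + W (P n))%C by ring.
    rewrite C, IH by easy; ring. }
(* If c = 0 then W(phi(0)) = W(0), and solving for phi(0) gives 0. Otherwise |1 + n c| is unbounded,
   against |W| < B at the times [f n]. *)
destruct (classic (c = RtoC 0)) as [E|E].
- apply Hfix; assert (E1 := Orb 1%nat); rewrite E in E1.
  change (P 1%nat) with (phi (RtoC 0)) in E1.
  assert (N := cayley_denom zeta (phi (RtoC 0)) Hz1 (HP 1%nat)).
  assert (E2 : (1 + Cconj zeta * phi 0)%C = (1 - Cconj zeta * phi 0)%C).
  { replace (1 + Cconj zeta * phi 0)%C with (W (phi 0) * (1 - Cconj zeta * phi 0))%C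
      by (unfold W, cayley; field; easy).
    rewrite E1; ring. }
  apply (f_equal (fun x => (x - 1) * zeta * / 2)%C) in E2.
  assert (E3 : (Cconj zeta * zeta)%C = RtoC 1) by (rewrite Cconj_mult_self, Hz1; f_equal; ring).
  assert (N2 : RtoC 2 <> RtoC 0) by (intros F; apply RtoC_inj in F; lra).
  replace ((1 + Cconj zeta * phi 0 - 1) * zeta * / 2)%C with
    (Cconj zeta * zeta * phi 0 * / 2)%C in E2 by ring.
  replace ((1 - Cconj zeta * phi 0 - 1) * zeta * / 2)%C with
    (- (Cconj zeta * zeta * phi 0 * / 2))%C in E2 by ring.
  rewrite E3 in E2.
  replace (phi 0) with ((1 * phi 0 * / 2) - - (1 * phi 0 * / 2))%C by (field; easy).
  rewrite E2 at 1; ring.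
- apply Cmod_gt_0 in E; destruct (INR_unbounded ((B + 1) / Cmod c)) as [n Hn].
  destruct (Hf n) as [F1 F2]; rewrite Orb in F2.
  assert (L : INR n <= INR (f n)) by now apply le_INR.
  assert (T := Cmod_triangle_minus (RtoC (INR (f n)) * c) (- (1))).
  rewrite Cmod_mult, Cmod_R, Cmod_m1, Rabs_pos_eq in T by apply pos_INR.
  replace (RtoC (INR (f n)) * c - - (1))%C with (1 + RtoC (INR (f n)) * c)%C in T by ring.
  apply (Rmult_lt_compat_r (Cmod c)) in Hn; [|easy].
  replace ((B + 1) / Cmod c * Cmod c) with (B + 1) in Hn by (field; lra).
  assert (INR n * Cmod c <= INR (f n) * Cmod c) by (apply Rmult_le_compat_r; lra); lra.
Qed.

(** * Slowly oscillating functions *)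

(** A switch at scale A, bounded on the right half-plane. Being fractional linear, it has one simple
    pole after composition with [cayley], which makes it tame. *)
Definition ramp (A : R) (w : C) : C := (w / (w + RtoC A))%C.

Lemma ramp_denom_sqr A w : 0 < A -> 0 <= Re w ->
  Cmod w * Cmod w + A * A <= Cmod (w + RtoC A) * Cmod (w + RtoC A).
Proof. intros HA Hw; unfold Re in Hw; rewrite !Cmod_sqr; simpl; nra. Qed.

Lemma ramp_denom_ge A w : 0 < A -> 0 <= Re w ->
  Cmod w <= Cmod (w + RtoC A) /\ A <= Cmod (w + RtoC A) /\
  (w + RtoC A)%C <> RtoC 0.
Proof.
intros HA Hw; assert (S := ramp_denom_sqr A w HA Hw).
assert (P := Cmod_ge_0 w); assert (Q := Cmod_ge_0 (w + RtoC A)).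
assert (L : A <= Cmod (w + RtoC A)) by nra.
split; [nra|split; [easy|apply Cmod_pos_neq; lra]].
Qed.

Lemma ramp_le A w : 0 < A -> 0 <= Re w -> Cmod (ramp A w) <= Cmod w / A.
Proof.
intros HA Hw; destruct (ramp_denom_ge A w HA Hw) as [_ [H1 H2]].
unfold ramp; rewrite Cmod_div by easy; apply Rmult_le_compat_l; [apply Cmod_ge_0|].
now apply Rinv_le_contravar.
Qed.

Lemma ramp_minus_1_le A w : 0 < A -> 0 <= Re w -> 0 < Cmod w ->
  Cmod (ramp A w - 1) <= A / Cmod w.
Proof.
intros HA Hw H0; destruct (ramp_denom_ge A w HA Hw) as [H1 [_ H2]].
replace (ramp A w - 1)%C with (RtoC (- A) / (w + RtoC A))%C
  by (unfold ramp; rewrite RtoC_opp; field; easy).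
rewrite Cmod_div, Cmod_R, Rabs_Ropp, Rabs_pos_eq by (easy || lra).
apply Rmult_le_compat_l; [lra|now apply Rinv_le_contravar].
Qed.

Definition real_ramp (A x : R) : R := x / (x + A).

(* [|w + A| >= (|w| + A) / sqrt 2] on the right half-plane *)
Lemma ramp_diff_le a b w : 0 < a -> a <= b -> 0 <= Re w -> 0 < Cmod w ->
  Cmod (ramp a w - ramp b w) <= 2 * (real_ramp a (Cmod w) - real_ramp b (Cmod w)).
Proof.
intros Ha Hab Hw H0; set (x := Cmod w) in *.
destruct (ramp_denom_ge a w Ha Hw) as [_ [Ga Na]].
destruct (ramp_denom_ge b w ltac:(lra) Hw) as [_ [Gb Nb]].
assert (Sa := ramp_denom_sqr a w Ha Hw); assert (Sb := ramp_denom_sqr b w ltac:(lra) Hw); fold x in Sa, Sb.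
replace (ramp a w - ramp b w)%C with (w * RtoC (b - a) * (/ (w + RtoC a) * / (w + RtoC b)))%C
  by (unfold ramp; rewrite RtoC_minus; field; easy).
rewrite !Cmod_mult, !Cmod_inv, Cmod_R, Rabs_pos_eq by (easy || lra); fold x.
replace (2 * (real_ramp a x - real_ramp b x)) with (x * (b - a) * (2 * (/ (x + a) * / (x + b))))
  by (unfold real_ramp; field; lra).
apply Rmult_le_compat_l; [apply Rmult_le_pos; lra|].
set (p := Cmod (w + RtoC a)) in *; set (q := Cmod (w + RtoC b)) in *.
rewrite <- !Rinv_mult; replace (2 * / ((x + a) * (x + b))) with (/ ((x + a) * (x + b) / 2)) by (field; lra).
apply Rinv_le_contravar; [apply Rdiv_lt_0_compat; [apply Rmult_lt_0_compat; lra|lra]|].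
assert (Hx : (x + a) * (x + b) <= 2 * (p * q)); [|lra].
apply Rsqr_incr_0_var; [|assert (0 < p * q) by (apply Rmult_lt_0_compat; lra); lra].
unfold Rsqr.
assert (E1 : (x + a) * (x + a) <= 2 * (p * p)) by (assert (0 <= (x - a) * (x - a)) by apply Rle_0_sqr; lra).
assert (E2 : (x + b) * (x + b) <= 2 * (q * q)) by (assert (0 <= (x - b) * (x - b)) by apply Rle_0_sqr; lra).
replace ((x + a) * (x + b) * ((x + a) * (x + b))) with ((x + a) * (x + a) * ((x + b) * (x + b))) by ring.
replace (2 * (p * q) * (2 * (p * q))) with (2 * (p * p) * (2 * (q * q))) by ring.
apply Rmult_le_compat; try apply Rle_0_sqr; easy.
Qed.

(** With u = conj(zeta) z, the composition is (1 + u) / ((A + 1) - (A - 1) u); [c0] and [c1] come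
    from its partial fractions. The decay in A of the bound 5 / A makes a series over geometrically
    growing A summable. *)
Lemma tame_ramp_cayley A zeta : 2 <= A -> Cmod zeta = 1 ->
  exists f, tame (5 / A) f /\ forall z, unit_disc z -> f z = ramp A (cayley zeta z).
Proof.
intros HA H1; set (beta := (A - 1) / (A + 1)).
assert (Hb : 0 <= beta <= 1).
{ unfold beta; split; [apply Rdiv_le_0_compat; lra|].
  apply Rmult_le_reg_r with (A + 1); [lra|]; unfold Rdiv; rewrite Rmult_assoc, Rinv_l; lra. }
assert (Ha : Cmod (RtoC beta * Cconj zeta) <= 1).
{ rewrite Cmod_mult, Cmod_conj, H1, Cmod_R, Rabs_pos_eq; lra. }
set (c0 := - / (A - 1)); set (c1 := 2 * A / ((A - 1) * (A + 1))).
exists (fun z => RtoC c0 + RtoC c1 / (1 - RtoC beta * Cconj zeta * z))%C; split.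
- apply tame_weaken with (Cmod (RtoC c0) + Cmod (RtoC c1)).
  + assert (P0 : 0 < / (A - 1)) by (apply Rinv_0_lt_compat; lra).
    assert (P1 : 0 < c1) by (apply Rdiv_lt_0_compat; [lra|apply Rmult_lt_0_compat; lra]).
    rewrite !Cmod_R; unfold c0; rewrite Rabs_Ropp, !Rabs_pos_eq by lra; unfold c1.
    apply Rmult_le_reg_r with ((A - 1) * (A + 1) * A); [repeat apply Rmult_lt_0_compat; lra|].
    replace ((/ (A - 1) + 2 * A / ((A - 1) * (A + 1))) * ((A - 1) * (A + 1) * A)) with
      ((A + 1) * A + 2 * A * A) by (field; lra).
    replace (5 / A * ((A - 1) * (A + 1) * A)) with (5 * ((A - 1) * (A + 1))) by (field; lra).
    nra.
  + apply tame_plus; [apply tame_const|now apply tame_pole].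
- intros z Hz; assert (N := cayley_denom zeta z H1 Hz).
  assert (G := pole_denom_ge (RtoC beta * Cconj zeta) z Ha); unfold unit_disc in Hz.
  destruct (ramp_denom_ge A (cayley zeta z) ltac:(lra)
    (Rlt_le _ _ (cayley_Re_pos zeta z H1 Hz))) as [_ [_ N3]].
  assert (N4 : (1 - RtoC beta * Cconj zeta * z)%C <> RtoC 0) by (apply Cmod_pos_neq; lra).
  assert (NA : (RtoC A + RtoC 1)%C <> RtoC 0).
  { rewrite <- RtoC_plus; intros E; apply RtoC_inj in E; lra. }
  assert (NB : (RtoC A - RtoC 1)%C <> RtoC 0).
  { rewrite <- RtoC_minus; intros E; apply RtoC_inj in E; lra. }
  assert (Eb : RtoC beta = ((RtoC A - 1) / (RtoC A + 1))%C).
  { unfold beta; rewrite RtoC_div, RtoC_minus, RtoC_plus by lra; easy. }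
  assert (E0 : RtoC c0 = (- / (RtoC A - 1))%C).
  { unfold c0; rewrite RtoC_opp, RtoC_inv, RtoC_minus by lra; easy. }
  assert (E1 : RtoC c1 = (2 * RtoC A / ((RtoC A - 1) * (RtoC A + 1)))%C).
  { unfold c1; rewrite RtoC_div, !RtoC_mult, RtoC_minus, RtoC_plus
      by (apply Rgt_not_eq, Rmult_lt_0_compat; lra); easy. }
  rewrite Eb in N4; rewrite E0, E1, Eb; unfold ramp, cayley in *.
  set (u := (Cconj zeta * z)%C) in *.
  replace ((RtoC A - 1) / (RtoC A + 1) * Cconj zeta * z)%C with
    ((RtoC A - 1) / (RtoC A + 1) * u)%C in * by (unfold u; ring).
  assert (M : ((1 + u) + RtoC A * (1 - u))%C <> RtoC 0).
  { intros F; apply N3.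
    replace ((1 + u) / (1 - u) + RtoC A)%C with (((1 + u) + RtoC A * (1 - u)) / (1 - u))%C
      by (field; easy); rewrite F; unfold Cdiv; ring. }
  replace ((RtoC A - 1) / (RtoC A + 1) * u)%C with ((RtoC A - 1) * u / (RtoC A + 1))%C in * by (field; easy).
  field; repeat split; try easy.

Qed.

Lemma rsum_telescope (th : nat -> R) n : (forall j, th (S j) <= th j) ->
  rsum (fun i => th (2 * i)%nat - th (2 * i + 1)%nat) n <= th O - th (2 * n)%nat.
Proof.
intros H; induction n as [|n IH]; [simpl; lra|].
assert (A := H (2 * n + 1)%nat).
replace (S (2 * n + 1)) with (2 * S n)%nat in A by lia.
change (rsum (fun i => th (2 * i)%nat - th (2 * i + 1)%nat) (S n)) with
  (rsum (fun i => th (2 * i)%nat - th (2 * i + 1)%nat) n + (th (2 * n)%nat - th (2 * n + 1)%nat)).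
lra.
Qed.

Lemma csum_split u p n : csum u (p + n) = (csum u p + csum (fun i => u (p + i)%nat) n)%C.
Proof.
induction n as [|n IH]; simpl; [rewrite Nat.add_0_r; ring|].
rewrite Nat.add_succ_r; simpl; rewrite IH; ring.
Qed.


(* [th j = x / (x + A j)] is close to [1] when [A j << x] and close to [0] when
   [x << A j]; the humps [ramp (A 2i) - ramp (A (2i+1))] add up to a bounded
   function since their moduli are controlled by a telescoping series. *)
Theorem oscillating_function (A : nat -> R) zeta : Cmod zeta = 1 ->
  (forall j, 2 * 2 ^ j <= A j) -> (forall j, A j <= A (S j)) ->
  exists F, holomorphic_on_disc F /\ (forall z, unit_disc z -> Cmod (F z) <= 2) /\
    forall z j, unit_disc z -> 100 * A j <= Cmod (cayley zeta z) <= A (S j) / 100 ->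
      Cmod (F z - (if Nat.even j then 1 else 0))%C <= 6 / 100.
Proof.
intros H1 HA Hinc.
assert (HA2 : forall j, 2 <= A j).
{ intros j; apply Rle_trans with (2 := HA j); assert (1 <= 2 ^ j) by (apply pow_R1_Rle; lra); lra. }
destruct (countable_choice _ (fun j f => tame (5 / A j) f /\
  forall z, unit_disc z -> f z = ramp (A j) (cayley zeta z))) as [E HE].
{ intros j; now apply tame_ramp_cayley. }
set (G := fun i z => (E (2 * i)%nat z + (-1) * E (2 * i + 1)%nat z)%C).
assert (HG : forall i z, unit_disc z ->
  G i z = (ramp (A (2 * i)%nat) (cayley zeta z) - ramp (A (2 * i + 1)%nat) (cayley zeta z))%C).
{ intros i z Hz; unfold G; rewrite !(fun j => proj2 (HE j)) by easy; ring. }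
destruct (tame_series (fun i => 5 * (/ 2) ^ i) G (2 * 5)) as [F [HF HFc]].
- intros i.
  assert (Tm : forall j, tame (5 / A j) (fun z => (-1) * E j z)%C).
  { intros j; destruct (HE j) as [[df Hdf] _]; exists (fun z => (-1) * df z)%C; intros z Hz.
    destruct (Hdf z Hz) as [D1 [D2 D3]].
    assert (M1 : forall c, Cmod ((-1) * c) = Cmod c).
    { intros c; rewrite Cmod_mult, Cmod_R, Rabs_m1; ring. }
    rewrite !M1; split; [easy|split; [easy|]]; intros w Hw.
    replace ((-1) * E j w - (-1) * E j z - (w - z) * ((-1) * df z))%C with
      ((-1) * (E j w - E j z - (w - z) * df z))%C by ring; rewrite M1; now apply D3. }
  (* Both scales are at least 2 * 2^i, so each ramp costs at most (5/2) 2^-i. *)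
  apply tame_weaken with (5 / A (2 * i)%nat + 5 / A (2 * i + 1)%nat).
  + assert (B : forall j, (i <= j)%nat -> 5 / A j <= 5 / 2 * (/ 2) ^ i).
    { intros j Hj; replace (5 / 2 * (/ 2) ^ i) with (5 * / (2 * 2 ^ i))
        by (rewrite pow_inv; field; apply pow_nonzero; lra).
      apply Rmult_le_compat_l; [lra|]; apply Rinv_le_contravar.
      - assert (0 < 2 ^ i) by (apply pow_lt; lra); lra.
      - apply Rle_trans with (2 := HA j), Rmult_le_compat_l; [lra|].
        apply Rle_pow; [lra|easy]. }
    assert (B1 := B (2 * i)%nat ltac:(lia)); assert (B2 := B (2 * i + 1)%nat ltac:(lia)); lra.
  + apply tame_plus; [apply HE|apply Tm].
- intros n; apply rsum_half; lra.
- exists F; split; [now apply tame_holomorphic with (2 * 5)|].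
  assert (Main : forall z, unit_disc z -> let x := Cmod (cayley zeta z) in
    0 < x /\ (forall i, Cmod (G i z) <=
      2 * (real_ramp (A (2 * i)%nat) x - real_ramp (A (2 * i + 1)%nat) x)) /\
    (forall j, real_ramp (A (S j)) x <= real_ramp (A j) x) /\
    (forall j, 0 <= real_ramp (A j) x <= 1)).
  { intros z Hz x; assert (R0 := cayley_Re_pos zeta z H1 Hz).
    assert (Hx : 0 < x).
    { apply Rlt_le_trans with (1 := R0), Rle_trans with (2 := Re_le_Cmod _), Rle_abs. }
    split; [easy|split; [|split]].
    - intros i; rewrite HG by easy; apply ramp_diff_le; [|now rewrite Nat.add_1_r|lra|easy].
      specialize (HA2 (2 * i)%nat); lra.
    - intros j; unfold real_ramp; apply Rmult_le_compat_l; [lra|].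
      apply Rinv_le_contravar; specialize (HA2 j); specialize (Hinc j); lra.
    - intros j; specialize (HA2 j); unfold real_ramp; split; [apply Rdiv_le_0_compat; lra|].
      apply Rmult_le_reg_r with (x + A j); [lra|].
      unfold Rdiv; rewrite Rmult_assoc, Rinv_l; lra. }
  (* Stated for a block starting at any p, so that the humps before and after the active one can be
     bounded separately. *)
  assert (Sums : forall z p n, unit_disc z -> let x := Cmod (cayley zeta z) in
    Cmod (csum (fun i => G (p + i)%nat z) n) <=
      2 * (real_ramp (A (2 * p)%nat) x - real_ramp (A (2 * (p + n))%nat) x)).
  { intros z p n Hz x; destruct (Main z Hz) as [Hx [M1 [M2 M3]]]; fold x in Hx, M1, M2, M3.
    apply Rle_trans with (1 := Cmod_csum _ _).
    set (th := fun j => real_ramp (A (2 * p + j)%nat) x).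
    apply Rle_trans with (rsum (fun i => 2 * (th (2 * i)%nat - th (2 * i + 1)%nat)) n).
    - apply rsum_le; intros i _; apply Rle_trans with (1 := M1 (p + i)%nat).
      unfold th; replace (2 * p + 2 * i)%nat with (2 * (p + i))%nat by lia.
      replace (2 * p + (2 * i + 1))%nat with (2 * (p + i) + 1)%nat by lia; lra.
    - rewrite rsum_scal; apply Rmult_le_compat_l; [lra|].
      assert (T := rsum_telescope th n); unfold th in T at 5 6.
      rewrite Nat.add_0_r in T; replace (2 * p + 2 * n)%nat with (2 * (p + n))%nat in T by lia.
      apply T; intros j; unfold th; rewrite Nat.add_succ_r; apply M2. }
  split.
  + intros z Hz; apply cconv_Cmod_le with (2 := HFc z Hz); intros n.
    assert (S := Sums z O n Hz); destruct (Main z Hz) as [_ [_ [_ M3]]].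
    simpl in S; apply Rle_trans with (1 := S).
    assert (Q1 := M3 O); assert (Q2 := M3 (n + (n + 0))%nat); simpl in Q1, Q2; lra.
  + intros z j Hz Hj; destruct (Main z Hz) as [Hx [M1 [M2 M3]]].
    set (x := Cmod (cayley zeta z)) in *.
    assert (Small1 : 1 - real_ramp (A j) x <= / 100).
    { specialize (HA2 j); unfold real_ramp; apply Rmult_le_reg_r with (x + A j); [lra|].
      replace ((1 - x / (x + A j)) * (x + A j)) with (A j) by (field; lra); lra. }
    assert (Small2 : real_ramp (A (S j)) x <= / 100).
    { specialize (HA2 (S j)); unfold real_ramp; apply Rmult_le_reg_r with (x + A (S j)); [lra|].
      unfold Rdiv; rewrite Rmult_assoc, Rinv_l; lra. }
    assert (Lim : forall t k B, (forall n, Cmod (csum (fun i => G i z) (k + n) - t) <= B) ->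
      Cmod (F z - t) <= B).
    { intros t k B HB; apply cconv_Cmod_le with (1 := HB).
      apply (cconv_plus (fun n => csum (fun i => G i z) (k + n)) (fun _ => (- t)%C));
        [|apply cconv_const].
      intros eps He; destruct (HFc z Hz eps He) as [N HN]; exists N; intros n Hn; apply HN; lia. }
    destruct (Nat.Even_or_Odd j) as [[k Hk]|[k Hk]].
    (* For j = 2 k the k-th hump is active: it is within 2/100 of 1, and the earlier and the later
       humps contribute at most 2/100 each. *)
    * replace (Nat.even j) with true by (symmetry; apply Nat.even_spec; now exists k).
      apply (Lim _ (S k)); intros n; rewrite csum_split; simpl (csum _ (S k)).
      assert (S0 := Sums z O k Hz); assert (S1 := Sums z (S k) n Hz); cbv zeta in S0, S1; fold x in S0, S1.
      simpl (fun i => G (0 + i)%nat z) in S0.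
      replace (2 * (0 + k))%nat with j in S0 by lia.
      set (a := csum _ k) in *; set (b := csum _ n) in *.
      assert (Q0 := M3 (2 * 0)%nat); assert (Q1 := M3 (2 * (S k + n))%nat).
      assert (Q2 : real_ramp (A (2 * S k)%nat) x <= / 100).
      { apply Rle_trans with (2 := Small2); replace (2 * S k)%nat with (S (S j)) by lia; apply M2. }
      assert (R0 := cayley_Re_pos zeta z H1 Hz).
      assert (T1 := ramp_minus_1_le (A j) (cayley zeta z) ltac:(specialize (HA2 j); lra) ltac:(lra) Hx).
      assert (T2 := ramp_le (A (S j)) (cayley zeta z) ltac:(specialize (HA2 (S j)); lra) ltac:(lra)).
      fold x in T1, T2.
      assert (T1' : A j / x <= / 100).
      { apply Rmult_le_reg_r with x; [easy|]; unfold Rdiv; rewrite Rmult_assoc, Rinv_l; lra. }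
      assert (T2' : x / A (S j) <= / 100).
      { specialize (HA2 (S j)); apply Rmult_le_reg_r with (A (S j)); [lra|].
        unfold Rdiv; rewrite Rmult_assoc, Rinv_l; lra. }
      rewrite HG by easy; replace (2 * k + 1)%nat with (S j) by lia.
      replace (2 * k)%nat with j by lia.
      match goal with |- Cmod ?X <= _ => replace X with (a + ((ramp (A j) (cayley zeta z) - 1)
        + (- ramp (A (S j)) (cayley zeta z) + b)))%C by ring end.
      eapply Rle_trans; [apply Cmod_triangle|]; assert (U1 := Cmod_triangle (ramp (A j) (cayley zeta z) - 1)
        (- ramp (A (S j)) (cayley zeta z) + b)).
      assert (U2 := Cmod_triangle (- ramp (A (S j)) (cayley zeta z)) b); rewrite Cmod_opp in U2.
      lra.
    (* For j = 2 k + 1 the k-th hump is already over; joined to the earlier ones it stays within 2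
       (1 - th j), so everything is small. *)
    * replace (Nat.even j) with false
        by (symmetry; rewrite <- Nat.negb_odd; apply Bool.negb_false_iff, Nat.odd_spec; now exists k).
      apply (Lim _ (S k)); intros n; rewrite csum_split; simpl (csum _ (S k)).
      assert (S0 := Sums z O k Hz); assert (S1 := Sums z (S k) n Hz); cbv zeta in S0, S1; fold x in S0, S1.
      assert (S2 := M1 k); replace (2 * k + 1)%nat with j in S2 by lia.
      simpl (fun i => G (0 + i)%nat z) in S0.
      replace (2 * (0 + k))%nat with (2 * k)%nat in S0 by lia.
      replace (2 * S k)%nat with (S j) in S1 by lia.
      set (a := csum _ k) in *; set (b := csum _ n) in *.
      assert (Q0 := M3 (2 * 0)%nat); assert (Q1 := M3 (2 * (S k + n))%nat).
      match goal with |- Cmod ?X <= _ => replace X with (a + (G k z + b))%C by ring end.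
      eapply Rle_trans; [apply Cmod_triangle|]; assert (U1 := Cmod_triangle (G k z) b); lra.
Qed.

Lemma finite_bound (u : nat -> R) n : exists B, forall k, (k <= n)%nat -> u k <= B.
Proof.
induction n as [|n [B HB]].
- exists (u O); intros k Hk; replace k with O by lia; lra.
- exists (Rmax B (u (S n))); intros k Hk; destruct (Nat.eq_dec k (S n)) as [->|N]; [apply Rmax_r|].
  apply Rle_trans with B; [apply HB; lia|apply Rmax_l].
Qed.

(** The scales A_j are chosen along the orbit of 0 so that it spends nearly all of the time up to
    some t_j between 100 A_j and A_(j+1) / 100. The means at the times t_j then alternate between
    nearly 1 and nearly 0. *)
Theorem no_fixed_point_not_cesaro phi : self_map phi ->
  (forall z, unit_disc z -> phi z <> z) -> ~ cesaro_convergent phi.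
Proof.
intros Hphi Hfix HC; destruct (wolff_point phi Hphi Hfix) as [zeta HW].
assert (Hesc := orbit_escapes zeta phi Hphi HW (Hfix _ unit_disc_0)).
assert (H1 := proj1 HW); set (P := fun n => Nat.iter n phi (RtoC 0)).
assert (HP : forall n, unit_disc (P n)) by (intros; apply iter_disc; [easy|apply unit_disc_0]).
set (X := fun n => Cmod (cayley zeta (P n))).
destruct (dependent_choice R (fun j a => 2 * 2 ^ j <= a) (fun j a b => a <= b /\
  exists N t, (100 * N <= t)%nat /\ (j <= t)%nat /\ (1 <= t)%nat /\
    (forall n, (N <= n)%nat -> 100 * a <= X n) /\ (forall n, (n <= t)%nat -> X n <= b / 100)) 2)
  as [A [_ HA]]; [simpl; lra| |].
{ intros j a Ha; destruct (Hesc (100 * a)) as [N HN].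
  (* At most one hundredth of the terms precede N, so they change the mean by at most 3/100; the
     summand j makes the times unbounded. *)
  set (t := (100 * N + j + 1)%nat); destruct (finite_bound X t) as [B HB].
  exists (Rmax (2 * a) (100 * B)); assert (M1 := Rmax_l (2 * a) (100 * B)).
  assert (M2 := Rmax_r (2 * a) (100 * B)); assert (0 < 2 ^ j) by (apply pow_lt; lra).
  split; [simpl; lra|split; [lra|]]; exists N, t; repeat split; try (unfold t; lia).
  - exact HN.
  - intros n Hn; specialize (HB n Hn); lra. }
destruct (oscillating_function A zeta H1) as [F [HF [HF2 HFosc]]]; [intros; apply HA|intros; apply HA|].
destruct (HC F HF) as [g [_ Hlim]]; [now exists 2|].
set (tau := fun j => if Nat.even j then RtoC 1 else RtoC 0).
assert (Hav : forall j, exists t, (j <= t)%nat /\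
  Cmod (avg (fun m => F (P m)) t - tau j) <= 1 / 10).
{ intros j; destruct (HA j) as [_ [_ [N [t [Ht1 [Ht2 [Ht3 [HN Ht]]]]]]]].
  exists t; split; [easy|].
  assert (Htr : 1 <= INR t) by (now apply (le_INR 1)).
  apply Rle_trans with (INR N * 3 / INR t + 6 / 100).
  - apply avg_near; [easy| | |lra].
    + intros k _; assert (T := Cmod_triangle (F (P k)) (- tau j)); rewrite Cmod_opp in T.
      specialize (HF2 (P k) (HP k)).
      assert (Cmod (tau j) <= 1).
      { unfold tau; destruct (Nat.even j); rewrite Cmod_R, Rabs_pos_eq; lra. }
      unfold Cminus; lra.
    + intros k Hk; apply HFosc; [apply HP|split; [apply HN; lia|apply Ht; lia]].
  - assert (L : 100 * INR N <= INR t).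
    { apply le_INR in Ht1; rewrite mult_INR in Ht1; replace (INR 100) with 100 in Ht1 by (simpl; lra); lra. }
    assert (INR N * 3 / INR t <= 3 / 100); [|lra].
    apply Rmult_le_reg_r with (INR t); [lra|]; unfold Rdiv at 1; rewrite Rmult_assoc, Rinv_l; lra. }
destruct (Hlim (1 / 10)) as [N HN]; [lra|].
destruct (Hav (2 * N)%nat) as [t [Ht Et]]; destruct (Hav (2 * N + 1)%nat) as [t' [Ht' Et']].
assert (K := HN t ltac:(lia) (RtoC 0) unit_disc_0); assert (K' := HN t' ltac:(lia) (RtoC 0) unit_disc_0).
fold P in K, K'; change (fun m => F (Nat.iter m phi (RtoC 0))) with (fun m => F (P m)) in K, K'.
unfold tau in Et, Et'; rewrite Nat.even_even in Et; rewrite Nat.even_odd in Et'.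
set (a := avg _ t) in *; set (b := avg _ t') in *.
assert (T1 := Cmod_triangle_sub 1 a 0); assert (T2 := Cmod_triangle_sub a (g (RtoC 0)) 0).
assert (T3 := Cmod_triangle_sub (g (RtoC 0)) b 0).
rewrite (Cmod_minus_sym 1 a) in T1; rewrite (Cmod_minus_sym (g (RtoC 0)) b) in T3.
replace (1 - 0)%C with (RtoC 1) in T1 by ring; rewrite Cmod_1 in T1; lra.
Qed.

(** * Mean ergodicity *)

Lemma opp_HinfE (f : Hinf) z : unit_disc z -> (opp f : Hinf) z = (- f z)%C.
Proof.
intros Hz; etransitivity; [exact (scal_HinfE (RtoC (-1)) f Hz)|].
replace (RtoC (-1)) with (- RtoC 1)%C by (now rewrite <- RtoC_opp); ring.
Qed.

Lemma minus_HinfE (f g : Hinf) z : unit_disc z -> (minus f g : Hinf) z = (f z - g z)%C.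
Proof. intros Hz; unfold minus; rewrite plus_HinfE, opp_HinfE; easy. Qed.

Lemma iter_composition_operatorE phi (Hphi : self_map phi) n (f : Hinf) z : unit_disc z ->
  (Nat.iter n (composition_operator Hphi) f) z = f (Nat.iter n phi z).
Proof.
revert z; induction n as [|n IH]; intros z Hz; [easy|].
rewrite Nat.iter_succ, composition_operatorE, IH, Nat.iter_succ_r; [easy|now apply Hphi|easy].
Qed.

Lemma cesaro_meanE phi (Hphi : self_map phi) n (f : Hinf) z : unit_disc z ->
  (cesaro_mean (composition_operator Hphi) n f : Hinf) z =
  avg (fun m => f (Nat.iter m phi z)) n.
Proof.
intros Hz; unfold cesaro_mean, avg; rewrite scal_HinfE by easy; f_equal.
induction n as [|n IH].
- rewrite sum_n_m_zero by lia; now rewrite zero_HinfE.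
- rewrite sum_n_Sm by lia; rewrite plus_HinfE, IH by easy.
  now rewrite iter_composition_operatorE.
Qed.

Lemma mean_ergodic_cesaro phi (Hphi : self_map phi) :
  mean_ergodic (composition_operator Hphi) -> cesaro_convergent phi.
Proof.
intros [_ [T [_ HT]]] f Hf Bf; set (F := Hinf_make Hf Bf); exists (T F).
split; [apply Hinf_holomorphic|]; intros eps He.
destruct (HT F (fun x => Hinf_ball (T F) eps x)) as [N HN].
{ now exists (mkposreal eps He). }
exists N; intros n Hn z Hz; specialize (HN n Hn); unfold Hinf_ball in HN.
apply Rle_lt_trans with (2 := HN).
replace (avg (fun m => f (Nat.iter m phi z)) n - T F z)%C with
  (minus (cesaro_mean (composition_operator Hphi) n F) (T F) z).
- now apply Hinf_norm_ge.
- rewrite minus_HinfE, cesaro_meanE by easy; f_equal; unfold avg; f_equal.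
  apply csum_ext; intros k _; apply Hinf_makeE, iter_disc; easy.
Qed.

(** * Moving an interior fixed point to the origin *)

Definition mob_conj (p : C) (phi : C -> C) (z : C) : C := mob p (phi (mob p z)).

Lemma mob_conj_self_map p phi : unit_disc p -> self_map phi -> self_map (mob_conj p phi).
Proof.
intros Hp Hphi; apply (self_map_comp (mob p) (fun z => phi (mob p z))); [now apply mob_self_map|].
apply (self_map_comp phi (mob p)); [easy|now apply mob_self_map].
Qed.

Lemma mob_conj_invol p phi z : unit_disc p -> self_map phi -> unit_disc z ->
  phi z = mob p (mob_conj p phi (mob p z)).
Proof.
intros Hp Hphi Hz; unfold mob_conj.
rewrite (mob_invol p z), mob_invol by (try apply Hphi; easy); easy.
Qed.

Lemma iter_mob_conj p phi n z : unit_disc p -> self_map phi -> unit_disc z ->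
  Nat.iter n phi z = mob p (Nat.iter n (mob_conj p phi) (mob p z)).
Proof.
intros Hp Hphi Hz; induction n as [|n IH]; [symmetry; now apply mob_invol|].
rewrite !Nat.iter_succ; unfold mob_conj at 1; rewrite <- IH, mob_invol; [easy|easy|].
now apply Hphi, iter_disc.
Qed.

Lemma mob_conj_cesaro p phi : unit_disc p -> self_map phi ->
  cesaro_convergent phi -> cesaro_convergent (mob_conj p phi).
Proof.
intros Hp Hphi HC f Hf [M HM].
destruct (HC (fun z => f (mob p z))) as [g [Hg Hlim]].
- intros z Hz; apply ex_cderive_comp; [apply Hf, mob_disc; easy|apply mob_self_map; easy].
- exists M; intros z Hz; apply HM, mob_disc; easy.
- exists (fun z => g (mob p z)); split.
  + intros z Hz; apply ex_cderive_comp; [apply Hg, mob_disc; easy|apply mob_self_map; easy].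
  + intros eps He; destruct (Hlim eps He) as [N HN]; exists N; intros n Hn z Hz.
    specialize (HN n Hn (mob p z) (mob_disc p z Hp Hz)).
    replace (avg (fun m => f (Nat.iter m (mob_conj p phi) z)) n) with
      (avg (fun m => f (mob p (Nat.iter m phi (mob p z)))) n); [exact HN|].
    unfold avg; f_equal; apply csum_ext; intros k _; f_equal.
    rewrite (iter_mob_conj p phi), (mob_invol p z), mob_invol; try easy.
    * apply iter_disc; [now apply mob_conj_self_map|easy].
    * now apply mob_disc.
Qed.

Lemma iter_surjective phi n w : disc_automorphism phi -> unit_disc w ->
  exists z, unit_disc z /\ Nat.iter n phi z = w.
Proof.
intros [_ [_ Hs]]; revert w; induction n as [|n IH]; intros w Hw; [now exists w|].
destruct (Hs w Hw) as [y [Hy <-]]; destruct (IH y Hy) as [z [Hz <-]]; now exists z.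
Qed.

(** Iterates of an automorphism are onto, so uniform convergence would put the whole disc within 1/4
    of p; but 0 and 3/4 are too far apart. *)
Lemma uniform_limit_denjoy_wolff phi p : unit_disc p ->
  iterates_converge_uniformly_on unit_disc phi p -> denjoy_wolff_point phi p.
Proof.
intros Hp Hu; split; [|split; [now left|]].
- intros [l [Ha _]]; destruct (Hu (1 / 4)) as [N HN]; [lra|].
  assert (K : forall w, unit_disc w -> Cmod (w - p) < 1 / 4).
  { intros w Hw; destruct (iter_surjective phi N w Ha Hw) as [z [Hz <-]]; now apply HN. }
  assert (K0 := K _ unit_disc_0).
  assert (K1 := K (RtoC (3 / 4)) ltac:(unfold unit_disc; rewrite Cmod_R, Rabs_pos_eq; lra)).
  assert (T := Cmod_triangle_sub (RtoC (3 / 4)) p 0); rewrite (Cmod_minus_sym p 0) in T.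
  replace (RtoC (3 / 4) - 0)%C with (RtoC (3 / 4)) in T by ring.
  rewrite Cmod_R, Rabs_pos_eq in T; lra.
- intros A _ HA eps He; destruct (Hu eps He) as [N HN]; exists N; intros n Hn z Hz; auto.
Qed.

Lemma rotation_elliptic phi p l : unit_disc p -> self_map phi -> Cmod l = 1 ->
  (forall z, unit_disc z -> mob_conj p phi z = (l * z)%C) -> elliptic_with phi l.
Proof.
intros Hp Hphi Hl Hrot.
assert (E : forall z, unit_disc z -> phi z = mob p (l * mob p z)%C).
{ intros z Hz; rewrite (mob_conj_invol p phi z), Hrot by (try apply mob_disc; easy); easy. }
assert (Dl : forall z, unit_disc z -> unit_disc (l * z)%C).
{ intros z Hz; unfold unit_disc; rewrite Cmod_mult, Hl, Rmult_1_l; exact Hz. }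
assert (Il : (Cconj l * l)%C = RtoC 1) by (rewrite Cconj_mult_self, Hl; f_equal; ring).
split; [|split; [easy|]].
- split; [easy|split].
  + intros z w Hz Hw; rewrite !E by easy; intros F.
    apply (f_equal (mob p)) in F; rewrite !mob_invol in F by (try apply Dl, mob_disc; easy).
    apply (f_equal (fun x => mob p (Cconj l * x))) in F; rewrite !Cmult_assoc, Il, !Cmult_1_l in F.
    rewrite !mob_invol in F; easy.
  + intros w Hw.
    assert (Dm : unit_disc (Cconj l * mob p w)%C).
    { unfold unit_disc; rewrite Cmod_mult, Cmod_conj, Hl, Rmult_1_l; now apply mob_disc. }
    exists (mob p (Cconj l * mob p w)%C); split; [now apply mob_disc|].
    rewrite E, mob_invol, Cmult_assoc, (Cmult_comm l), Il, Cmult_1_l, mob_invol;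
      try easy; now apply mob_disc.
- exists (mob p), (mob p); split; [now apply mob_automorphism|split; [|easy]].
  intros z Hz; split; [now apply mob_disc|now apply mob_invol].
Qed.

Theorem cesaro_dichotomy phi : self_map phi -> cesaro_convergent phi ->
  (exists z0, denjoy_wolff_point phi z0 /\ unit_disc z0 /\
     iterates_converge_uniformly_on unit_disc phi z0) \/
  periodic_elliptic_automorphism phi.
Proof.
intros Hphi HC.
destruct (classic (exists p, unit_disc p /\ phi p = p)) as [[p [Hp Hfix]]|Hno].
2: { exfalso; apply (no_fixed_point_not_cesaro phi Hphi); [|easy].
  intros z Hz E; apply Hno; now exists z. }
set (psi := mob_conj p phi).
assert (Hpsi : self_map psi) by now apply mob_conj_self_map.
assert (HCpsi : cesaro_convergent psi) by now apply mob_conj_cesaro.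
assert (Hpsi0 : psi (RtoC 0) = RtoC 0).
{ unfold psi, mob_conj; rewrite mob_0, Hfix; apply mob_self. }
destruct (proj2 Hpsi (RtoC 0) unit_disc_0 : exists l : C, is_cderive psi (RtoC 0) l) as [l Hl].
assert (Bl := divz_bound psi l Hpsi Hpsi0 Hl (RtoC 0) unit_disc_0); rewrite divz_0 in Bl.
destruct (Rle_lt_or_eq_dec _ _ Bl) as [Ll|El].
- left; assert (U := attracting_cesaro psi l Hpsi Hpsi0 Hl Ll HCpsi).
  assert (Uphi : iterates_converge_uniformly_on unit_disc phi p).
  { intros eps He; unfold unit_disc in Hp.
    (* The factor cancels the constant 2 / (1 - |p|) of [mob_dist]. *)
    destruct (U (eps * ((1 - Cmod p) / 2))) as [N HN].
    { apply Rmult_lt_0_compat; lra. }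
    exists N; intros n Hn z Hz; rewrite (iter_mob_conj p phi) by easy.
    assert (Dm := mob_disc p z Hp Hz); specialize (HN n Hn _ Dm); fold psi.
    replace (Nat.iter n psi (mob p z) - 0)%C with (Nat.iter n psi (mob p z)) in HN by ring.
    eapply Rle_lt_trans; [apply mob_dist; [easy|now apply iter_disc]|].
    apply (Rmult_lt_compat_r (2 / (1 - Cmod p))) in HN; [|apply Rdiv_lt_0_compat; lra].
    replace (eps * ((1 - Cmod p) / 2) * (2 / (1 - Cmod p))) with eps in HN by (field; lra); easy. }
  exists p; split; [now apply uniform_limit_denjoy_wolff|easy].
- right; assert (Rot := schwarz_rotation psi l Hpsi Hpsi0 Hl El).
  exists l; split; [now apply (rotation_elliptic phi p)|].
  apply NNPP; intros Hroot; apply (rotation_not_cesaro psi l); try easy.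
  intros n Hn E; apply Hroot; now exists n.
Qed.

(** * From the dynamics to uniform mean ergodicity *)

Lemma Hinf_norm_pointwise (f : Hinf) M : norm f <= M <-> forall z, unit_disc z -> Cmod (f z) <= M.
Proof.
split; [|apply Hinf_norm_le].
intros H z Hz; apply Rle_trans with (2 := H); now apply Hinf_norm_ge.
Qed.

(** [real] sends an infinite supremum to 0, so [operator_norm] is meaningful only once a bound on
    the unit ball is known. *)
Lemma operator_norm_lub (X : NormedModule C_AbsRing) (T : X -> X) M :
  (forall x, norm x <= 1 -> norm (T x) <= M) ->
  0 <= operator_norm T <= M /\ forall x, norm x <= 1 -> norm (T x) <= operator_norm T.
Proof.
intros H; unfold operator_norm; set (E := fun r => _).
destruct (Lub_Rbar_correct E) as [U L].
assert (H0 : E (norm (T zero))).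
{ exists zero; split; [rewrite norm_zero; lra|easy]. }
assert (LM : Rbar_le (Lub_Rbar E) M).
{ apply L; intros r [x [Hx ->]]; now apply H. }
destruct (Lub_Rbar E) as [r| |]; simpl in *; [|contradiction|now specialize (U _ H0)].
split; [split; [|easy]|].
- apply Rle_trans with (norm (T zero)); [apply norm_ge_0|exact (U _ H0)].
- intros x Hx; apply U; now exists x.
Qed.

Lemma uniformly_mean_ergodic_intro (X : NormedModule C_AbsRing) (T P : X -> X) :
  is_linear T -> is_linear P ->
  (forall eps, 0 < eps -> exists N, forall n, (N <= n)%nat -> forall x, norm x <= 1 ->
     norm (minus (cesaro_mean T n x) (P x)) <= eps) -> uniformly_mean_ergodic T.
Proof.
intros HT HP H; split; [easy|]; exists P; split; [easy|].
apply is_lim_seq_Reals; intros eps He; destruct (H (eps / 2)) as [N HN]; [lra|].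
exists N; intros n Hn; unfold Rdist; rewrite Rminus_0_r.
destruct (operator_norm_lub X (fun x => minus (cesaro_mean T n x) (P x)) (eps / 2) (HN n Hn))
  as [B _].
rewrite Rabs_pos_eq; lra.
Qed.

Lemma avg_bound u n M : 0 <= M -> (forall k, Cmod (u k) <= M) -> Cmod (avg u n) <= M.
Proof.
intros HM H; destruct n as [|n].
- unfold avg; simpl csum; rewrite Cmult_0_r, Cmod_0; easy.
- replace (avg u (S n)) with (avg u (S n) - 0)%C by ring.
  apply Rle_trans with (INR (S n) * M / INR (S n) + 0).
  + apply avg_near; [lia| |intros; lia|lra].
    intros k _; replace (u k - 0)%C with (u k) by ring; auto.
  + right; field; apply not_0_INR; lia.
Qed.

Lemma avg_plus u v n : avg (fun m => u m + v m)%C n = (avg u n + avg v n)%C.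
Proof.
unfold avg; rewrite (csum_plus (fun m => u (S m)) (fun m => v (S m))); ring.
Qed.

Lemma avg_scal c u n : avg (fun m => c * u m)%C n = (c * avg u n)%C.
Proof. unfold avg; rewrite (csum_scal c (fun m => u (S m))); ring. Qed.

Lemma avg_ext u v n : (forall m, u m = v m) -> avg u n = avg v n.
Proof. intros H; unfold avg; f_equal; apply csum_ext; auto. Qed.

Lemma cesaro_mean_is_linear phi (Hphi : self_map phi) n :
  is_linear (cesaro_mean (composition_operator Hphi) n).
Proof.
split.
- intros f g; apply Hinf_ext; intros z Hz; rewrite plus_HinfE, !cesaro_meanE by easy.
  rewrite <- avg_plus; apply avg_ext; intros m; apply plus_HinfE, iter_disc; easy.
- intros c f; apply Hinf_ext; intros z Hz; rewrite scal_HinfE, !cesaro_meanE by easy.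
  rewrite <- avg_scal; apply avg_ext; intros m; apply scal_HinfE, iter_disc; easy.
- exists 1; split; [lra|]; intros f; apply Hinf_norm_le; intros z Hz.
  rewrite cesaro_meanE, Rmult_1_l by easy; apply avg_bound; [apply norm_ge_0|].
  intros k; apply Hinf_norm_ge, iter_disc; easy.
Qed.

Lemma uniformly_mean_ergodic_mean_ergodic phi (Hphi : self_map phi) :
  uniformly_mean_ergodic (composition_operator Hphi) -> mean_ergodic (composition_operator Hphi).
Proof.
intros [HT [P [HP Hlim]]]; split; [easy|]; exists P; split; [easy|]; intros x.
set (T := composition_operator Hphi) in *.
destruct (linear_norm P HP) as [M [HM HPM]].
(* A priori finiteness: without it, a small [operator_norm] could be the default value of an
   infinite supremum. *)
assert (Hbd : forall n y, norm y <= 1 -> norm (minus (cesaro_mean T n y) (P y)) <= 1 + M).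
{ intros n y Hy.
  apply Hinf_norm_pointwise; intros z Hz; rewrite minus_HinfE by easy.
  assert (Tr := Cmod_triangle (cesaro_mean T n y z) (- P y z)); rewrite Cmod_opp in Tr.
  assert (A : Cmod (cesaro_mean T n y z) <= 1).
  { unfold T; rewrite cesaro_meanE by easy; apply avg_bound; [lra|].
    intros k; apply (proj1 (Hinf_norm_pointwise y 1) Hy), iter_disc; easy. }
  assert (B : Cmod (P y z) <= M).
  { apply (proj1 (Hinf_norm_pointwise (P y) M)); [|easy].
    specialize (HPM y); assert (Q := norm_ge_0 y); apply Rle_trans with (1 := HPM); nra. }
  unfold Cminus; lra. }
(* Dividing by |x| + 1 puts x in the unit ball and also covers x = 0. *)
set (K := norm x + 1); assert (HK : 0 < K) by (unfold K; assert (Q := norm_ge_0 x); lra).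
apply filterlim_locally; intros eps.
apply is_lim_seq_Reals in Hlim; destruct (Hlim (eps / K)) as [N HN].
{ apply Rdiv_lt_0_compat; [apply cond_pos|easy]. }
exists N; intros n Hn; specialize (HN n Hn); unfold Rdist in HN; rewrite Rminus_0_r in HN.
destruct (operator_norm_lub _ (fun x => minus (cesaro_mean T n x) (P x)) (1 + M) (Hbd n)) as [B0 B1].
rewrite Rabs_pos_eq in HN by lra.
set (y := scal (RtoC (/ K) : C_AbsRing) x).
assert (Hy : norm y <= 1).
{ eapply Rle_trans; [apply norm_scal|]; change (Cmod (RtoC (/ K)) * norm x <= 1).
  rewrite Cmod_R, Rabs_pos_eq by (left; now apply Rinv_0_lt_compat).
  apply Rmult_le_reg_l with K; [easy|]; rewrite <- Rmult_assoc, Rinv_r by lra; unfold K; lra. }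
specialize (B1 y Hy).
change (norm (minus (cesaro_mean T n x) (P x)) < eps).
apply Rle_lt_trans with (K * operator_norm (fun x => minus (cesaro_mean T n x) (P x))).
- assert (Q := proj1 (Hinf_norm_pointwise _ _) B1).
  apply Hinf_norm_pointwise; intros z Hz; specialize (Q z Hz).
  rewrite minus_HinfE in Q |- * by easy.
  assert (E1 : cesaro_mean T n y = scal (RtoC (/ K) : C_AbsRing) (cesaro_mean T n x)).
  { apply (linear_scal _ (cesaro_mean_is_linear phi Hphi n)). }
  assert (E2 : P y = scal (RtoC (/ K) : C_AbsRing) (P x)) by apply (linear_scal P HP).
  rewrite E1, E2, !scal_HinfE in Q by easy.
  replace (RtoC (/ K) * cesaro_mean T n x z - RtoC (/ K) * P x z)%C with
    (RtoC (/ K) * (cesaro_mean T n x z - P x z))%C in Q by ring.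
  rewrite Cmod_mult, Cmod_R, Rabs_pos_eq in Q by (left; now apply Rinv_0_lt_compat).
  apply (Rmult_le_compat_l K) in Q; [|lra].
  rewrite <- Rmult_assoc, Rinv_r, Rmult_1_l in Q by lra; exact Q.
- apply (Rmult_lt_compat_l K) in HN; [|easy].
  replace (K * (eps / K)) with (pos eps) in HN by (field; lra); exact HN.
Qed.

(** Schwarz-Pick for f / 2; halving keeps the values in the open disc and away from the circle. The
    constant 4 is this factor 2 times the bound 2 on |1 - conj(h(z)) h(w)|. *)
Lemma Hinf_lipschitz (f : Hinf) z w : norm f <= 1 -> unit_disc z -> unit_disc w ->
  Cmod (f w - f z) <= 4 / (1 - Cmod z) * Cmod (w - z).
Proof.
intros Hf Hz Hw; assert (Bf := proj1 (Hinf_norm_pointwise f 1) Hf).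
set (h := fun x => (RtoC (1 / 2) * f x)%C).
assert (Hb : forall x, unit_disc x -> Cmod (h x) <= 1 / 2).
{ intros x Hx; unfold h; rewrite Cmod_mult, Cmod_R, Rabs_pos_eq by lra; specialize (Bf x Hx); lra. }
assert (Hh : self_map h).
{ split; [intros x Hx; specialize (Hb x Hx); unfold unit_disc; lra|].
  intros x Hx; apply ex_cderive_mult; [apply ex_cderive_const|now apply Hinf_holomorphic]. }
assert (S := schwarz_pick_mob h w z Hh Hw Hz); unfold mob in S.
assert (N1 := mob_denom_neq z w Hz (Rlt_le _ _ Hw)).
assert (N2 := mob_denom_neq (h z) (h w) (proj1 Hh z Hz) (Rlt_le _ _ (proj1 Hh w Hw))).
assert (G1 := mob_denom_ge z w Hz (Rlt_le _ _ Hw)).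
rewrite !Cmod_div in S by easy.
assert (P2 := proj1 (Cmod_gt_0 _) N2); assert (P1 := proj1 (Cmod_gt_0 _) N1).
assert (U2 : Cmod (1 - Cconj (h z) * h w) <= 2).
{ assert (T := Cmod_triangle 1 (- (Cconj (h z) * h w))).
  rewrite Cmod_opp, Cmod_1, Cmod_mult, Cmod_conj in T; unfold Cminus.
  assert (Cmod (h z) * Cmod (h w) <= 1 / 2 * (1 / 2)).
  { apply Rmult_le_compat; auto using Cmod_ge_0. }
  lra. }
assert (Eh : Cmod (f w - f z) = 2 * Cmod (h z - h w)).
{ unfold h; replace (RtoC (1 / 2) * f z - RtoC (1 / 2) * f w)%C with (RtoC (1 / 2) * (f z - f w))%C by ring.
  rewrite Cmod_mult, Cmod_R, Rabs_pos_eq, (Cmod_minus_sym (f w)) by lra; field. }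
rewrite Eh, (Cmod_minus_sym w z).
assert (Q : Cmod (h z - h w) <= Cmod (z - w) / Cmod (1 - Cconj z * w) * 2).
{ apply Rle_trans with (Cmod (z - w) / Cmod (1 - Cconj z * w) * Cmod (1 - Cconj (h z) * h w)).
  - apply (Rmult_le_compat_r (Cmod (1 - Cconj (h z) * h w))) in S; [|lra].
    unfold Rdiv in S at 1; rewrite Rmult_assoc, Rinv_l, Rmult_1_r in S by lra; exact S.
  - apply Rmult_le_compat_l; [|easy]; apply Rdiv_le_0_compat; [apply Cmod_ge_0|easy]. }
unfold unit_disc in Hz.
assert (V : Cmod (z - w) / Cmod (1 - Cconj z * w) <= Cmod (z - w) / (1 - Cmod z)).
{ apply Rmult_le_compat_l; [apply Cmod_ge_0|]; apply Rinv_le_contravar; lra. }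
replace (4 / (1 - Cmod z) * Cmod (z - w)) with (2 * (Cmod (z - w) / (1 - Cmod z) * 2)) by (field; lra).
lra.
Qed.

(** The limit operator sends f to the constant f(p). The Lipschitz constant at p is common to the
    whole unit ball, which makes the convergence one in operator norm. *)
Lemma attracting_uniformly_mean_ergodic phi (Hphi : self_map phi) p : unit_disc p ->
  iterates_converge_uniformly_on unit_disc phi p ->
  uniformly_mean_ergodic (composition_operator Hphi).
Proof.
intros Hp Hu.
assert (Hh : forall f : Hinf, holomorphic_on_disc (fun _ => f p)).
{ intros f z _; apply ex_cderive_const. }
assert (Hb : forall f : Hinf, exists M, forall z, unit_disc z -> Cmod (f p) <= M).
{ intros f; exists (Cmod (f p)); intros; lra. }
apply (uniformly_mean_ergodic_intro _ _ (fun f => Hinf_make (Hh f) (Hb f))).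
- apply composition_operator_is_linear.
- split.
  + intros f g; apply Hinf_ext; intros z Hz; rewrite plus_HinfE, !Hinf_makeE by easy.
    now apply plus_HinfE.
  + intros c f; apply Hinf_ext; intros z Hz; rewrite scal_HinfE, !Hinf_makeE by easy.
    now apply scal_HinfE.
  + exists 1; split; [lra|]; intros f; apply Hinf_norm_le; intros z Hz.
    rewrite Hinf_makeE, Rmult_1_l by easy; now apply Hinf_norm_ge.
- intros eps He; unfold unit_disc in Hp; set (L := 4 / (1 - Cmod p)).
  assert (HL : 0 < L) by (apply Rdiv_lt_0_compat; lra).
  destruct (Hu (eps / 2 / L)) as [N HN]; [apply Rdiv_lt_0_compat; lra|].
  destruct (archimed_div (INR N * (2 * 1)) (eps / 2)) as [N' [HN1 HN']]; [lra|].
  exists N'; intros n Hn f Hf; assert (Bf := proj1 (Hinf_norm_pointwise f 1) Hf).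
  apply Hinf_norm_pointwise; intros z Hz.
  rewrite minus_HinfE, cesaro_meanE, Hinf_makeE by easy.
  apply Rle_trans with (INR N * (2 * 1) / INR n + eps / 2); [|specialize (HN' n Hn); lra].
  apply avg_near; [lia| | |lra].
  + intros k _; apply Cmod_bound_diff; apply Bf; [now apply iter_disc|easy].
  + intros k Hk; specialize (HN k ltac:(lia) z Hz).
    eapply Rle_trans; [apply (Hinf_lipschitz f p); [easy|easy|now apply iter_disc]|]; fold L.
    apply (Rmult_lt_compat_l L) in HN; [|easy].
    replace (L * (eps / 2 / L)) with (eps / 2) in HN by (field; lra); lra.
Qed.

Lemma elliptic_iterates phi l : elliptic_with phi l -> forall n, (l ^ n)%C = RtoC 1 ->
  forall z, unit_disc z -> Nat.iter n phi z = z.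
Proof.
intros [_ [Hl [h [k [[Hh [Hinj _]] [Hk Hphi]]]]]] n Hn z Hz.
assert (Dl : forall m y, unit_disc y -> unit_disc (l ^ m * y)%C).
{ intros m y Hy; unfold unit_disc; rewrite Cmod_mult, Cmod_pow, Hl, pow1, Rmult_1_l; exact Hy. }
(* [k] is given only as a right inverse; injectivity of [h] makes it two-sided on the disc. *)
assert (Kh : forall y, unit_disc y -> k (h y) = y).
{ intros y Hy; destruct (Hk (h y)) as [D E]; [now apply Hh|]; now apply Hinj. }
destruct (Hk z Hz) as [Dz Ez].
assert (It : forall m, Nat.iter m phi z = h (l ^ m * k z)%C).
{ induction m as [|m IH]; simpl; [now rewrite Cmult_1_l|].
  rewrite IH, Hphi, Kh, Cmult_assoc by (try apply Hh; now apply Dl); easy. }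
now rewrite It, Hn, Cmult_1_l.
Qed.

(** The defect [d n] between the n-th partial sum and n times the mean over a period is itself
    N-periodic, hence bounded independently of n. *)
Lemma avg_periodic u N n : (1 <= N)%nat -> (1 <= n)%nat ->
  (forall k, u (N + k)%nat = u k) -> (forall k, Cmod (u k) <= 1) ->
  Cmod (avg u n - avg u N) <= 2 * INR N / INR n.
Proof.
intros HN Hn Hper Hb; set (a := avg u N).
set (d := fun n => (csum (fun m => u (S m)) n - RtoC (INR n) * a)%C).
assert (Ha : (RtoC (INR N) * a)%C = csum (fun m => u (S m)) N).
{ unfold a, avg; assert (Q := RtoC_INR_neq N HN).
  rewrite RtoC_inv by (intros E; apply Q; now rewrite E); field; easy. }
assert (Hd : forall m, d (N + m)%nat = d m).
{ intros m; unfold d; rewrite csum_split, plus_INR, RtoC_plus.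
  rewrite (csum_ext (fun i => u (S (N + i))) (fun i => u (S i)))
    by (intros i _; rewrite <- Nat.add_succ_r; apply Hper).
  replace ((RtoC (INR N) + RtoC (INR m)) * a)%C with (RtoC (INR N) * a + RtoC (INR m) * a)%C by ring.
  rewrite Ha; ring. }
assert (Ba : Cmod a <= 1) by (apply avg_bound; [lra|easy]).
assert (Bd : forall m, Cmod (d m) <= 2 * INR N).
{ intros m; induction m as [m IH] using Wf_nat.lt_wf_ind.
  destruct (Nat.lt_ge_cases m N) as [L|L].
  - assert (Lm : INR m <= INR N) by (apply le_INR; lia).
    assert (T := Cmod_triangle (csum (fun m => u (S m)) m) (- (RtoC (INR m) * a))).
    rewrite Cmod_opp, Cmod_mult, Cmod_R, Rabs_pos_eq in T by apply pos_INR.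
    assert (C1 := Cmod_csum (fun m => u (S m)) m).
    assert (C2 : rsum (fun k => Cmod (u (S k))) m <= rsum (fun _ => 1) m) by (apply rsum_le; auto).
    rewrite rsum_const in C2; assert (P := pos_INR m); unfold d, Cminus; nra.
  - replace m with (N + (m - N))%nat by lia; rewrite Hd; apply IH; lia. }
assert (Q := RtoC_INR_neq n Hn).
assert (Pn : 0 < INR n) by (apply lt_0_INR; lia).
replace (avg u n - a)%C with (RtoC (/ INR n) * d n)%C.
- rewrite Cmod_mult, Cmod_R, Rabs_pos_eq, Rmult_comm by (left; now apply Rinv_0_lt_compat).
  apply Rmult_le_compat_r; [left; now apply Rinv_0_lt_compat|easy].
- unfold d, avg; rewrite RtoC_inv by (intros E; apply Q; now rewrite E); field; easy.
Qed.

(** The limit operator is the N-th Cesaro mean itself, the average over one period. *)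
Lemma periodic_uniformly_mean_ergodic phi (Hphi : self_map phi) :
  periodic_elliptic_automorphism phi -> uniformly_mean_ergodic (composition_operator Hphi).
Proof.
intros [l [Hl [N [HN Hroot]]]]; assert (Hper := elliptic_iterates phi l Hl N Hroot).
apply (uniformly_mean_ergodic_intro _ _ (cesaro_mean (composition_operator Hphi) N)).
- apply composition_operator_is_linear.
- apply cesaro_mean_is_linear.
- intros eps He; destruct (archimed_div (2 * INR N) eps He) as [N' [HN1 HN']].
  exists N'; intros n Hn f Hf; assert (Bf := proj1 (Hinf_norm_pointwise f 1) Hf).
  apply Hinf_norm_pointwise; intros z Hz; rewrite minus_HinfE, !cesaro_meanE by easy.
  apply Rle_trans with (2 := HN' n Hn); apply avg_periodic; [easy|lia| |].
  + intros k; rewrite Nat.iter_add, Hper; [easy|now apply iter_disc].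
  + intros k; apply Bf, iter_disc; easy.
Qed.

Theorem theoremA (phi : C -> C) (Hphi : self_map phi) :
  (mean_ergodic (composition_operator Hphi) <->
   uniformly_mean_ergodic (composition_operator Hphi)) /\
  (uniformly_mean_ergodic (composition_operator Hphi) <->
   ((exists z0 : C, denjoy_wolff_point phi z0 /\ unit_disc z0 /\
       iterates_converge_uniformly_on unit_disc phi z0) \/
    periodic_elliptic_automorphism phi)).
Proof.
assert (H1 := uniformly_mean_ergodic_mean_ergodic phi Hphi).
assert (H2 := fun H => cesaro_dichotomy phi Hphi (mean_ergodic_cesaro phi Hphi H)).
assert (H3 : ((exists z0 : C, denjoy_wolff_point phi z0 /\ unit_disc z0 /\
       iterates_converge_uniformly_on unit_disc phi z0) \/
    periodic_elliptic_automorphism phi) -> uniformly_mean_ergodic (composition_operator Hphi)).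
{ intros [[p [_ [Hp Hu]]]|Hper].
  - now apply attracting_uniformly_mean_ergodic with p.
  - now apply periodic_uniformly_mean_ergodic. }
tauto.
Qed.
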